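(* There is a deterministic algorithm that, given an unweighted directed graph $G=(V,E)$ with $n$ vertices subject to edge insertions, a vertex $s\in V$, and $\varepsilon>0$, maintains for every vertex $v$ an estimate $\hat{d}(v)$ such that after every update $d(s,v)\leq \hat{d}(v)\leq (1+\varepsilon)\,d(s,v)$, and runs in total time $O(n^2\log^5 n/\varepsilon)$. A query for an approximate shortest path from $s$ to any vertex $v$ can be answered in time linear in the number of edges on the path.
   Context: $d(s,v)$ is the shortest-path distance from $s$ to $v$ in the current graph. Total time is over the whole update sequence.
   Formalization: The time bound is proved as O(n² log⁵ n / min(ε,1)), since for very large ε the stated bound falls below the time to read n² insertions; ε is a positive rational given as a fraction, inserted edges are distinct and not already present, and the time bound is for n ≥ 2. *)

(* Defs.v *)
From HB Require Import structures.
From mathcomp Require Import all_boot all_order all_algebra.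

Set Implicit Arguments.
Unset Strict Implicit.
Unset Printing Implicit Defensive.

Import Order.TTheory GRing.Theory Num.Theory.

(* Word RAM with word size w, presented as a structured while-language.  A    *)
(* program is a fixed finite text, so it uses finitely many registers and     *)
(* finitely many memory banks (arrays); addresses and contents are w-bit      *)
(* words, every elementary operation works modulo 2 ^ w and costs one unit.   *)

Inductive binop := Add | Sub | Mul | Div | Mod | Lt | Eq.

Inductive expr :=
  | Const of nat
  | Reg of nat
  | Fetch of nat & expr          (* bank, address *)
  | Bin of binop & expr & expr.

Inductive cmd :=
  | Skip
  | Assign of nat & expr
  | Store of nat & expr & expr  (* bank, address, value *)
  | Seq of cmd & cmd
  | If of expr & cmd & cmd
  | While of expr & cmd.

Record state := State { regs : nat -> nat; banks : nat -> nat -> nat }.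

Definition eval_binop (w : nat) (o : binop) (x y : nat) : nat :=
  match o with
  | Add => (x + y) %% 2 ^ w
  | Sub => (x + (2 ^ w - y)) %% 2 ^ w
  | Mul => (x * y) %% 2 ^ w
  | Div => (x %/ y) %% 2 ^ w
  | Mod => (x %% y) %% 2 ^ w
  | Lt => (x < y) %% 2 ^ w
  | Eq => (x == y) %% 2 ^ w
  end.

Fixpoint eval (w : nat) (st : state) (e : expr) : nat :=
  match e with
  | Const k => k %% 2 ^ w
  | Reg r => regs st r
  | Fetch b a => banks st b (eval w st a)
  | Bin o e1 e2 => eval_binop w o (eval w st e1) (eval w st e2)
  end.

Fixpoint ecost (e : expr) : nat :=
  match e with
  | Const _ | Reg _ => 1
  | Fetch _ a => (ecost a).+1
  | Bin _ e1 e2 => (ecost e1 + ecost e2).+1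
  end.

Definition set_reg (st : state) (r x : nat) : state :=
  State [eta regs st with r |-> x] (banks st).

Definition set_cell (st : state) (b a x : nat) : state :=
  State (regs st)
    (fun b' a' => if (b' == b) && (a' == a) then x else banks st b' a').

(* [exec w c st st' t]: on word size w, command c started in st halts in st'  *)
(* after t time units.                                                        *)
Inductive exec (w : nat) : cmd -> state -> state -> nat -> Prop :=
  | ExecSkip st : exec w Skip st st 1
  | ExecAssign r e st :
      exec w (Assign r e) st (set_reg st r (eval w st e)) (ecost e).+1
  | ExecStore b a e st :
      exec w (Store b a e) st (set_cell st b (eval w st a) (eval w st e))
        (ecost a + ecost e).+1
  | ExecSeq c1 c2 st st1 st2 t1 t2 :
      exec w c1 st st1 t1 -> exec w c2 st1 st2 t2 ->
      exec w (Seq c1 c2) st st2 (t1 + t2)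
  | ExecIfTrue e c1 c2 st st' t :
      eval w st e <> 0 -> exec w c1 st st' t ->
      exec w (If e c1 c2) st st' (ecost e + t).+1
  | ExecIfFalse e c1 c2 st st' t :
      eval w st e = 0 -> exec w c2 st st' t ->
      exec w (If e c1 c2) st st' (ecost e + t).+1
  | ExecWhileTrue e c st st1 st2 t1 t2 :
      eval w st e <> 0 -> exec w c st st1 t1 ->
      exec w (While e c) st1 st2 t2 ->
      exec w (While e c) st st2 (ecost e + t1 + t2).+1
  | ExecWhileFalse e c st :
      eval w st e = 0 -> exec w (While e c) st st (ecost e).+1.

Lemma exec_det (w : nat) (c : cmd) (st st1 st2 : state) (t1 t2 : nat) :
  exec w c st st1 t1 -> exec w c st st2 t2 -> st1 = st2 /\ t1 = t2.
Proof.
move=> h; elim: h st2 t2 => {c st st1 t1} [st|r e st|b a e st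
  |c1 c2 st st1 st1' t1 t1' _ IH1 _ IH2|e c1 c2 st st' t ne _ IH
  |e c1 c2 st st' t eq0 _ IH|e c st st1 st1' t1 t1' ne _ IH1 _ IH2
  |e c st eq0] st2 t2 h; inversion h; subst => //.
- match goal with
  | h1 : exec w c1 _ _ _, h2 : exec w c2 _ _ _ |- _ =>
    by case: (IH1 _ _ h1) => ? ?; subst; case: (IH2 _ _ h2) => -> ->
  end.
- by match goal with h1 : exec w c1 _ _ _ |- _ => case: (IH _ _ h1) => -> -> end.
- by match goal with h1 : exec w c2 _ _ _ |- _ => case: (IH _ _ h1) => -> -> end.
- match goal with
  | h1 : exec w c _ _ _, h2 : exec w (While e c) ?x _ _ |- _ =>
    by case: (IH1 _ _ h1) => ? ?; subst; case: (IH2 _ _ h2) => -> ->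
  end.
Qed.

Section Distance.

Variables (V : finType) (e : rel V).

Definition walk (x y : V) (k : nat) : bool :=
  [exists p : k.-tuple V, path e x p && (last x p == y)].

Lemma connect_walk (x y : V) : connect e x y -> exists k, walk x y k.
Proof.
case/connectP=> p ep ->; exists (size p); apply/existsP; exists (in_tuple p).
by rewrite ep eqxx.
Qed.

(* Shortest-path distance; None stands for infinity. *)
Definition dist (x y : V) : option nat :=
  if @idP (connect e x y) is ReflectT cxy then Some (ex_minn (connect_walk cxy))
  else None.

End Distance.

(* d <= dh <= (1 + eps) d in [0, +oo], with None standing for infinity. *)
Definition approximates (eps : rat) (d dh : option nat) : Prop :=
  match d, dh with
  | Some k, Some kh => k <= kh /\ (kh%:R <= (1 + eps) * k%:R)%R
  | None, None => True
  | _, _ => False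
  end.

(* A dynamic-graph algorithm: one program run on the initial graph, one run   *)
(* at each edge insertion, one run at each path query.  Registers and banks   *)
(* persist between runs.  Calling convention (all other initial contents are  *)
(* 0):                                                                        *)
(*   init   : registers 0..4 hold n, s, the numerator and the denominator of  *)
(*            eps, and the number of initial edges; cells 2i and 2i+1 of bank *)
(*            0 hold the tail and the head of the i-th initial edge.          *)
(*   insert : registers 0, 1 hold the tail and the head of the new edge.      *)
(*   query  : register 0 holds the target vertex; the answer is left in       *)
(*            register 0 and bank 2 (see [answers]).                          *)
(* The estimate of vertex v is kept in cell v of bank 1 (see [estimate]).     *)
Record algorithm := Algorithm { init : cmd; insert : cmd; query : cmd }.

Section DynamicGraph.

Variable n : nat.

Inductive op :=
  | Insert of 'I_n & 'I_n
  | Query of 'I_n.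

Definition inserted (ops : seq op) : seq ('I_n * 'I_n) :=
  pmap (fun o => if o is Insert u v then Some (u, v) else None) ops.

Definition graph_rel (E : seq ('I_n * 'I_n)) : rel 'I_n :=
  [rel u v | (u, v) \in E].

Definition input (s : 'I_n) (eps : rat) (E0 : seq ('I_n * 'I_n)) : state :=
  State
    (nth 0 [:: n; s : nat; `|numq eps|%N; `|denq eps|%N; size E0])
    (fun b => if b == 0
              then nth 0 (flatten [seq [:: val u.1; val u.2] | u : 'I_n * 'I_n <- E0])
              else fun=> 0).

(* [run w A s eps E0 ops st T]: A, started on the initial graph E0 and        *)
(* processing the operations ops online, reaches state st; T is the total     *)
(* time of the initialization and of all insertions (queries excluded).       *)
Inductive run (w : nat) (A : algorithm) (s : 'I_n) (eps : rat)
    (E0 : seq ('I_n * 'I_n)) : seq op -> state -> nat -> Prop :=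
  | RunInit st t :
      exec w (init A) (input s eps E0) st t ->
      run w A s eps E0 [::] st t
  | RunInsert ops st T (u v : 'I_n) st' t :
      run w A s eps E0 ops st T ->
      exec w (insert A) (set_reg (set_reg st 0 u) 1 v) st' t ->
      run w A s eps E0 (rcons ops (Insert u v)) st' (T + t)
  | RunQuery ops st T (v : 'I_n) st' t :
      run w A s eps E0 ops st T ->
      exec w (query A) (set_reg st 0 v) st' t ->
      run w A s eps E0 (rcons ops (Query v)) st' T.

(* A cell containing 0 encodes infinity, k.+1 encodes the finite value k. *)
Definition estimate (st : state) (v : 'I_n) : option nat :=
  if banks st 1 v is k.+1 then Some k else None.

(* Final state st of a path query to v.  Register 0 = 0: no path; register    *)
(* 0 = k.+1: cells 0..k of bank 2 list the vertices, from s to v, of a path p *)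
(* with k edges whose length is at most (1 + eps) d(s,v).                     *)
Definition answers (E : seq ('I_n * 'I_n)) (eps : rat) (s v : 'I_n)
    (st : state) (k : nat) : Prop :=
  match dist (graph_rel E) s v with
  | None => regs st 0 = 0 /\ k = 0
  | Some d => exists p : seq 'I_n,
      [/\ path (graph_rel E) s p, last s p = v, uniq (s :: p),
          size p = k & (k%:R <= (1 + eps) * d%:R)%R]
      /\ regs st 0 = k.+1
      /\ [seq banks st 2 i | i <- iota 0 k.+1] = [seq val x | x <- s :: p]
  end.

End DynamicGraph.

(* Main.v *)
Require Import Defs.
From HB Require Import structures.
From mathcomp Require Import all_boot all_order all_algebra.
From mathcomp Require Import zify.

Set Implicit Arguments.
Unset Strict Implicit.
Unset Printing Implicit Defensive.

(** Estimates are located through a table [pot] whose increment at distance d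
    is about 4n/(eps d), and the range of the table is cut into dyadic cells: a
    cell of level j has length 2^j, and the top level is a single cell.  For a
    vertex v, the level-j list of v holds the out-neighbours w for which d(w)-1
    lies in the level-j cell in which d(v) was when v was last scanned at that
    level.  Vertex v is rescanned at level j only when d(v) enters a new level-j
    cell, and only while its list is light (shorter than 2^i) at every level
    i > j.  A scan at level j therefore costs O(2^j) and happens O(pot(n) / 2^j)
    times, which gives n^2 polylog(n) / eps in total.  When d(w) leaves a cell,
    the watchers of w at that level are notified, so that a list that becomes
    light wakes up its vertex.

    For the error, let X be the estimate of t and take a path from s to t.
    Every a < X is crossed by a path edge (u, w) with d(u) <= a < d(w), and then
    a lies in the cell of u at the lowest level at which u is up to date.
    At level 0 this forces a = d(u), so such a's are at most as many as
    the edges of the path.  At a level j > 0 the cell is heavy: it contains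
    d(w')-1 for at least 2^j vertices w'.  The maximal heavy cells are disjoint,
    hence their total length is at most n, and by the increments of [pot] they
    contain at most eps X / 2 values a. *)

(** * Tables and cells *)

(** A scan at level j costs O(2^j) because it reads only the list at level j + 1, which is light.
    This is enough because cells are nested: an out-neighbour missing from that list lies in a lower
    cell at level j + 1, hence also at level j, so it needs neither relaxation nor listing. The top
    level, a single cell, lists all out-neighbours and starts the descent. Estimates are not
    distances, since an edge is not reexamined whenever its tail improves. Parent pointers still
    yield a real path no longer than the estimate, so only the upper bound needs the counting
    argument. That argument gives (1 - eps/2) X <= l, which implies X <= (1 + eps) l when eps <= 1;
    hence eps is replaced by min(eps, 1). The 4 in [pot] is 2 for the loss eps/2 times 2 because m +
    1 indices span only m gaps. Watchers are not withdrawn when a list is restarted; a stale one is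
    recognised when it is notified. Time and termination both come from one potential: estimates and
    cells only go down, and stack entries and watchers carry credit for the work they will cause. *)

Definition upd (T : Type) (f : nat -> T) x y : nat -> T :=
  fun z => if z == x then y else f z.

Definition upd2 (T : Type) (f : nat -> nat -> T) x1 x2 y : nat -> nat -> T :=
  fun z1 z2 => if (z1 == x1) && (z2 == x2) then y else f z1 z2.

(** Constant-time removal from an unordered array: the last entry moves into the slot of [w]. The
    programs combine it with a table of positions. *)
Definition swap_del (l : seq nat) (w : nat) : seq nat :=
  take (size l).-1 (set_nth 0 l (index w l) (last 0 l)).

Lemma size_swap_del l w : w \in l -> size (swap_del l w) = (size l).-1.
Proof.
rewrite -index_mem => wl; rewrite size_take size_set_nth.
rewrite (maxn_idPr wl); case: ltnP => //; case: (size l) wl => // k _ /=; lia.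
Qed.

Lemma nth_swap_del l w i : w \in l -> i < (size l).-1 ->
  nth 0 (swap_del l w) i = if i == index w l then last 0 l else nth 0 l i.
Proof. by move=> wl il; rewrite nth_take // nth_set_nth. Qed.

Lemma perm_swap_del l w : w \in l -> perm_eq l (w :: swap_del l w).
Proof.
move=> wl; have := wl; rewrite -index_mem; have := nth_index 0 wl.
have := size_swap_del wl; have := @nth_swap_del l w ^~ wl.
move: (swap_del l w) (index w l) => d p.
case/lastP: l wl => [|l t] // _; rewrite size_rcons last_rcons /= => nd sd.
rewrite nth_rcons ltnS; case: ltngtP => //= [pl wE _|pE <- _].
  have -> : d = set_nth 0 l p t.
    apply: (@eq_from_nth _ 0); first by rewrite size_set_nth sd; lia.
    by move=> i; rewrite sd => il; rewrite nd // nth_set_nth /= nth_rcons il.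
  rewrite set_nthE pl -wE perm_rcons.
  rewrite -{1}(cat_take_drop p l) (drop_nth 0 pl).
  apply/permP => a; rewrite /= !count_cat /=; lia.
have -> : d = l.
  apply: (@eq_from_nth _ 0) => // i; rewrite sd => il.
  by rewrite nd // pE ltn_eqF // nth_rcons il.
by rewrite perm_rcons.
Qed.

Lemma mem_swap_del l w x : uniq l -> w \in l ->
  (x \in swap_del l w) = (x != w) && (x \in l).
Proof.
move=> ul wl; have p := perm_swap_del wl.
have := perm_uniq p; rewrite ul /= => /esym/andP[wd _].
rewrite (perm_mem p) inE; case: eqP => [->|] //=; exact: negbTE.
Qed.

Lemma uniq_swap_del l w : uniq l -> w \in l -> uniq (swap_del l w).
Proof.
by move=> ul wl; have := perm_uniq (perm_swap_del wl); rewrite ul => /esym/andP[].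
Qed.

Lemma leq_size_bounded (l : seq nat) k : uniq l -> (forall x, x \in l -> x < k) ->
  size l <= k.
Proof.
move=> ul lk; rewrite -[k](size_iota 0); apply: uniq_leq_size => // x /lk.
by rewrite mem_iota.
Qed.

(** Each dyadic block [2^i, 2^(i+1)) has 2^i terms, all at most X %/ 2^i, so it contributes at most
    X. One logarithm of the running time comes from here. *)
Lemma harmonic_le X m : \sum_(1 <= k < 2 ^ m) X %/ k <= X * m.
Proof.
elim: m => [|m IH]; first by rewrite expn0 big_geq.
have p0 : 0 < 2 ^ m by rewrite expn_gt0.
have p1 : 2 ^ m <= 2 ^ m.+1 by rewrite leq_exp2l.
rewrite (big_cat_nat p0 p1) /= mulnS addnC; apply: leq_add => //.
apply: (@leq_trans (\sum_(2 ^ m <= k < 2 ^ m.+1) X %/ 2 ^ m)).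
  rewrite !big_nat; apply: leq_sum => k /andP[k1 _]; exact: leq_div2l.
rewrite sum_nat_const_nat expnS mul2n -addnn addnK mulnC; exact: leq_trunc_div.
Qed.

Section Tables.

Variables n num den : nat.

Definition levels := up_log 2 n.+1.

(** Distance a is looked up at entry a + 2: entry 1 is then d(s) - 1 = -1, and entry 0 is free for
    infinity. The summand 1 makes up for the truncated quotient and makes the table strictly
    increasing. *)
Definition pot i := \sum_(1 <= k < i) ((4 * n * den) %/ (num * k) + 1).

(* Entry 0 stands for the infinite estimate. *)
Definition ztable i := if i == 0 then pot n.+1 + 2 ^ levels else pot i.

(* The last width exceeds every table entry, so that the top level is a single cell. *)
Definition cell_width j := if j < levels then 2 ^ j else (ztable 0).+1.

(** Cells are numbered from 1, so that 0 as a last scanned cell can mean that no scan has taken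
    place. *)
Definition cell_of j x := (x %/ cell_width j).+1.

Lemma levelsP : n < 2 ^ levels.
Proof. exact: up_logP. Qed.

Lemma levels_gt0 : 0 < n -> 0 < levels.
Proof. by move=> n0; rewrite up_log_gt0 /= ltnS. Qed.

Lemma levels_lt : levels < 2 ^ levels.
Proof. exact: ltn_expl. Qed.

Lemma pow_levels_le : 0 < n -> 2 ^ levels <= 2 * n.
Proof.
move=> n0; have L0 := levels_gt0 n0; rewrite -(prednK L0) expnS leq_mul2l /=.
by rewrite -ltnS; apply: up_log_gtn; rewrite ?ltnS.
Qed.

Lemma potS i : 0 < i -> pot i.+1 = pot i + ((4 * n * den) %/ (num * i) + 1).
Proof. by move=> i0; rewrite /pot big_nat_recr. Qed.

Lemma pot_le_lin i : pot i <= i * (4 * n * den + 1).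
Proof.
rewrite /pot; apply: (@leq_trans (\sum_(1 <= k < i) (4 * n * den + 1))).
  by apply: leq_sum => k _; rewrite leq_add2r leq_div.
by rewrite sum_nat_const_nat leq_mul2r leq_subr orbT.
Qed.

Lemma pot_lt i j : 0 < i -> i < j -> pot i < pot j.
Proof.
move=> i0; elim: j => // j IH; rewrite ltnS leq_eqVlt => /orP[/eqP <-|ij].
  by rewrite potS // addnA addn1 ltnS leq_addr.
by rewrite potS ?(leq_ltn_trans _ ij) // ltn_addr ?IH.
Qed.

Lemma pot_le i j : 0 < i -> i <= j -> pot i <= pot j.
Proof.
by move=> i0; rewrite leq_eqVlt => /orP[/eqP ->//|ij]; apply/ltnW/pot_lt.
Qed.

(* [ble x y]: order of estimates in the encoding where 0 is infinity. *)
Definition ble x y := (y == 0) || (0 < x <= y).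

Lemma Z_le x y : x <= n.+1 -> y <= n.+1 -> ble x y -> ztable x <= ztable y.
Proof.
rewrite /ble => xn yn /orP[/eqP->|/andP[x0 xy]]; last first.
  by rewrite /ztable gtn_eqF // gtn_eqF; [exact: pot_le | lia].
rewrite {2}/ztable /=; rewrite /ztable; case: ifP => // /negbT x0.
by apply: leq_trans (leq_addr _ _); apply: pot_le => //; lia.
Qed.

Lemma Z_lt x y : 0 < x -> x < y -> ztable x < ztable y.
Proof. by move=> x0 xy; rewrite /ztable gtn_eqF // gtn_eqF; [exact: pot_lt | lia]. Qed.

Lemma Z_le0 x : x <= n.+1 -> ztable x <= ztable 0.
Proof. by move=> xn; apply: Z_le. Qed.

Lemma cell_le j x y : x <= y -> cell_of j x <= cell_of j y.
Proof. by move=> xy; rewrite ltnS leq_div2r. Qed.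

Lemma cellL x : x <= ztable 0 -> cell_of levels x = 1.
Proof. by move=> x0; rewrite /cell_of /cell_width ltnn divn_small. Qed.

(** Entry 0 lies at least 2^[levels] above every finite entry, more than any width below the top
    level; so infinity has cells of its own there. *)
Lemma cell_finite j x : j < levels -> 0 < x <= n.+1 -> cell_of j (ztable x) < cell_of j (ztable 0).
Proof.
move=> jL /andP[x0 xn]; rewrite /cell_of ltnS /cell_width jL.
have p0 : 0 < 2 ^ j by rewrite expn_gt0.
have h : ztable x + 2 ^ j <= ztable 0.
  rewrite /ztable gtn_eqF //= leq_add ?pot_le //.
  by rewrite leq_exp2l // ltnW.
by apply: (leq_trans _ (leq_div2r _ h)); rewrite divnDr ?divnn ?p0 ?addn1.
Qed.

Lemma cell_up j x y : j < levels -> x <= ztable 0 -> y <= ztable 0 ->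
  cell_of j x <= cell_of j y -> cell_of j.+1 x <= cell_of j.+1 y.
Proof.
move=> jL x0 y0; case: (ltngtP j.+1 levels) => [jL1||->]; last 2 first.
- lia.
- by rewrite !cellL.
rewrite /cell_of !ltnS /cell_width jL jL1 expnSr !divnMA; exact: leq_div2r.
Qed.

Lemma cell_inj0 x y : 0 < levels -> cell_of 0 x = cell_of 0 y -> x = y.
Proof. by move=> L0 []; rewrite /cell_width L0 !divn1. Qed.

End Tables.

(** * The invariant *)

(** Abstract memory contents: estimates shifted by one (0 is infinity), parents, last scanned cells
    (0 is never), lists, watcher lists, and the stack of vertices still to be processed. *)
Record ast := Ast {
  ab : nat -> nat;
  apar : nat -> nat;
  alast : nat -> nat -> nat;
  alst : nat -> nat -> seq nat;
  awat : nat -> nat -> seq nat;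
  astk : seq nat }.

Section Invariant.

Variables n num den s : nat.
Notation L := (levels n).
Notation Z := (ztable n num den).
Notation D := (cell_width n num den).
Notation cell := (cell_of n num den).

(* [ab] stores d(v) + 1, so these are the cells of d(w) - 1 and of d(v). *)
Definition zcell A j w := cell j (Z (ab A w)).
Definition ycell A j v := cell j (Z (ab A v).+1).

Definition settled A v := forall j, j < L ->
  (forall i, j < i <= L -> size (alst A v i) < D i) -> alast A v j = ycell A j v.

(* [pend v j w] exempts the edge (v, w) at level j while it is being scanned; *)
(* the vertices in X are exempt from being settled.                           *)
Record inv A (E : seq (nat * nat)) (pend : nat -> nat -> nat -> bool)
    (X : seq nat) : Prop := Inv {
  i_b : forall v, v < n -> ab A v <= count (fun x => ab A x != 0) (iota 0 n);
  i_s : ab A s = 1;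
  i_E : forall u w, (u, w) \in E -> u < n /\ w < n;
  i_par : forall v, v < n -> 0 < ab A v -> v != s ->
    [/\ apar A v < n, (apar A v, v) \in E & 0 < ab A (apar A v) < ab A v];
  i_lastL : forall v, v < n -> alast A v L = 1;
  i_last : forall v j, v < n -> j < L -> 0 < alast A v j ->
    0 < ab A v /\ ycell A j v <= alast A v j;
  i_edge : forall v w j, (v, w) \in E -> j <= L -> ~~ pend v j w ->
    0 < alast A v j -> zcell A j w <= alast A v j;
  i_lst : forall v j, v < n -> j <= L -> uniq (alst A v j);
  i_mem : forall v w j, v < n -> j <= L -> (w \in alst A v j) =
    [&& (v, w) \in E, ~~ pend v j w & alast A v j == zcell A j w];
  i_wat : forall w j, w < n -> j <= L -> uniq (awat A w j);
  i_watm : forall v w j, w < n -> j <= L -> v \in awat A w j ->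
    [/\ v < n, 0 < alast A v j <= zcell A j w
      & alast A v j = zcell A j w -> w \in alst A v j];
  i_lw : forall v w j, v < n -> j <= L -> w \in alst A v j -> v \in awat A w j;
  i_stk : uniq (astk A);
  i_stkm : forall v, v \in astk A -> v < n /\ 0 < ab A v;
  i_set : forall v, v < n -> 0 < ab A v -> v \notin astk A -> v \notin X ->
    settled A v }.

(** Since estimates are not exact distances, their bound comes from counting: a newly reached vertex
    gets at most one more than the old number of reached vertices, and that number has just grown by
    one. *)
Lemma inv_bn A E pend X v : inv A E pend X -> v < n -> ab A v <= n.
Proof.
move=> I vn; apply: (leq_trans (i_b I vn)).
by apply: leq_trans (count_size _ _) _; rewrite size_iota.
Qed.

Lemma inv_lst_lt A E pend X v w j : inv A E pend X -> v < n -> j <= L ->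
  w \in alst A v j -> w < n.
Proof. by move=> I vn jL; rewrite (i_mem I) // => /and3P[/(i_E I)[]]. Qed.

Lemma inv_wat_lt A E pend X v w j : inv A E pend X -> w < n -> j <= L ->
  v \in awat A w j -> v < n.
Proof. by move=> I wn jL /(i_watm I wn jL)[]. Qed.

(** A parent may have improved since it was recorded, so estimates drop by at least, not exactly,
    one along parents; the chain is simple and may be shorter than the estimate. The last clause
    reads it backwards from [v], as the query program meets it. *)
Lemma parent_chain A E pend X v : inv A E pend X -> v < n -> 0 < ab A v ->
  exists p, [/\ path (fun u x => (u, x) \in E) s p, last s p = v, uniq (s :: p)
    /\ (forall y, y \in s :: p -> y < n /\ ab A y <= ab A v), size p <= (ab A v).-1 &
    forall i, i <= size p -> iter i (apar A) v = nth 0 (s :: p) (size p - i)].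
Proof.
move=> I; move: {2}(ab A v) (leqnn (ab A v)) => k; elim: k v => [|k IH] v vk vn v0.
  by move: vk; rewrite leqn0 eqn0Ngt v0.
have [e|vs] := eqVneq v s.
  rewrite e in vn *.
  exists [::]; split => //; first by split => // y; rewrite inE => /eqP->.
  by case.
have [pn pE /andP[p0 pv]] := i_par I vn v0 vs.
have pk : ab A (apar A v) <= k by lia.
have [p [h1 h2 [h3 h3'] h4 h5]] := IH _ pk pn p0.
exists (rcons p v); split.
- by rewrite rcons_path h1 h2.
- by rewrite last_rcons.
- split.
    rewrite -rcons_cons rcons_uniq h3 andbT.
    by apply/negP => /h3'[_]; rewrite leqNgt pv.
  move=> y; rewrite -rcons_cons mem_rcons inE => /orP[/eqP->//|/h3'[yn yv]].
  by split => //; apply: leq_trans yv (ltnW pv).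
- by rewrite size_rcons; lia.
- case=> [|i]; rewrite size_rcons.
    by move=> _; rewrite /= nth_rcons ltnn eqxx.
  rewrite ltnS => ip; rewrite iterSr h5 // subSS -rcons_cons nth_rcons /= ltnS.
  by rewrite leq_subr.
Qed.

(** Net effect of relaxing (u, w); the levels where [w] leaves its cell are those with
    [zcell A i w != zcell A' i w]. The stack is described as a set because its order depends on the
    order of the watcher lists. *)
Record relaxed A A' u w : Prop := Relaxed {
  r_b : ab A' = upd (ab A) w (ab A u).+1;
  r_par : apar A' = upd (apar A) w u;
  r_last : alast A' = alast A;
  r_lst : forall v i, v < n -> i <= L -> alst A' v i =
    if [&& zcell A i w != zcell A' i w, v \in awat A w i & alast A v i == zcell A i w]
    then swap_del (alst A v i) w else alst A v i;
  r_wat : forall x i, x < n -> i <= L -> awat A' x i =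
    if (x == w) && (zcell A i w != zcell A' i w) then [::] else awat A x i;
  r_stk : uniq (astk A');
  r_stkm : forall v, (v \in astk A') <-> [\/ v \in astk A, v = w |
    exists i, [/\ i <= L, zcell A i w != zcell A' i w & v \in awat A w i]] }.

Lemma Z_b_le0 A E pend X v : inv A E pend X -> v < n -> Z (ab A v) <= Z 0.
Proof. by move=> I vn; apply: Z_le0; have := inv_bn I vn; lia. Qed.

(** Estimates only drop, so cells only move down. Wherever [w] changes cell, all its watchers go on
    the stack; hence a vertex off the stack has unchanged lists and stays settled. *)
Lemma inv_relaxed A A' E pend X u w : inv A E pend X -> relaxed A A' u w ->
  (u, w) \in E -> 0 < ab A u -> ab A w = 0 \/ (ab A u).+1 < ab A w ->
  inv A' E pend X.
Proof.
move=> I R uwE u0 wu.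
have [un wn] := i_E I uwE.
have bn := inv_bn I.
have bw : ab A' w = (ab A u).+1 by rewrite (r_b R) /upd eqxx.
have bx x : x != w -> ab A' x = ab A x by rewrite (r_b R) /upd => /negbTE->.
have uw : u != w by apply/eqP => uw; move: wu; rewrite uw in u0 *; lia.
have bu := bx _ uw.
have ws : w != s.
  by apply/eqP => E'; move: wu; rewrite E' (i_s I); lia.
have ble_b x : x < n -> ble (ab A' x) (ab A x).
  have [->|xw] := eqVneq x w; first by rewrite bw /ble; lia.
  by rewrite bx // /ble; lia.
have pos x : 0 < ab A x -> 0 < ab A' x.
  by have [->|xw] := eqVneq x w; [rewrite bw | rewrite bx].
(* The number of reached vertices grows by one exactly when [w] was unreached; this restores [i_b]
   for the new estimate. *)
have cnt0 : count (fun x => ab A x != 0) (iota 0 n)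
            + (ab A w == 0) <= count (fun x => ab A' x != 0) (iota 0 n).
  have wi : w \in iota 0 n by rewrite mem_iota.
  have /permP pm := perm_to_rem wi.
  rewrite !pm /= bw /= (@eq_in_count _ (fun x => ab A' x != 0) (fun x => ab A x != 0)).
    by case: (ab A w == 0) => /=; rewrite ?addn0 ?add0n ?addn1 ?add1n.
  move=> x xr /=; rewrite bx //.
  by move: xr; rewrite (mem_rem_uniq _ (iota_uniq 0 n)) inE => /andP[].
have b'n x : x < n -> ab A' x <= count (fun x => ab A' x != 0) (iota 0 n).
  move=> xn; have [->|xw] := eqVneq x w; last first.
    by rewrite bx //; have := i_b I xn; lia.
  rewrite bw; have := i_b I un; have := i_b I wn.
  by case: wu => [w0|]; [move: cnt0; rewrite w0 eqxx; lia | lia].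
have b'n' x : x < n -> ab A' x <= n.
  move=> xn; apply: (leq_trans (b'n _ xn)).
  by apply: leq_trans (count_size _ _) _; rewrite size_iota.
have zle x j : x < n -> zcell A' j x <= zcell A j x.
  move=> xn; apply/cell_le/Z_le; last exact: ble_b.
    by have := b'n' _ xn; lia.
  by have := bn _ xn; lia.
have zcx x j : x != w -> zcell A' j x = zcell A j x by move=> xw; rewrite /zcell bx.
(* The single top cell is never left, so notifications occur only below it, where [i_last] shows
   that the watcher is reached. *)
have chgL i : i <= L -> zcell A i w != zcell A' i w -> i < L.
  move=> iL; rewrite ltn_neqAle iL andbT; apply: contra => /eqP->.
  rewrite /zcell !cellL //; first by apply: Z_le0; have := b'n' _ wn; lia.
  exact: Z_b_le0 I wn.
split.
- exact: b'n.
- by rewrite bx ?(i_s I) // eq_sym.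
- exact: i_E I.
- move=> v vn; have [->|vw] := eqVneq v w => v0 vs.
    by rewrite (r_par R) /upd eqxx; split; rewrite // bw bu u0 /=.
  move: v0; rewrite bx // => v0; rewrite (r_par R) /upd (negbTE vw).
  have [p1 p2 /andP[p3 p4]] := i_par I vn v0 vs; split => //.
  by rewrite pos //=; have := ble_b _ p1; rewrite /ble; lia.
- by move=> v vn; rewrite (r_last R) (i_lastL I).
- move=> v j vn jL; rewrite (r_last R) => l0.
  have [v0 yl] := i_last I vn jL l0; split; first exact: pos.
  apply: leq_trans yl; apply/cell_le/Z_le; rewrite ?ltnS ?b'n' ?bn //.
  by have := ble_b _ vn; rewrite /ble; lia.
- move=> v x j vE jL pd; rewrite (r_last R) => l0.
  have [_ xn] := i_E I vE.
  exact: leq_trans (zle _ _ xn) (i_edge I vE jL pd l0).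
- move=> v j vn jL; rewrite (r_lst R) //; case: ifP => [/and3P[_ vw /eqP lz]|_].
    by apply: uniq_swap_del; [exact: i_lst I _ _ vn jL | have [_ _ /(_ lz)] := i_watm I wn jL vw].
  exact: i_lst I _ _ vn jL.
- move=> v x j vn jL; rewrite (r_last R) (r_lst R) //.
  case: ifP => [/and3P[ch vw /eqP lz]|ch].
    have wl : w \in alst A v j by have [_ _ /(_ lz)] := i_watm I wn jL vw.
    rewrite mem_swap_del ?(i_lst I) //.
    have [->|xw] := eqVneq x w; last by rewrite (i_mem I) // zcx.
    by rewrite /= lz (negbTE ch) !andbF.
  have [->|xw] := eqVneq x w; last by rewrite (i_mem I) // zcx.
  have [<-|ch'] := eqVneq (zcell A j w) (zcell A' j w); first by rewrite (i_mem I).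
  rewrite ch' /= in ch.
  have wl : w \notin alst A v j.
    apply/negP => wl; move: ch; rewrite (i_lw I vn jL wl) /=.
    by move: wl; rewrite (i_mem I) // => /and3P[_ _ ->].
  (* A drop cannot bring [w] into a list: its old cell was at most [alast A v j], so a changed cell
     lies strictly below. *)
  rewrite (negbTE wl); apply/esym/negbTE/negP => /and3P[vwE pd /eqP lz].
  have l0 : 0 < alast A v j by rewrite lz.
  have := i_edge I vwE jL pd l0; have := zle _ j wn; rewrite lz => h1 h2.
  by move: ch'; rewrite eqn_leq h1 h2.
- by move=> x j xn jL; rewrite (r_wat R) //; case: ifP => // _; apply: i_wat I _ _ xn jL.
- move=> v x j xn jL; rewrite (r_wat R) //; case: ifP => // /negbT ch vx.
  have [vn ll lst] := i_watm I xn jL vx.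
  have zE : zcell A' j x = zcell A j x.
    have [xw|/zcx//] := eqVneq x w; move: ch; rewrite xw eqxx /= negbK.
    by move=> /eqP.
  rewrite (r_last R) zE; split => // /lst xl; rewrite (r_lst R) //.
  case: ifP => // /and3P[ch' vw /eqP lz].
  rewrite mem_swap_del ?(i_lst I) //; last by have [_ _ /(_ lz)] := i_watm I wn jL vw.
  by rewrite xl andbT; apply: contraNneq ch => ->; rewrite eqxx ch'.
- move=> v x j vn jL.
  have xin : x \in alst A' v j -> x \in alst A v j.
    rewrite (r_lst R) //; case: ifP => // /and3P[_ vw /eqP lz].
    rewrite mem_swap_del ?(i_lst I) //; last by have [_ _ /(_ lz)] := i_watm I wn jL vw.
    by case/andP.
  move=> xl'; have xl := xin xl'; have vx := i_lw I vn jL xl.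
  have xn := inv_lst_lt I vn jL xl.
  rewrite (r_wat R) //; case: ifP => // /andP[/eqP xw ch].
  move: xl'; rewrite xw in vx xl *; rewrite (r_lst R) // ch vx /=.
  have lz : alast A v j == zcell A j w by move: xl; rewrite (i_mem I) // => /and3P[].
  by rewrite lz mem_swap_del ?(i_lst I) // eqxx.
- exact: r_stk R.
- move=> v /(r_stkm R)[/(i_stkm I)[vn v0]|->|[i [iL ch vw]]].
  + by split => //; apply: pos.
  + by rewrite bw.
  + have [vn /andP[l0 _] _] := i_watm I wn iL vw; split => //; apply: pos.
    by have [] := i_last I vn (chgL _ iL ch) l0.
- move=> v vn v0 vs vX.
  have vw : v != w by apply: contraNneq vs => ->; apply/(r_stkm R); constructor 2.
  have vA : v \notin astk A.
    by apply: contra vs => vs; apply/(r_stkm R); constructor 1.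
  have v0' : 0 < ab A v by rewrite -bx.
  have st := i_set I vn v0' vA vX.
  have lE i : i <= L -> alst A' v i = alst A v i.
    move=> iL; rewrite (r_lst R) //; case: ifP => // /and3P[ch vwt _].
    by case/negP: vs; apply/(r_stkm R); constructor 3; exists i.
  move=> j jL h; rewrite (r_last R) /ycell bx //; apply: st => // i ij.
  by rewrite -lE; [exact: h | case/andP: ij].
Qed.

End Invariant.

(** * The approximation guarantee *)

Section Approximation.

Variables n num den s : nat.
Hypothesis num0 : 0 < num.
Hypothesis sn : s < n.
Notation L := (levels n).
Notation Z := (ztable n num den).
Notation D := (cell_width n num den).
Notation cell := (cell_of n num den).
Notation zc := (zcell n num den).
Notation yc := (ycell n num den).
Notation inv := (inv n num den s).
Notation settled := (settled n num den).
Notation no_pend := (fun _ _ _ : nat => false).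

(** This makes the top-level list always light, so that a lowest level with only light lists above
    it exists. *)
Lemma n_lt_DL : n < D L.
Proof.
rewrite /cell_width ltnn ltnS /ztable /=.
by apply: leq_trans (leq_addl _ _); apply/ltnW/levelsP.
Qed.

Lemma inv_size_lst A E pend X v j : inv A E pend X -> v < n -> j <= L ->
  size (alst A v j) <= n.
Proof.
move=> I vn jL; apply: leq_size_bounded; first exact: i_lst I _ _ vn jL.
by move=> x; apply: inv_lst_lt I vn jL.
Qed.

(** Take the lowest level above which all lists are light. Being settled makes it up to date, and if
    it is not 0, minimality makes its own list heavy. *)
Lemma settled_level A E pend X v : inv A E pend X -> v < n -> settled A v ->
  exists j, [/\ j < L, alast A v j = yc A j v & j = 0 \/ D j <= size (alst A v j)].
Proof.
move=> I vn st; pose P j := all (fun i => (j < i) ==> (size (alst A v i) < D i)) (iota 0 L.+1).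
have PP j : reflect (forall i, j < i <= L -> size (alst A v i) < D i) (P j).
  apply: (iffP allP) => [h i /andP[ji iL]|h i].
    by have := h i; rewrite mem_iota /= ltnS iL ji; apply.
  by rewrite mem_iota /= ltnS => iL; apply/implyP => ji; apply: h; rewrite ji.
have L0 : 0 < L by apply: levels_gt0; lia.
have PL : P L.-1.
  apply/PP => i iL; have -> : i = L by lia.
  exact: leq_ltn_trans (inv_size_lst I vn (leqnn _)) n_lt_DL.
case: (ex_minnP (ex_intro P _ PL)) => j Pj jmin.
have jL : j < L by have := jmin _ PL; lia.
exists j; split => //; first by apply: st => //; apply/PP.
case: j => [|j] in Pj jmin jL *; [by left | right].
rewrite leqNgt; apply/negP => lt; suff /jmin : P j by rewrite ltnn.
apply/PP => i /andP[]; rewrite leq_eqVlt => /orP[/eqP <- //|ji iL].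
by move/PP: Pj; apply; rewrite ji.
Qed.

Definition heavy A j c := D j <= count (fun x => zc A j x == c) (iota 0 n).

(** At the level of [settled_level], the invariant puts the cell of d(w) - 1 at or below that of
    d(v); every a with d(v) <= a < d(w) is squeezed between them, so all these cells agree. An
    unreached [w] would lie in the cell of infinity, above that of d(v). *)
Lemma edge_step A E X v w : inv A E no_pend X -> settled A v ->
    0 < ab A v -> (v, w) \in E ->
  0 < ab A w /\ forall a, (ab A v).-1 <= a < (ab A w).-1 ->
    a = (ab A v).-1 \/ exists j, [/\ j < L, heavy A j (cell j (Z a.+2))
      & cell j (Z a.+2) = cell j (Z (ab A v).+1)].
Proof.
move=> I st v0 vwE; have [vn wn] := i_E I vwE.
have [j [jL lst hv]] := settled_level I vn st.
have bv := inv_bn I vn; have bw := inv_bn I wn.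
have zy : zc A j w <= yc A j v.
  by rewrite -lst; apply: (i_edge I vwE) => //; [exact: ltnW | rewrite lst].
have w0 : 0 < ab A w.
  rewrite lt0n; apply/negP => /eqP w0; move: zy; rewrite /zcell w0.
  by rewrite leqNgt cell_finite // ?bv.
split => // a av.
have cE : cell j (Z a.+2) = cell j (Z (ab A v).+1).
  apply/eqP; rewrite eqn_leq; apply/andP; split; last first.
    by apply/cell_le/Z_le; rewrite /ble; lia.
  apply: leq_trans zy; apply/cell_le/Z_le; rewrite /ble; lia.
case: hv => [j0|hv].
  left; rewrite j0 in cE jL; have := cell_inj0 jL cE => zE.
  have := @Z_lt n num den (ab A v).+1 a.+2; rewrite zE ltnn; lia.
right; exists j; split => //; rewrite /heavy; apply: leq_trans hv _.
rewrite -size_filter; apply: uniq_leq_size; first by apply: i_lst I _ _ vn (ltnW jL).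
move=> x xl; rewrite mem_filter mem_iota /= (inv_lst_lt I vn (ltnW jL) xl) andbT.
by move: xl; rewrite (i_mem I) ?(ltnW jL) // => /and3P[_ _ /eqP <-]; rewrite lst cE.
Qed.

(** The increments in this range are rounded-up quotients with divisor at most num X, so distances
    below X are at least 4n / (eps X) apart in the table. *)
Lemma Z_gap X m k : k < X -> m <= k ->
  4 * n * den * (k - m) <= num * X * (Z k.+2 - Z m.+2).
Proof.
elim: k => [|k IH] kX; first by rewrite leqn0 => /eqP ->; rewrite subnn muln0.
rewrite leq_eqVlt => /orP[/eqP ->|mk]; first by rewrite subnn muln0.
have zk : Z k.+3 = Z k.+2 + ((4 * n * den) %/ (num * k.+2) + 1).
  by rewrite /ztable /= potS.
have zm : Z m.+2 <= Z k.+2 by rewrite /ztable /=; apply: pot_le; lia.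
rewrite zk subSn // -addnBAC // mulnDr mulnS addnC.
apply: leq_add; first by apply: IH; lia.
rewrite addn1; apply: (@leq_trans (num * k.+2 * ((4 * n * den) %/ (num * k.+2)).+1)).
  by rewrite [X in _ <= X]mulnC; apply/ltnW/ltn_ceil; rewrite muln_gt0 num0.
by rewrite leq_mul2r leq_mul2l; apply/orP; right; apply/orP; right; lia.
Qed.

Lemma cell_eq_up j i x y : j <= i -> i < L -> x <= Z 0 -> y <= Z 0 ->
  cell j x = cell j y -> cell i x = cell i y.
Proof.
move=> ji iL x0 y0 c; elim: i ji iL => [|i IH]; first by rewrite leqn0 => /eqP <-.
rewrite leq_eqVlt => /orP[/eqP <- //|ji] iL.
have iL' : i < L by lia.
have e := IH ji iL'; apply/eqP; rewrite eqn_leq.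
by apply/andP; split; apply: cell_up => //; rewrite e.
Qed.

Section Count.

Variables (A : ast) (X : nat).
Hypothesis Xn : X < n.
Hypothesis bn : forall v, v < n -> ab A v <= n.

Let Q (a : 'I_X) := Z a.+2.

Let Q_le a : Q a <= Z 0.
Proof. by apply: Z_le0; have := ltn_ord a; lia. Qed.

Let popl (j : nat) (a : 'I_X) : {set 'I_n} := [set x : 'I_n | zc A j x == cell j (Q a)].
(** Level of the maximal heavy cell around [a]. The value 0 of an empty maximum is ruled out by
    [J_heavy] wherever some cell of [a] is heavy. *)
Let J (a : 'I_X) := \max_(j < L | 2 ^ j <= #|popl j a|) j.

(** The second index [a'] excludes cells holding one index only, which would span no gap of the
    table; in the application it is the estimate of the tail of the crossing edge. *)
Let nonexact (S : {set 'I_X}) := forall a, a \in S -> exists (j : nat) (a' : 'I_X),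
  [/\ j < L, heavy A j (cell j (Q a)), a' != a & cell j (Q a) = cell j (Q a')].

Let J_heavy a j : j < L -> heavy A j (cell j (Q a)) ->
  [/\ j <= J a, J a < L & 2 ^ J a <= #|popl (J a) a|].
Proof.
move=> jL; rewrite /heavy /cell_width jL => hv.
have hv' : 2 ^ j <= #|popl j a|.
  apply: leq_trans hv _; rewrite -size_filter.
  rewrite cardE.
  have -> : [seq x <- iota 0 n | zc A j x == cell j (Q a)]
     = [seq val x | x <- enum (popl j a)].
    rewrite -val_enum_ord filter_map; congr map.
    by rewrite enumT -/(enum _) [in RHS]/enum_mem; apply: eq_filter => x; rewrite /= !inE.
  by rewrite size_map.
have P0 : 0 < #|[pred i : 'I_L | 2 ^ i <= #|popl i a|]|.
  by apply/card_gt0P; exists (Ordinal jL); rewrite inE.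
have [i iP iE] := eq_bigmax_cond (fun i : 'I_L => i : nat) P0.
have JE : J a = i by rewrite -iE.
split; last 2 first; rewrite ?JE //.
by rewrite -JE -[j]/(nat_of_ord (Ordinal jL)) /J; apply: leq_bigmax_cond.
Qed.

Let J_max a (j : nat) : j < L -> 2 ^ j <= #|popl j a| -> j <= J a.
Proof.
move=> jL h.
by rewrite -[j]/(nat_of_ord (Ordinal jL)) /J; apply: leq_bigmax_cond.
Qed.

Let popl_eq a a' j : cell j (Q a) = cell j (Q a') -> popl j a = popl j a'.
Proof. by move=> e; apply/setP => x; rewrite !inE e. Qed.

Let z_le (x : 'I_n) : Z (ab A x) <= Z 0.
Proof. by apply: Z_le0; have := bn (ltn_ord x); lia. Qed.

(** By nesting, a common vertex forces a common cell at the coarser of the two levels, hence a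
    common population there; maximality for the finer index then makes the levels equal. *)
Let meet_eq S a a' x : nonexact S -> a \in S -> a' \in S ->
  x \in popl (J a) a -> x \in popl (J a') a' ->
  J a = J a' /\ cell (J a) (Q a) = cell (J a) (Q a').
Proof.
move=> ne aS a'S; rewrite !inE => /eqP xa /eqP xa'.
have [j [b [jL hv _ _]]] := ne _ aS; have [_ JL Jp] := J_heavy jL hv.
have [j' [b' [jL' hv' _ _]]] := ne _ a'S; have [_ JL' Jp'] := J_heavy jL' hv'.
have half c d : J c <= J d -> J c < L -> J d < L -> 2 ^ J d <= #|popl (J d) d| ->
    zc A (J c) x = cell (J c) (Q c) -> zc A (J d) x = cell (J d) (Q d) ->
    J c = J d /\ cell (J c) (Q c) = cell (J c) (Q d).
  move=> cd cL dL dp xc xd.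
  have e : cell (J d) (Q c) = cell (J d) (Q d).
    by rewrite -xd; apply: cell_eq_up cd dL _ _ _ => //; rewrite -xc.
  have dc : J d <= J c by apply: J_max => //; rewrite (popl_eq e).
  have E : J c = J d by apply/eqP; rewrite eqn_leq cd dc.
  by split; rewrite // E.
have [le|lt] := leqP (J a) (J a'); first exact: half.
have [E1 E2] := half a' a (ltnW lt) JL' JL Jp xa' xa.
by rewrite E1 in lt; rewrite ltnn in lt.
Qed.

(** Indices with the same population lie in one cell, whose width 2^J is at most the size of the
    population, and [Z_gap] limits how many indices fit into that width. *)
Let class_card S a0 : nonexact S -> a0 \in S ->
  4 * n * den * #|[set a in S | popl (J a) a == popl (J a0) a0]|
    <= 2 * num * X * #|popl (J a0) a0|.
Proof.
move=> ne a0S; have [j [b [jL hv ba cb]]] := ne _ a0S.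
have [jJ JL Jp] := J_heavy jL hv.
pose T := [set a : 'I_X | cell (J a0) (Q a) == cell (J a0) (Q a0)].
have sub : [set a in S | popl (J a) a == popl (J a0) a0] \subset T.
  apply/subsetP => a; rewrite inE => /andP[aS /eqP pE].
  have /card_gt0P[x xp] : 0 < #|popl (J a0) a0|.
    by apply: leq_trans Jp; rewrite expn_gt0.
  have [] := meet_eq ne a0S aS xp; first by rewrite pE.
  by move=> _ e; rewrite inE e.
have a0T : a0 \in T by rewrite inE.
have bT : b \in T.
  by rewrite inE; apply/eqP/esym; apply: cell_eq_up jJ JL _ _ cb.
case: (@arg_minnP _ a0 (mem T) val a0T) => lo loT lomin.
case: (@arg_maxnP _ a0 (mem T) val a0T) => hi hiT himax.
have lohi : lo < hi.
  have : lo != hi.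
    apply/eqP => lh; move/eqP: ba; apply; apply/val_inj => /=.
    have := lomin _ bT; have := lomin _ a0T; have := himax _ bT; have := himax _ a0T.
    by rewrite lh /=; lia.
  by rewrite -val_eqE /=; have := lomin _ hiT; rewrite /=; lia.
(* Since [a0] and [b] are distinct members, hi > lo and hi - lo + 1 is at most twice hi - lo. *)
have cT : #|T| <= 2 * (hi - lo).
  apply: (@leq_trans (hi - lo).+1); last by lia.
  rewrite cardE -(size_map val) -[X in _ <= X](size_iota lo).
  apply: uniq_leq_size; first by rewrite map_inj_uniq ?enum_uniq //; exact: val_inj.
  move=> _ /mapP[a aT ->]; rewrite mem_enum in aT; rewrite mem_iota /=.
  by have := lomin _ aT; have := himax _ aT; rewrite /=; lia.
have gap := Z_gap (ltn_ord hi) (ltnW lohi).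
have wid : Q hi - Q lo < 2 ^ J a0.
  move: hiT loT; rewrite !inE => /eqP h1 /eqP h2.
  have : cell (J a0) (Q hi) = cell (J a0) (Q lo) by rewrite h1 h2.
  rewrite /cell_of /cell_width JL => -[].
  have := divn_eq (Q hi) (2 ^ J a0); have := divn_eq (Q lo) (2 ^ J a0).
  have := ltn_pmod (Q hi) (expn_gt0 2 (J a0)).
  have := ltn_pmod (Q lo) (expn_gt0 2 (J a0)).
  by move=> p1 p2 e1 e2 e; rewrite {1}e1 {1}e2 e; lia.
apply: leq_trans (leq_mul (leqnn _) (leq_trans (subset_leq_card sub) cT)) _.
rewrite mulnCA -!mulnA leq_mul2l /= !mulnA.
apply: leq_trans gap _; rewrite leq_mul2l.
by apply/orP; right; apply: leq_trans Jp; apply: ltnW.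
Qed.

(** The set is partitioned by the population itself; distinct populations are disjoint sets of
    vertices, so their sizes sum to at most n. *)
Lemma nonexact_card (S : {set 'I_X}) : nonexact S -> 2 * den * #|S| <= num * X.
Proof.
move=> ne; suff : 4 * n * den * #|S| <= 2 * num * X * n.
  have n0 : 0 < n by lia.
  have -> : 4 * n * den * #|S| = 2 * n * (2 * den * #|S|) by lia.
  have -> : 2 * num * X * n = 2 * n * (num * X) by lia.
  by rewrite leq_pmul2l //; lia.
rewrite -sum1_card big_distrr /= (partition_big_imset (fun a => popl (J a) a)) /=.
apply: (@leq_trans (\sum_(B in [set popl (J a) a | a in S]) 2 * num * X * #|B|)).
  apply: leq_sum => B /imsetP[a0 a0S ->].
  apply: leq_trans (class_card ne a0S).
  rewrite -big_distrr /= leq_mul2l; apply/orP; right.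
  by rewrite sum1dep_card leqnn.
rewrite -big_distrr /= leq_mul2l; apply/orP; right.
have tI : trivIset [set popl (J a) a | a in S].
  apply/trivIsetP => _ _ /imsetP[a aS ->] /imsetP[b bS ->]; apply: contraR.
  rewrite -setI_eq0 => /set0Pn[x]; rewrite inE => /andP[xa xb].
  by have [-> e] := meet_eq ne aS bS xa xb; apply/eqP/popl_eq; rewrite e.
have /eqP -> := tI; rewrite -[X in _ <= X]card_ord; exact: max_card.
Qed.

End Count.

Lemma crossing (f : nat -> nat) d a : f 0 <= a -> a < f d ->
  exists i, [/\ i < d, f i <= a & a < f i.+1].
Proof.
move=> f0; elim: d => [|d IH]; first by rewrite ltnNge f0.
move=> fd; have [ad|da] := ltnP a (f d); last by exists d.
by have [i [id fi fi1]] := IH ad; exists i; split => //; apply: ltnW.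
Qed.

(** With X the estimate of the endpoint, this is (1 - eps/2) X <= length, denominators cleared.
    Finiteness travels along the path because a settled reached vertex has no unreached
    out-neighbour. *)
Lemma inv_approx A E p : inv A E no_pend [::] -> astk A = [::] ->
  path (fun u w => (u, w) \in E) s p ->
  0 < ab A (last s p) /\
  2 * den * (ab A (last s p)).-1
    <= 2 * den * size p + num * (ab A (last s p)).-1.
Proof.
move=> I stk0 /(pathP s) pE.
have st v : v < n -> 0 < ab A v -> settled A v.
  by move=> vn v0; apply: (i_set I) => //; rewrite stk0.
pose x i := nth s (s :: p) i.
have xE i : i < size p -> (x i, x i.+1) \in E by move=> ip; apply: pE.
have fin i : i <= size p -> x i < n /\ 0 < ab A (x i).
  elim: i => [|i IH] ip; first by rewrite /x /= sn (i_s I).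
  have [xn x0] := IH (ltnW ip); have [_ wn] := i_E I (xE _ ip).
  by have [w0 _] := edge_step I (st _ xn x0) x0 (xE _ ip).
have lE : last s p = x (size p) by rewrite /x nth_last.
have [tn t0] := fin _ (leqnn _).
rewrite lE; split => //; set X := (ab A (x (size p))).-1.
have Xn : X < n by have := inv_bn I tn; rewrite /X; lia.
pose f i := (ab A (x i)).-1.
pose ex (a : 'I_X) := (a : nat) \in [seq f i | i <- iota 0 (size p)].
have e1 : #|[set a | ex a]| <= size p.
  apply: (@leq_trans (size [seq f i | i <- iota 0 (size p)])); last first.
    by rewrite size_map size_iota.
  rewrite cardE -(size_map val).
  apply: uniq_leq_size; first by rewrite map_inj_uniq ?enum_uniq //; exact: val_inj.
  by move=> _ /mapP[a aT ->]; move: aT; rewrite mem_enum inE.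
have e2 : 2 * den * #|[set a | ~~ ex a]| <= num * X.
  apply: (@nonexact_card A) => //; first by move=> v; apply: inv_bn I.
  move=> a; rewrite inE => na.
  have f0 : f 0 <= a by rewrite /f /x /= (i_s I).
  have [i [ip fi fi1]] := crossing f0 (ltn_ord a).
  have [xn x0] := fin _ (ltnW ip).
  have [_ /(_ a)] := edge_step I (st _ xn x0) x0 (xE _ ip).
  rewrite -/(f i) -/(f i.+1) fi fi1 => /(_ isT) [ae|[j [jL hv ce]]].
    by case/negP: na; apply/mapP; exists i; rewrite ?mem_iota.
  (* The estimate of the tail lies in the same cell as [a] and differs from it: it is the second
     index that [nonexact] asks for. *)
  have fX : f i < X by apply: leq_ltn_trans (ltn_ord a).
  exists j, (Ordinal fX); split => //.
    rewrite -val_eqE /=; apply: contra na => /eqP e; rewrite /ex -e.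
    by apply/mapP; exists i; rewrite ?mem_iota.
  by rewrite ce /= /f; congr (cell j (Z _)); lia.
have : #|[set a | ex a]| + #|[set a | ~~ ex a]| = X.
  have -> : [set a | ~~ ex a] = ~: [set a | ex a] by apply/setP => a; rewrite !inE.
  by rewrite cardsC card_ord.
by move=> XE; rewrite -{1}XE mulnDr; nia.
Qed.

End Approximation.

(** * The programs *)

Section Wp.

Variable w : nat.

(** Total correctness, with the running time handed to the postcondition so that it can be traded
    against a potential. *)
Definition wp c st (Q : state -> nat -> Prop) :=
  exists st' t, exec w c st st' t /\ Q st' t.

Lemma wp_mono c st (Q Q' : state -> nat -> Prop) :
  (forall st' t, Q st' t -> Q' st' t) -> wp c st Q -> wp c st Q'.
Proof. by move=> QQ' [st' [t [e q]]]; exists st', t; split; last exact: QQ'. Qed.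

Lemma wp_skip st (Q : state -> nat -> Prop) : Q st 1 -> wp Skip st Q.
Proof. by move=> q; exists st, 1; split => //; constructor. Qed.

Lemma wp_assign r e x st (Q : state -> nat -> Prop) :
  eval w st e = x -> Q (set_reg st r x) (ecost e).+1 -> wp (Assign r e) st Q.
Proof. by move=> <- q; eexists; eexists; split; [constructor | exact: q]. Qed.

Lemma wp_store b a e i x st (Q : state -> nat -> Prop) :
  eval w st a = i -> eval w st e = x ->
  Q (set_cell st b i x) (ecost a + ecost e).+1 -> wp (Store b a e) st Q.
Proof. by move=> <- <- q; eexists; eexists; split; [constructor | exact: q]. Qed.

Lemma wp_seq c1 c2 st (Q : state -> nat -> Prop) :
  wp c1 st (fun st1 t1 => wp c2 st1 (fun st2 t2 => Q st2 (t1 + t2))) ->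
  wp (Seq c1 c2) st Q.
Proof.
move=> [st1 [t1 [e1 [st2 [t2 [e2 q]]]]]]; exists st2, (t1 + t2).
by split => //; econstructor; eauto.
Qed.

Lemma wp_if e c1 c2 st (b : bool) (Q : state -> nat -> Prop) :
  (eval w st e != 0) = b ->
  (if b then wp c1 st (fun st' t => Q st' (ecost e + t).+1)
   else wp c2 st (fun st' t => Q st' (ecost e + t).+1)) ->
  wp (If e c1 c2) st Q.
Proof.
case: b => /eqP e0 [st' [t [ex q]]]; exists st', (ecost e + t).+1; split => //.
  by constructor.
by apply: ExecIfFalse => //; case: eqP e0.
Qed.

(* [I k st T]: k bounds the number of remaining rounds, T is the time spent. *)
Lemma wp_while e c (I : nat -> state -> nat -> Prop) k st
    (Q : state -> nat -> Prop) :
  (forall k st T, I k st T -> eval w st e != 0 -> wp c st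
     (fun st1 t => exists k', k' < k /\ I k' st1 (T + (ecost e + t).+1))) ->
  (forall k st T, I k st T -> eval w st e = 0 -> Q st (T + (ecost e).+1)) ->
  I k st 0 -> wp (While e c) st Q.
Proof.
move=> step stop i0.
suff : forall m k st T, k < m -> I k st T ->
    exists st' t, exec w (While e c) st st' t /\ Q st' (T + t).
  by move=> /(_ k.+1 k st 0 (ltnSn _) i0)[st' [t [ex q]]]; exists st', t.
elim=> // m IH {i0 st}k st T km i.
have [e0|ne] := eqVneq (eval w st e) 0.
  by exists st, (ecost e).+1; split; [exact: ExecWhileFalse | exact: stop i e0].
have [st1 [t1 [e1 [k' [k'k i']]]]] := step _ _ _ i ne.
have k'm : k' < m by lia.
have [st2 [t2 [e2 q]]] := IH _ _ _ k'm i'.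
exists st2, (ecost e + t1 + t2).+1; split.
  by apply: ExecWhileTrue e1 e2; apply/eqP.
by move: q; have -> : T + (ecost e + t1).+1 + t2 = T + (ecost e + t1 + t2).+1 by lia.
Qed.

End Wp.

Ltac ecosts := repeat match goal with |- context [ecost ?e] =>
  let x := eval vm_compute in (ecost e) in change (ecost e) with x end.

Ltac fields R := split => /=; try solve [reflexivity | destruct R; assumption].

(* Registers 6, 7, 8, 60: source, 2 ^ levels, levels, stack height.             *)
(* Banks 1 and 3: estimates and parents; 4 and 5: [ztable] and [cell_width];   *)
(* 6: last scanned cell; 8, 9, 14: lengths, entries and positions of the       *)
(* lists; 10 and 11: lengths and entries of the watcher lists; 12 and 13:      *)
(* stack and stack membership.                                                 *)
Definition inc e := Bin Add e (Const 1).
Definition dec e := Bin Defs.Sub e (Const 1).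
(** Row-major addressing; register 7 holds the stride 2^[levels], which exceeds every vertex and
    every level, so addresses decode uniquely. *)
Definition idx2 a b := Bin Add (Bin Mul a (Reg 7)) b.
Definition idx3 a b c := Bin Add (Bin Mul (idx2 a b) (Reg 7)) c.
Definition eb a := Fetch 1 a.
Definition ez a := Fetch 4 a.
Definition ecell j x := inc (Bin Div x (Fetch 5 j)).
Definition elast v j := Fetch 6 (idx2 v j).
Definition elen v j := Fetch 8 (idx2 v j).
Definition elst v j i := Fetch 9 (idx3 v j i).
Definition ewlen v j := Fetch 10 (idx2 v j).
Definition ewat v j i := Fetch 11 (idx3 v j i).
Definition epos v j x := Fetch 14 (idx3 v j x).

Definition push r :=
  If (Fetch 13 (Reg r)) Skip
    (Seq (Store 12 (Reg 60) (Reg r))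
    (Seq (Store 13 (Reg r) (Const 1))
         (Assign 60 (inc (Reg 60))))).

Definition pop_stack :=
  Seq (Assign 60 (dec (Reg 60)))
  (Seq (Assign 14 (Fetch 12 (Reg 60)))
       (Store 13 (Reg 14) (Const 0))).

Definition del r1 r2 r3 :=
  Seq (Assign 40 (epos (Reg r1) (Reg r2) (Reg r3)))
  (Seq (Assign 41 (dec (elen (Reg r1) (Reg r2))))
  (Seq (Assign 42 (elst (Reg r1) (Reg r2) (Reg 41)))
  (Seq (Store 8 (idx2 (Reg r1) (Reg r2)) (Reg 41))
  (Seq (Store 9 (idx3 (Reg r1) (Reg r2) (Reg 40)) (Reg 42))
       (Store 14 (idx3 (Reg r1) (Reg r2) (Reg 42)) (Reg 40)))))).

Definition add r1 r2 r3 :=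
  Seq (Assign 40 (elen (Reg r1) (Reg r2)))
  (Seq (Assign 41 (ewlen (Reg r3) (Reg r2)))
  (Seq (Store 9 (idx3 (Reg r1) (Reg r2) (Reg 40)) (Reg r3))
  (Seq (Store 14 (idx3 (Reg r1) (Reg r2) (Reg r3)) (Reg 40))
  (Seq (Store 8 (idx2 (Reg r1) (Reg r2)) (inc (Reg 40)))
  (Seq (Store 11 (idx3 (Reg r3) (Reg r2) (Reg 41)) (Reg r1))
       (Store 10 (idx2 (Reg r3) (Reg r2)) (inc (Reg 41)))))))).

Definition pop_watch r3 r2 :=
  Seq (Assign 33 (dec (ewlen (Reg r3) (Reg r2))))
  (Seq (Assign 34 (ewat (Reg r3) (Reg r2) (Reg 33)))
       (Store 10 (idx2 (Reg r3) (Reg r2)) (Reg 33))).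

(** Register 30 holds the old table value. A watcher whose last scanned cell differs from the old
    cell is stale: its list no longer contains the vertex, so nothing is deleted. *)
Definition fire r :=
  While (ewlen (Reg r) (Reg 32))
    (Seq (pop_watch r 32)
    (Seq (If (Bin Eq (elast (Reg 34) (Reg 32)) (ecell (Reg 32) (Reg 30)))
            (del 34 32 r) Skip)
         (push 34))).

Definition relax ru rw :=
  Seq (Assign 30 (ez (eb (Reg rw))))
  (Seq (Store 1 (Reg rw) (inc (eb (Reg ru))))
  (Seq (Store 3 (Reg rw) (Reg ru))
  (Seq (Assign 31 (ez (eb (Reg rw))))
  (Seq (Assign 32 (Const 0))
  (Seq (While (Bin Lt (Reg 32) (inc (Reg 8)))
          (Seq (If (Bin Eq (ecell (Reg 32) (Reg 30)) (ecell (Reg 32) (Reg 31)))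
                  Skip (fire rw))
               (Assign 32 (inc (Reg 32)))))
       (push rw)))))).

Definition event :=
  Seq (Store 6 (idx2 (Reg 14) (Reg 15)) (Reg 16))
  (Seq (Store 8 (idx2 (Reg 14) (Reg 15)) (Const 0))
  (Seq (Assign 17 (inc (Reg 15)))
  (Seq (Assign 20 (Const 0))
       (While (Bin Lt (Reg 20) (elen (Reg 14) (Reg 17)))
          (Seq (Assign 21 (elst (Reg 14) (Reg 17) (Reg 20)))
          (Seq (If (Bin Lt (eb (Reg 14)) (dec (eb (Reg 21)))) (relax 14 21) Skip)
          (Seq (If (Bin Eq (ecell (Reg 15) (ez (eb (Reg 21)))) (Reg 16))
                  (add 14 15 21) Skip)
               (Assign 20 (inc (Reg 20)))))))))).

Definition process :=
  Seq (Assign 15 (Reg 8))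
      (While (Bin Mul (Bin Lt (Const 0) (Reg 15))
                (Bin Lt (elen (Reg 14) (Reg 15)) (Fetch 5 (Reg 15))))
         (Seq (Assign 15 (dec (Reg 15)))
         (Seq (Assign 16 (ecell (Reg 15) (ez (inc (eb (Reg 14))))))
              (If (Bin Eq (elast (Reg 14) (Reg 15)) (Reg 16)) Skip event)))).

Definition drain := While (Reg 60) (Seq pop_stack process).

Definition insert_edge :=
  Seq (If (Bin Mul (Bin Lt (Const 0) (eb (Reg 0)))
             (Bin Lt (eb (Reg 0)) (dec (eb (Reg 1))))) (relax 0 1) Skip)
  (Seq (Assign 17 (Const 0))
  (Seq (While (Bin Lt (Reg 17) (inc (Reg 8)))
          (Seq (If (Bin Eq (elast (Reg 0) (Reg 17))
                      (ecell (Reg 17) (ez (eb (Reg 1))))) (add 0 17 1) Skip)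
               (Assign 17 (inc (Reg 17)))))
       drain)).

Definition parent_walk c :=
  While (Bin Eq (Bin Eq (Reg 10) (Reg 6)) (Const 0))
    (Seq c (Assign 10 (Fetch 3 (Reg 10)))).

(** Parents lead from the target to the source, so a first walk counts the edges and a second one
    fills the answer from its end. *)
Definition query_path :=
  If (eb (Reg 0))
    (Seq (Assign 10 (Reg 0))
    (Seq (Assign 11 (Const 0))
    (Seq (parent_walk (Assign 11 (inc (Reg 11))))
    (Seq (Assign 12 (inc (Reg 11)))
    (Seq (Assign 10 (Reg 0))
    (Seq (parent_walk (Seq (Store 2 (Reg 11) (Reg 10)) (Assign 11 (dec (Reg 11)))))
    (Seq (Store 2 (Const 0) (Reg 6))
         (Assign 0 (Reg 12)))))))))
    (Assign 0 (Const 0)).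

Definition init_levels :=
  Seq (Assign 7 (Const 1))
  (Seq (Assign 8 (Const 0))
       (While (Bin Lt (Reg 7) (inc (Reg 5)))
          (Seq (Store 5 (Reg 8) (Reg 7))
          (Seq (Assign 7 (Bin Mul (Reg 7) (Const 2)))
               (Assign 8 (inc (Reg 8))))))).

Definition init_table :=
  Seq (Assign 9 (Const 0))
  (Seq (Assign 10 (Const 1))
       (While (Bin Lt (Reg 10) (inc (inc (Reg 5))))
          (Seq (Store 4 (Reg 10) (Reg 9))
          (Seq (Store 6 (idx2 (dec (Reg 10)) (Reg 8)) (Const 1))
          (Seq (Assign 9 (Bin Add (Reg 9)
                  (inc (Bin Div (Bin Mul (Bin Mul (Const 4) (Reg 5)) (Reg 3))
                                (Bin Mul (Reg 2) (Reg 10))))))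
               (Assign 10 (inc (Reg 10)))))))).

Definition init_edges :=
  Seq (Assign 9 (Const 0))
      (While (Bin Lt (Reg 9) (Reg 4))
         (Seq (Assign 0 (Fetch 0 (Bin Mul (Const 2) (Reg 9))))
         (Seq (Assign 1 (Fetch 0 (inc (Bin Mul (Const 2) (Reg 9)))))
         (Seq insert_edge
              (Assign 9 (inc (Reg 9))))))).

(** The conditional assignment replaces eps by min(eps, 1), the value for which the tables are
    built. *)
Definition init_all :=
  Seq (Assign 5 (Reg 0))
  (Seq (Assign 6 (Reg 1))
  (Seq (If (Bin Lt (Reg 3) (Reg 2)) (Assign 2 (Reg 3)) Skip)
  (Seq init_levels
  (Seq init_table
  (Seq (Store 4 (Const 0) (Bin Add (Fetch 4 (inc (Reg 5))) (Reg 7)))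
  (Seq (Store 5 (Reg 8) (inc (Fetch 4 (Const 0))))
  (Seq (Store 1 (Reg 6) (Const 1))
  (Seq (Store 12 (Const 0) (Reg 6))
  (Seq (Store 13 (Reg 6) (Const 1))
  (Seq (Assign 60 (Const 1))
  (Seq drain
       init_edges))))))))))).

Definition set_lst A f := Ast (ab A) (apar A) (alast A) f (awat A) (astk A).
Definition set_wat A f := Ast (ab A) (apar A) (alast A) (alst A) f (astk A).
Definition set_stk A l := Ast (ab A) (apar A) (alast A) (alst A) (awat A) l.

Definition pushA A v := if v \in astk A then A else set_stk A (rcons (astk A) v).
Definition delA A v j x :=
  set_lst A (upd2 (alst A) v j (swap_del (alst A v j) x)).
Definition addA A v j x :=
  set_wat (set_lst A (upd2 (alst A) v j (rcons (alst A v j) x)))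
    (upd2 (awat A) x j (rcons (awat A x j) v)).

(** * Memory representation of the abstract state, and word arithmetic without overflow *)

Section Representation.

Variables n num den s w : nat.
Hypothesis sn : s < n.
Notation L := (levels n).
Notation M := (2 ^ levels n).
Notation Z := (ztable n num den).
Notation D := (cell_width n num den).
Notation cell := (cell_of n num den).
Notation zc := (zcell n num den).
Notation yc := (ycell n num den).
Hypothesis W1 : M * M * M <= 2 ^ w.
Hypothesis W2 : (Z 0).+1 < 2 ^ w.

(** The part of the invariant on which single list operations rely. It holds throughout a
    relaxation, while the full invariant is broken between the change of the estimate and the last
    notification. *)
Record wf A : Prop := Wf {
  w_b : forall v, v < n -> ab A v <= n;
  w_lst : forall v j, v < n -> j <= L -> uniq (alst A v j);
  w_lstm : forall v j x, v < n -> j <= L -> x \in alst A v j -> x < n;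
  w_wat : forall v j, v < n -> j <= L -> uniq (awat A v j);
  w_watm : forall v j x, v < n -> j <= L -> x \in awat A v j -> x < n;
  w_stk : uniq (astk A);
  w_stkm : forall x, x \in astk A -> x < n }.

(** Arrays are constrained only below their recorded lengths, and positions only for current
    members, so deletions leave old cells as they are. *)
Record rep st A : Prop := Rep {
  p_s : regs st 6 = s;
  p_M : regs st 7 = M;
  p_L : regs st 8 = L;
  p_sp : regs st 60 = size (astk A);
  p_b : forall v, v < n -> banks st 1 v = ab A v;
  p_par : forall v, v < n -> banks st 3 v = apar A v;
  p_z : forall i, i <= n.+1 -> banks st 4 i = Z i;
  p_d : forall j, j <= L -> banks st 5 j = D j;
  p_last : forall v j, v < n -> j <= L -> banks st 6 (v * M + j) = alast A v j;
  p_len : forall v j, v < n -> j <= L ->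
    banks st 8 (v * M + j) = size (alst A v j);
  p_lst : forall v j i, v < n -> j <= L -> i < size (alst A v j) ->
    banks st 9 ((v * M + j) * M + i) = nth 0 (alst A v j) i;
  p_pos : forall v j x, v < n -> j <= L -> x \in alst A v j ->
    banks st 14 ((v * M + j) * M + x) = index x (alst A v j);
  p_wlen : forall v j, v < n -> j <= L ->
    banks st 10 (v * M + j) = size (awat A v j);
  p_wat : forall v j i, v < n -> j <= L -> i < size (awat A v j) ->
    banks st 11 ((v * M + j) * M + i) = nth 0 (awat A v j) i;
  p_stk : forall i, i < size (astk A) -> banks st 12 i = nth 0 (astk A) i;
  p_inq : forall v, v < n -> banks st 13 v = (v \in astk A) }.

(** Register numbers grow with nesting depth, so a routine that preserves all registers below its
    own leaves the variables of its callers intact. *)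
Definition keep k st st' := forall r, r < k -> regs st' r = regs st r.

Lemma M_gt : [/\ n < M, L < M & 1 < M].
Proof.
split; first exact: levelsP; first exact: levels_lt.
by apply: leq_ltn_trans (levelsP n); lia.
Qed.

Lemma idx2_lt v j : v < M -> j < M -> v * M + j < M * M.
Proof. by move: M => m; nia. Qed.

Lemma idx3_lt v j i : v < M -> j < M -> i < M -> (v * M + j) * M + i < M * M * M.
Proof. by move=> vM jM iM; have := idx2_lt vM jM; move: (v * M + j) => x; move: M iM => m; nia. Qed.

Lemma idx2_eq v j v' j' : j < M -> j' < M ->
  (v * M + j == v' * M + j') = (v == v') && (j == j').
Proof.
move=> jM j'M; apply/eqP/andP => [e|[/eqP-> /eqP->] //].
have M0 : 0 < M by lia.
have := congr1 (divn^~ M) e; have := congr1 (modn^~ M) e.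
by rewrite /= !modnMDl !modn_small // !divnMDl // !divn_small // !addn0 => -> ->.
Qed.

Lemma idx3_eq v j i v' j' i' : j < M -> j' < M -> i < M -> i' < M ->
  ((v * M + j) * M + i == (v' * M + j') * M + i') = [&& v == v', j == j' & i == i'].
Proof. by move=> *; rewrite idx2_eq // idx2_eq // andbA. Qed.

Lemma W_facts : [/\ M * M < 2 ^ w, M < 2 ^ w & 1 < 2 ^ w].
Proof.
have [_ _ h3] := M_gt.
have a : M < M * M by rewrite ltn_Pmulr //; exact: ltnW.
have b : M * M < M * M * M by rewrite ltn_Pmulr // muln_gt0 (ltnW h3).
by split; lia.
Qed.

Lemma ev_idx2 st a b : regs st 7 = M -> eval w st a < M -> eval w st b < M ->
  eval w st (idx2 a b) = eval w st a * M + eval w st b.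
Proof.
move=> e7 aM bM; have [w1 w2 w3] := W_facts; have lt := idx2_lt aM bM.
have h1 : eval w st a * M + eval w st b < 2 ^ w by lia.
have h2 : eval w st a * M < 2 ^ w by lia.
by rewrite /= e7 (modn_small h2) (modn_small h1).
Qed.

Lemma ev_idx3 st a b c : regs st 7 = M -> eval w st a < M -> eval w st b < M ->
  eval w st c < M ->
  eval w st (idx3 a b c) = (eval w st a * M + eval w st b) * M + eval w st c.
Proof.
move=> e7 aM bM cM; have lt := idx3_lt aM bM cM.
have lt' := leq_trans lt W1.
have -> : eval w st (idx3 a b c) =
  ((eval w st (idx2 a b) * regs st 7) %% 2 ^ w + eval w st c) %% 2 ^ w by [].
rewrite -ev_idx2 // in lt' *; rewrite e7; move: (eval w st (idx2 a b)) (eval w st c) lt' => x y lt'.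
have h2 : x * M < 2 ^ w by lia.
by rewrite (modn_small h2) (modn_small lt').
Qed.

Lemma ev_inc st e : (eval w st e).+1 < 2 ^ w -> eval w st (inc e) = (eval w st e).+1.
Proof.
have [_ _ w3] := W_facts => h /=.
by rewrite (modn_small w3) addn1 modn_small.
Qed.

Lemma ev_dec st e : 0 < eval w st e < 2 ^ w -> eval w st (dec e) = (eval w st e).-1.
Proof.
have [_ _ w3] := W_facts => /andP[h0 h] /=; rewrite (modn_small w3).
have -> : eval w st e + (2 ^ w - 1) = (eval w st e).-1 + 2 ^ w by lia.
by rewrite modnDr modn_small //; lia.
Qed.

(** Zero encodes infinity, and its decrement wraps around to the largest word; one comparison with
    [dec] therefore also treats unreached vertices as farther. *)
Lemma ev_dec0 st e : eval w st e = 0 -> eval w st (dec e) = (2 ^ w).-1.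
Proof.
have [_ _ w3] := W_facts => /= ->; rewrite (modn_small w3) add0n modn_small; lia.
Qed.

Lemma ev_const st k : k < 2 ^ w -> eval w st (Const k) = k.
Proof. exact: modn_small. Qed.

Lemma modb (c : bool) : c %% 2 ^ w = c.
Proof. by have [_ _ w3] := W_facts; rewrite modn_small //; case: c; lia. Qed.

Lemma ev_lt st a b : eval w st (Bin Lt a b) = (eval w st a < eval w st b).
Proof. exact: modb. Qed.

Lemma ev_eq st a b : eval w st (Bin Eq a b) = (eval w st a == eval w st b).
Proof. exact: modb. Qed.

Lemma ev_and st a b (x y : bool) : eval w st a = x -> eval w st b = y ->
  eval w st (Bin Mul a b) = x && y.
Proof. by move=> /= -> ->; rewrite mulnb modb. Qed.

Lemma ev_cell st A ej ex : rep st A -> eval w st ej <= L -> eval w st ex <= Z 0 ->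
  eval w st (ecell ej ex) = cell (eval w st ej) (eval w st ex).
Proof.
move=> R jL xZ; have h : eval w st ex %/ D (eval w st ej) <= Z 0.
  by apply: leq_trans (leq_div _ _) xZ.
have lt1 : eval w st ex %/ D (eval w st ej) < 2 ^ w by lia.
rewrite /ecell ev_inc; rewrite /= (p_d R jL) modn_small //; lia.
Qed.

Lemma ev_fetch st b e : eval w st (Fetch b e) = banks st b (eval w st e).
Proof. by []. Qed.

Lemma ev_last st A a b : rep st A -> eval w st a < n -> eval w st b <= L ->
  eval w st (elast a b) = alast A (eval w st a) (eval w st b).
Proof.
move=> R an bL; have [nM LM _] := M_gt.
by rewrite ev_fetch (ev_idx2 (p_M R)) ?(p_last R) //; lia.
Qed.

Lemma ev_len st A a b : rep st A -> eval w st a < n -> eval w st b <= L ->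
  eval w st (elen a b) = size (alst A (eval w st a) (eval w st b)).
Proof.
move=> R an bL; have [nM LM _] := M_gt.
by rewrite ev_fetch (ev_idx2 (p_M R)) ?(p_len R) //; lia.
Qed.

Lemma ev_wlen st A a b : rep st A -> eval w st a < n -> eval w st b <= L ->
  eval w st (ewlen a b) = size (awat A (eval w st a) (eval w st b)).
Proof.
move=> R an bL; have [nM LM _] := M_gt.
by rewrite ev_fetch (ev_idx2 (p_M R)) ?(p_wlen R) //; lia.
Qed.

Lemma size_lst_le A v j : wf A -> v < n -> j <= L -> size (alst A v j) <= n.
Proof.
move=> F vn jL; apply: leq_size_bounded; first exact: w_lst.
by move=> x; apply: w_lstm.
Qed.

Lemma size_wat_le A v j : wf A -> v < n -> j <= L -> size (awat A v j) <= n.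
Proof.
move=> F vn jL; apply: leq_size_bounded; first exact: w_wat.
by move=> x; apply: w_watm.
Qed.

Lemma size_stk_le A : wf A -> size (astk A) <= n.
Proof.
move=> F; apply: leq_size_bounded; first exact: w_stk.
by move=> x; apply: w_stkm.
Qed.

Lemma ev_lst st A a b c : rep st A -> wf A -> eval w st a < n -> eval w st b <= L ->
  eval w st c < size (alst A (eval w st a) (eval w st b)) ->
  eval w st (elst a b c) = nth 0 (alst A (eval w st a) (eval w st b)) (eval w st c).
Proof.
move=> R F an bL cs; have [nM LM _] := M_gt; have := size_lst_le F an bL => sz.
by rewrite ev_fetch (ev_idx3 (p_M R)) ?(p_lst R) //; lia.
Qed.

Lemma ev_wat st A a b c : rep st A -> wf A -> eval w st a < n -> eval w st b <= L ->
  eval w st c < size (awat A (eval w st a) (eval w st b)) ->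
  eval w st (ewat a b c) = nth 0 (awat A (eval w st a) (eval w st b)) (eval w st c).
Proof.
move=> R F an bL cs; have [nM LM _] := M_gt; have := size_wat_le F an bL => sz.
by rewrite ev_fetch (ev_idx3 (p_M R)) ?(p_wat R) //; lia.
Qed.

Lemma ev_pos st A a b c : rep st A -> wf A -> eval w st a < n -> eval w st b <= L ->
  eval w st c \in alst A (eval w st a) (eval w st b) ->
  eval w st (epos a b c) = index (eval w st c) (alst A (eval w st a) (eval w st b)).
Proof.
move=> R F an bL cs; have [nM LM _] := M_gt; have := w_lstm F an bL cs => cn.
by rewrite ev_fetch (ev_idx3 (p_M R)) ?(p_pos R) //; lia.
Qed.

Lemma rep_set_reg st A r x : rep st A -> r != 6 -> r != 7 -> r != 8 -> r != 60 ->
  rep (set_reg st r x) A.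
Proof.
move=> R r6 r7 r8 r60; case: R => *; split => //=.
- by rewrite eq_sym (negbTE r6).
- by rewrite eq_sym (negbTE r7).
- by rewrite eq_sym (negbTE r8).
- by rewrite eq_sym (negbTE r60).
Qed.

Lemma keep_set_reg k st r x : k <= r -> keep k st (set_reg st r x).
Proof. by move=> kr i ik /=; rewrite ltn_eqF // (leq_trans ik). Qed.

(** * Elementary operations on the stack, the lists and the watcher lists *)

Lemma wp_push st A r : rep st A -> wf A -> regs st r < n -> r < 60 ->
  wp w (push r) st (fun st' t => [/\ rep st' (pushA A (regs st r)),
    wf (pushA A (regs st r)), keep 60 st st' & t <= 20]).
Proof.
move=> R F rn r60; have [nM LM M1] := M_gt; have [w1 w2 w3] := W_facts.
apply: wp_if; first by rewrite /= (p_inq R rn) eqb0 negbK.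
rewrite /pushA; case vs: (_ \in _).
  by apply: wp_skip; split => //; move=> i _.
have sl := size_stk_le F.
apply/wp_seq/wp_store; [by rewrite /= (p_sp R)|reflexivity|].
apply/wp_seq/wp_store; [reflexivity|exact: ev_const|].
apply: wp_assign; first by rewrite ev_inc /= (p_sp R) //; lia.
split; last by [].
- fields R.
  + by rewrite size_rcons.
  + move=> i; rewrite size_rcons ltnS nth_rcons; case: (ltngtP i (size (astk A))) => //.
    by move=> lt _; rewrite (p_stk R).
  + move=> v vn; rewrite mem_rcons inE; case: eqP => // _.
    by rewrite (p_inq R).
- fields F; first by rewrite rcons_uniq vs (w_stk F).
  by move=> x; rewrite mem_rcons inE => /orP[/eqP->//|]; exact: w_stkm.
- by move=> i i60 /=; rewrite ltn_eqF.
Qed.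

Lemma wp_pop_stack st A l v : rep st A -> wf A -> astk A = rcons l v ->
  wp w pop_stack st (fun st' t => [/\ rep st' (set_stk A l),
    wf (set_stk A l), keep 14 st st', regs st' 14 = v & t <= 20]).
Proof.
move=> R F sE; have [nM LM M1] := M_gt; have [w1 w2 w3] := W_facts.
have sl := size_stk_le F; rewrite sE size_rcons in sl.
have vn : v < n by apply: (w_stkm F); rewrite sE mem_rcons mem_head.
have := w_stk F; rewrite sE rcons_uniq => /andP[vl ul].
apply/wp_seq/wp_assign.
  by rewrite ev_dec /= (p_sp R) sE size_rcons; [reflexivity|lia].
apply: wp_seq; apply: (@wp_assign _ _ _ v).
  by rewrite /= (p_stk R) sE ?size_rcons // nth_rcons ltnn eqxx.
apply: wp_store; [reflexivity|by apply: ev_const; lia|].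
split => //.
- fields R.
  + move=> i il; rewrite (p_stk R) sE ?size_rcons ?nth_rcons ?il //; lia.
  + move=> x xn; case: eqP => [->|/eqP xv]; first by rewrite (negbTE vl).
    by rewrite (p_inq R) // sE mem_rcons inE (negbTE xv).
- fields F; move=> x xl; apply: (w_stkm F).
  by rewrite sE mem_rcons inE xl orbT.
- by move=> i i60 /=; rewrite !ltn_eqF //; lia.
Qed.

Lemma upd2E (T : Type) (f : nat -> nat -> T) v j x v' j' :
  upd2 f v j x v' j' = if (v' == v) && (j' == j) then x else f v' j'.
Proof. by []. Qed.

Lemma wp_del st A r1 r2 r3 : rep st A -> wf A -> r1 < 40 -> r2 < 40 -> r3 < 40 ->
  regs st r1 < n -> regs st r2 <= L ->
  regs st r3 \in alst A (regs st r1) (regs st r2) ->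
  wp w (del r1 r2 r3) st (fun st' t =>
    [/\ rep st' (delA A (regs st r1) (regs st r2) (regs st r3)),
        wf (delA A (regs st r1) (regs st r2) (regs st r3)), keep 40 st st' & t <= 100]).
Proof.
move=> R F r1s r2s r3s vn jL xl; have [nM LM M1] := M_gt; have [w1 w2 w3] := W_facts.
set v := regs st r1 in vn xl *; set j := regs st r2 in jL xl *.
set x := regs st r3 in xl *; set l := alst A v j in xl *.
have sl : size l <= n by exact: size_lst_le.
have l0 : 0 < size l by case: (l) xl.
have ix : index x l < size l by rewrite index_mem.
have ul : uniq l by exact: w_lst.
have tl : last 0 l \in l by case: (l) l0 => //= a b _; exact: mem_last.
have tn : last 0 l < n by apply: (w_lstm F vn jL).
have rr r k : r < 40 -> 40 <= k -> (r == k) = false by move=> *; apply: ltn_eqF; lia.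
apply: wp_seq; apply: (@wp_assign _ _ _ (index x l)); first exact: ev_pos.
have R1 := rep_set_reg (r := 40) (index x l) R isT isT isT isT.
apply: wp_seq; apply: (@wp_assign _ _ _ (size l).-1).
  have e : eval w (set_reg st 40 (index x l)) (elen (Reg r1) (Reg r2)) = size l.
    by rewrite (ev_len R1) /= !rr.
  by rewrite ev_dec e //; lia.
have R2 := rep_set_reg (r := 41) (size l).-1 R1 isT isT isT isT.
apply: wp_seq; apply: (@wp_assign _ _ _ (last 0 l)).
  rewrite (ev_lst R2 F) /= !rr //; last by rewrite -/v -/j -/l; lia.
  by rewrite -/v -/j -/l nth_last.
apply: wp_seq; apply: (@wp_store _ _ _ _ (v * M + j) (size l).-1).
- by rewrite ev_idx2 /= ?rr ?(p_M R) //; rewrite -/v -/j; lia.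
- by [].
apply: wp_seq; apply: (@wp_store _ _ _ _ ((v * M + j) * M + index x l) (last 0 l)).
- by rewrite ev_idx3 /= ?rr ?(p_M R) //; rewrite -/v -/j; lia.
- by [].
apply: (@wp_store _ _ _ _ ((v * M + j) * M + last 0 l) (index x l)).
- by rewrite ev_idx3 /= ?rr ?(p_M R) //; rewrite -/v -/j; lia.
- by [].
split => //.
- fields R.
  + move=> v' j' vn' jL'; rewrite upd2E -/l idx2_eq; [|lia|lia].
    case: ifP => [_|_]; first by rewrite size_swap_del.
    by rewrite (p_len R).
  + move=> v' j' i vn' jL'; rewrite upd2E -/l.
    case: ifP => [/andP[/eqP-> /eqP->]|ne] il.
      rewrite size_swap_del // in il.
      have il' : i < size l by exact: leq_trans il (leq_pred _).
      rewrite nth_swap_del // idx3_eq ?eqxx /=; try lia.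
      by case: ifP => // _; rewrite (p_lst R).
    have := size_lst_le F vn' jL' => sl'.
    by rewrite idx3_eq ?andbA ?ne //=; [rewrite (p_lst R)|lia..].
  + move=> v' j' y vn' jL'; rewrite upd2E -/l.
    case: ifP => [/andP[/eqP-> /eqP->]|ne] yl; last first.
      have yn := w_lstm F vn' jL' yl.
      by rewrite idx3_eq ?andbA ?ne //=; [rewrite (p_pos R)|lia..].
    move: (yl); rewrite mem_swap_del // => /andP[yx yl'].
    have yn := w_lstm F vn jL yl'.
    have ud : uniq (swap_del l x) by exact: uniq_swap_del.
    have iy : index y l < size l by rewrite index_mem.
    have yi : index y l != index x l.
      by apply: contra yx => /eqP e; rewrite -(nth_index 0 yl') e nth_index.
    rewrite idx3_eq ?eqxx /=; try lia.
    have tE : last 0 l = nth 0 l (size l).-1 by rewrite nth_last.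
    (* Only the moved entry changes position. Since the new list has no duplicates, positions are
       compared through the entries found there. *)
    have [yt|yt] := eqVneq y (last 0 l).
      have xi : index x l < (size l).-1.
        have : index y l = (size l).-1 by rewrite yt tE index_uniq ?ltn_predL.
        by move=> e; rewrite e in yi; rewrite ltn_neqAle eq_sym yi -ltnS (ltn_predK l0).
      apply/eqP; rewrite -(nth_uniq 0 _ _ ud) ?index_mem ?size_swap_del //.
      by rewrite nth_index // nth_swap_del // eqxx yt.
    have iy' : index y l < (size l).-1.
      have : index y l != (size l).-1.
        by apply: contra yt => /eqP e; rewrite tE -e nth_index.
      by move=> e; rewrite ltn_neqAle e -ltnS (ltn_predK l0).
    rewrite (p_pos R) // -/l.
    apply/eqP; rewrite -(nth_uniq 0 _ _ ud) ?index_mem ?size_swap_del //.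
    by rewrite nth_index // nth_swap_del // (negbTE yi) nth_index.
- fields F.
  + move=> v' j' vn' jL'; rewrite upd2E -/l; case: ifP => _; last exact: w_lst.
    exact: uniq_swap_del.
  + move=> v' j' y vn' jL'; rewrite upd2E -/l; case: ifP => _; last exact: w_lstm.
    by rewrite mem_swap_del // => /andP[_]; exact: w_lstm.
- by move=> i i40 /=; rewrite !ltn_eqF //; lia.
Qed.

Lemma wp_add st A r1 r2 r3 : rep st A -> wf A -> r1 < 40 -> r2 < 40 -> r3 < 40 ->
  regs st r1 < n -> regs st r2 <= L -> regs st r3 < n ->
  regs st r3 \notin alst A (regs st r1) (regs st r2) ->
  regs st r1 \notin awat A (regs st r3) (regs st r2) ->
  wp w (add r1 r2 r3) st (fun st' t =>
    [/\ rep st' (addA A (regs st r1) (regs st r2) (regs st r3)),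
        wf (addA A (regs st r1) (regs st r2) (regs st r3)), keep 40 st st' & t <= 100]).
Proof.
move=> R F r1s r2s r3s vn jL xn xl vw; have [nM LM M1] := M_gt; have [w1 w2 w3] := W_facts.
set v := regs st r1 in vn xl vw *; set j := regs st r2 in jL xl vw *.
set x := regs st r3 in xn xl vw *; set l := alst A v j in xl *.
set m := awat A x j in vw *.
have ul : uniq l by exact: w_lst.
have um : uniq m by exact: w_wat.
have ul' : uniq (rcons l x) by rewrite rcons_uniq xl.
have um' : uniq (rcons m v) by rewrite rcons_uniq vw.
have lm' y : y \in rcons l x -> y < n.
  by rewrite mem_rcons inE => /orP[/eqP->//|]; exact: w_lstm.
have mm' y : y \in rcons m v -> y < n.
  by rewrite mem_rcons inE => /orP[/eqP->//|]; exact: w_watm.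
(* The extended list is still a duplicate-free list of vertices, so the slot written to has index
   below n, hence below the stride. *)
have sl : size l < n by have := leq_size_bounded ul' lm'; rewrite size_rcons.
have sm : size m < n by have := leq_size_bounded um' mm'; rewrite size_rcons.
have rr r k : r < 40 -> 40 <= k -> (r == k) = false by move=> *; apply: ltn_eqF; lia.
apply: wp_seq; apply: (@wp_assign _ _ _ (size l)); first exact: ev_len.
have R1 := rep_set_reg (r := 40) (size l) R isT isT isT isT.
apply: wp_seq; apply: (@wp_assign _ _ _ (size m)); first by rewrite (ev_wlen R1) /= !rr.
apply: wp_seq; apply: (@wp_store _ _ _ _ ((v * M + j) * M + size l) x).
- by rewrite ev_idx3 /= ?rr ?(p_M R) //; rewrite -/v -/j; lia.
- by rewrite /= !rr.
apply: wp_seq; apply: (@wp_store _ _ _ _ ((v * M + j) * M + x) (size l)).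
- by rewrite ev_idx3 /= ?rr ?(p_M R) //; rewrite -/v -/j -/x; lia.
- by [].
apply: wp_seq; apply: (@wp_store _ _ _ _ (v * M + j) (size l).+1).
- by rewrite ev_idx2 /= ?rr ?(p_M R) //; rewrite -/v -/j; lia.
- by rewrite ev_inc /=; lia.
apply: wp_seq; apply: (@wp_store _ _ _ _ ((x * M + j) * M + size m) v).
- by rewrite ev_idx3 /= ?rr ?(p_M R) //; rewrite -/x -/j; lia.
- by rewrite /= !rr.
apply: (@wp_store _ _ _ _ (x * M + j) (size m).+1).
- by rewrite ev_idx2 /= ?rr ?(p_M R) //; rewrite -/x -/j; lia.
- by rewrite ev_inc /=; lia.
split => //.
- fields R.
  + move=> v' j' vn' jL'; rewrite upd2E -/l -/m idx2_eq; [|lia|lia].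
    case: ifP => [_|_]; first by rewrite size_rcons.
    by rewrite (p_len R).
  + move=> v' j' i vn' jL'; rewrite upd2E -/l -/m.
    case: ifP => [/andP[/eqP-> /eqP->]|ne] il.
      rewrite size_rcons ltnS in il; rewrite idx3_eq ?eqxx /=; try lia.
      rewrite nth_rcons; case: ltngtP il => // il _; by rewrite (p_lst R).
    have := size_lst_le F vn' jL' => sl'.
    by rewrite idx3_eq ?andbA ?ne //=; [rewrite (p_lst R)|lia..].
  + move=> v' j' y vn' jL'; rewrite upd2E -/l -/m.
    case: ifP => [/andP[/eqP-> /eqP->]|ne] yl; last first.
      have yn := w_lstm F vn' jL' yl.
      by rewrite idx3_eq ?andbA ?ne //=; [rewrite (p_pos R)|lia..].
    have yn := lm' _ yl; rewrite idx3_eq ?eqxx /=; try lia.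
    rewrite -cats1 index_cat; move: yl; rewrite mem_rcons inE.
    case: eqP => [-> _|/eqP yx /= yl]; first by rewrite (negbTE xl) /= eqxx addn0.
    by rewrite yl (p_pos R).
  + move=> v' j' vn' jL'; rewrite upd2E -/l -/m idx2_eq; [|lia|lia].
    case: ifP => [_|_]; first by rewrite size_rcons.
    by rewrite (p_wlen R).
  + move=> v' j' i vn' jL'; rewrite upd2E -/l -/m.
    case: ifP => [/andP[/eqP-> /eqP->]|ne] il.
      rewrite size_rcons ltnS in il; rewrite idx3_eq ?eqxx /=; try lia.
      rewrite nth_rcons; case: ltngtP il => // il _; by rewrite (p_wat R).
    have := size_wat_le F vn' jL' => sl'.
    by rewrite idx3_eq ?andbA ?ne //=; [rewrite (p_wat R)|lia..].
- fields F.
  + by move=> v' j' vn' jL'; rewrite upd2E -/l -/m; case: ifP => _ //; exact: w_lst.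
  + by move=> v' j' y vn' jL'; rewrite upd2E -/l -/m; case: ifP => _; [exact: lm'|exact: w_lstm].
  + by move=> v' j' vn' jL'; rewrite upd2E -/l -/m; case: ifP => _ //; exact: w_wat.
  + by move=> v' j' y vn' jL'; rewrite upd2E -/l -/m; case: ifP => _; [exact: mm'|exact: w_watm].
- by move=> i i40 /=; rewrite !ltn_eqF //; lia.
Qed.

Lemma wp_pop_watch st A r3 r2 l v : rep st A -> wf A -> r2 < 33 -> r3 < 33 ->
  regs st r3 < n -> regs st r2 <= L ->
  awat A (regs st r3) (regs st r2) = rcons l v ->
  wp w (pop_watch r3 r2) st (fun st' t =>
    [/\ rep st' (set_wat A (upd2 (awat A) (regs st r3) (regs st r2) l)),
        wf (set_wat A (upd2 (awat A) (regs st r3) (regs st r2) l)),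
        keep 33 st st', regs st' 34 = v & t <= 50]).
Proof.
move=> R F r2s r3s xn jL; have [nM LM M1] := M_gt; have [w1 w2 w3] := W_facts.
set x := regs st r3 in xn *; set j := regs st r2 in jL *; move=> mE.
have := w_wat F xn jL; rewrite mE rcons_uniq => /andP[vl ul].
have sl : size l < n by have := size_wat_le F xn jL; rewrite mE size_rcons.
have rr r k : r < 33 -> 33 <= k -> (r == k) = false by move=> *; apply: ltn_eqF; lia.
apply: wp_seq; apply: (@wp_assign _ _ _ (size l)).
  have e : eval w st (ewlen (Reg r3) (Reg r2)) = (size l).+1.
    by rewrite (ev_wlen R) //= -/x -/j mE size_rcons.
  by rewrite ev_dec e //; lia.
have R1 := rep_set_reg (r := 33) (size l) R isT isT isT isT.
apply: wp_seq; apply: (@wp_assign _ _ _ v).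
  rewrite (ev_wat R1 F) /= !rr //; rewrite -/x -/j mE ?size_rcons //.
  by rewrite nth_rcons ltnn eqxx.
apply: (@wp_store _ _ _ _ (x * M + j) (size l)).
- by rewrite ev_idx2 /= ?rr ?(p_M R) //; rewrite -/x -/j; lia.
- by [].
split => //.
- fields R.
  + move=> v' j' vn' jL'; rewrite upd2E idx2_eq; [|lia|lia].
    by case: ifP => [_|_] //; rewrite (p_wlen R).
  + move=> v' j' i vn' jL'; rewrite upd2E.
    case: ifP => [/andP[/eqP-> /eqP->]|ne] il; last by rewrite (p_wat R).
    by rewrite (p_wat R) // mE ?nth_rcons ?il // size_rcons; lia.
- fields F.
  + by move=> v' j' vn' jL'; rewrite upd2E; case: ifP => _ //; exact: w_wat.
  + move=> v' j' y vn' jL'; rewrite upd2E; case: ifP => _; last exact: w_watm.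
    by move=> yl; apply: (w_watm F xn jL); rewrite mE mem_rcons inE yl orbT.
- by move=> i i40 /=; rewrite !ltn_eqF //; lia.
Qed.

(** * Path queries *)

Definition unchanged st st' :=
  [/\ forall r, r \notin [:: 0; 10; 11; 12] -> regs st' r = regs st r
    & forall b, b != 2 -> banks st' b = banks st b].

Lemma unchanged_rep st st' A : unchanged st st' -> rep st A -> rep st' A.
Proof. by case=> hr hb [*]; split; rewrite ?hr ?hb. Qed.

Lemma wp_query_none st A v : rep st A -> v < n -> regs st 0 = v -> ab A v = 0 ->
  wp w query_path st (fun st' t => [/\ unchanged st st', regs st' 0 = 0 & t <= 10]).
Proof.
move=> R vn r0 v0; have [w1 w2 w3] := W_facts.
apply: (@wp_if _ _ _ _ _ false); first by rewrite /= r0 (p_b R) // v0.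
apply: (@wp_assign _ _ _ 0); first by apply: ev_const; lia.
by split => //; split => // r; rewrite inE negb_or /= => /andP[/negbTE->].
Qed.

Lemma wp_query_path st A v p : rep st A ->
  v < n -> 0 < ab A v -> regs st 0 = v -> uniq (s :: p) ->
  (forall y, y \in s :: p -> y < n) ->
  (forall i, i <= size p -> iter i (apar A) v = nth 0 (s :: p) (size p - i)) ->
  wp w query_path st (fun st' t => [/\ unchanged st st', regs st' 0 = (size p).+1,
    [seq banks st' 2 i | i <- iota 0 (size p).+1] = s :: p & t <= 100 * (size p).+1]).
Proof.
move=> R vn v0 r0 up pn itE; have [nM LM M1] := M_gt; have [w1 w2 w3] := W_facts.
have sp : (size p).+1 <= n by exact: (leq_size_bounded up pn).
have xn i : i <= size p -> iter i (apar A) v < n.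
  by move=> ip; rewrite itE //; apply/pn/mem_nth; rewrite /=; lia.
(* The path is simple, so the source is met only at its end and the loop test counts the edges
   exactly. *)
have xs i : i <= size p -> (iter i (apar A) v == s) = (i == size p).
  move=> ip; rewrite itE // -[s in X in _ == X]/(nth 0 (s :: p) 0) nth_uniq //=; lia.
apply: (@wp_if _ _ _ _ _ true); first by rewrite /= r0 (p_b R) // -lt0n.
have test st1 i : regs st1 6 = s -> regs st1 10 = iter i (apar A) v -> i <= size p ->
    eval w st1 (Bin Eq (Bin Eq (Reg 10) (Reg 6)) (Const 0)) = (i != size p).
  move=> e6 e10 ip; rewrite ev_eq ev_eq ev_const; last by lia.
  by rewrite /= e6 e10 xs // eqb0.
apply: wp_seq; apply: (@wp_assign _ _ _ v) => //.
apply: wp_seq; apply: (@wp_assign _ _ _ 0); first by apply: ev_const; lia.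
apply: wp_seq; set st1 := set_reg _ _ _.
pose I1 k st2 T := exists i, [/\ i <= size p, k = size p - i, T <= 30 * i,
  unchanged st st2 /\ regs st2 0 = v
  & regs st2 10 = iter i (apar A) v /\ regs st2 11 = i].
have i1 : I1 (size p) st1 0.
  exists 0; split => //; first by rewrite subn0.
  split => //; split => // r; rewrite !inE !negb_or => /and4P[_ /negbTE h1 /negbTE h2 _].
  by rewrite /= h1 h2.
apply: (@wp_while _ _ _ I1 (size p) _ _ _ _ i1).
- move=> k st2 T [i [ip kE Tb [un r0'] [r10 r11]]].
  have R2 := unchanged_rep un R; have r6 := p_s R2.
  rewrite (test _ i) // eqb0 negbK => ni; have ip' : i < size p by rewrite ltn_neqAle ni.
  apply: wp_seq; apply: (@wp_assign _ _ _ i.+1); first by rewrite ev_inc /= r11 //; lia.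
  apply: (@wp_assign _ _ _ (iter i.+1 (apar A) v)).
    by rewrite /= r10 (p_par R2) // xn.
  exists (size p - i.+1); split; first by lia.
  exists i.+1; split => //; first by ecosts; lia.
  case: un => ur ub; split => //; split => // r nr; move: (nr).
  rewrite !inE !negb_or => /and4P[_ /negbTE h1 /negbTE h2 _].
  by rewrite /= h1 h2 ur.
move=> k st2 T [i [ip kE Tb [un r0'] [r10 r11]]].
have R2 := unchanged_rep un R; have r6 := p_s R2.
rewrite (test _ i) // => /eqP; rewrite eqb0 negbK => /eqP iE.
have T0 : T <= 30 * size p by rewrite -iE.
apply: wp_seq; apply: (@wp_assign _ _ _ (size p).+1).
  by rewrite ev_inc /= r11 iE //; lia.
apply: wp_seq; apply: (@wp_assign _ _ _ v) => //.
apply: wp_seq; set st3 := set_reg _ _ _.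
pose I2 k st4 T := exists i, [/\ i <= size p, k = size p - i, T <= 30 * i,
  unchanged st st4 /\ regs st4 12 = (size p).+1
  & [/\ regs st4 10 = iter i (apar A) v, regs st4 11 = size p - i
   & forall l, size p - i < l <= size p -> banks st4 2 l = nth 0 (s :: p) l]].
have i2 : I2 (size p) st3 0.
  exists 0; split => //; first by rewrite subn0.
    case: un => ur ub; split => //; split => // r nr; move: (nr).
    rewrite !inE !negb_or => /and4P[_ /negbTE h1 _ /negbTE h2].
    by rewrite /= h1 h2 ur.
  by split => //=; [rewrite r11 iE subn0 | move=> l; lia].
apply: (@wp_while _ _ _ I2 (size p) _ _ _ _ i2).
- move=> {}k st4 T' [{kE r10 r11 iE ip Tb}i [ip kE Tb [un4 r12] [r10 r11 cells]]].
  have R4 := unchanged_rep un4 R; have {}r6 := p_s R4.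
  rewrite (test _ i) // eqb0 negbK => ni; have ip' : i < size p by rewrite ltn_neqAle ni.
  apply: wp_seq; apply: wp_seq.
  apply: (@wp_store _ _ _ _ (size p - i) (nth 0 (s :: p) (size p - i))) => //.
    by rewrite /= r10 itE.
  apply: (@wp_assign _ _ _ (size p - i.+1)).
    by rewrite ev_dec /= r11; lia.
  apply: (@wp_assign _ _ _ (iter i.+1 (apar A) v)).
    by rewrite /= r10 (p_par R4) // xn.
  exists (size p - i.+1); split; first by lia.
  exists i.+1; split => //; first by ecosts; lia.
    case: un4 => ur ub; split => //; split; last by move=> b b2 /=; rewrite -ub // (negbTE b2).
    move=> r nr; move: (nr).
    rewrite !inE !negb_or => /and4P[_ /negbTE h1 /negbTE h2 _].
    by rewrite /= h1 h2 ur.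
  split => // l lp /=; case: eqP => [->//|ne]; apply: cells; lia.
move=> {}k st4 T' [{kE r10 r11 iE ip Tb}i [ip kE Tb' [un4 r12] [r10 r11 cells]]].
have R4 := unchanged_rep un4 R; have {}r6 := p_s R4.
rewrite (test _ i) // => /eqP; rewrite eqb0 negbK => /eqP iE.
apply: wp_seq; apply: (@wp_store _ _ _ _ 0 s) => //; first by apply: ev_const; lia.
apply: (@wp_assign _ _ _ (size p).+1) => //.
split => //.
- case: un4 => ur ub; split; last by move=> b b2 /=; rewrite -ub // (negbTE b2).
  by move=> r nr; move: (nr); rewrite inE negb_or => /andP[/negbTE h1 _]; rewrite /= h1 ur.
- apply: (@eq_from_nth _ 0); first by rewrite size_map size_iota.
  move=> l; rewrite size_map size_iota => lp.
  rewrite (nth_map 0) ?size_iota // nth_iota // add0n /=.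
  by case: l lp => // l lp; apply: cells; rewrite iE subnn; lia.
- by ecosts; lia.
Qed.

(** * Credit of stack and watchers, and the relaxation of one edge *)

Definition watch_total A := \sum_(v < n) \sum_(j < L.+1) size (awat A v j).

Lemma watch_total_upd A A' x j l : x < n -> j <= L ->
  (forall v i, v < n -> i <= L -> awat A' v i = upd2 (awat A) x j l v i) ->
  watch_total A' + size (awat A x j) = watch_total A + size l.
Proof.
move=> xn jL E; rewrite /watch_total.
have jL' : j < L.+1 by [].
rewrite (bigD1 (Ordinal xn)) //= (bigD1 (Ordinal jL')) //=.
rewrite [in RHS](bigD1 (Ordinal xn)) //= [in RHS](bigD1 (Ordinal jL')) //=.
rewrite E // /upd2 !eqxx /=.
rewrite (eq_bigr (fun i : 'I_L.+1 => size (awat A x i))); last first.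
  by move=> i; rewrite -val_eqE => ij; rewrite E ?leq_ord // /upd2 (negbTE ij) andbF.
rewrite [X in _ + X + _](eq_bigr (fun v : 'I_n => \sum_(i < L.+1) size (awat A v i))).
  by move: (\sum_(i < _ | _) _) (\sum_(i < _ | _) _) => a b; lia.
move=> v; rewrite -val_eqE => vx; apply: eq_bigr => i _.
by rewrite E ?leq_ord // /upd2 (negbTE vx).
Qed.

Variable alpha : nat.

(* A stack entry pays for processing its vertex, a watcher for its notification. *)
Definition phi1 A := alpha * size (astk A) + (alpha + 400) * watch_total A.

Lemma size_pushA A v : size (astk (pushA A v)) <= (size (astk A)).+1.
Proof. by rewrite /pushA; case: ifP => //= _; rewrite size_rcons. Qed.

Lemma mem_pushA A v x : (x \in astk (pushA A v)) = (x == v) || (x \in astk A).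
Proof.
rewrite /pushA; case: ifP => [vs|_] /=; last by rewrite mem_rcons inE.
by case: eqP => // ->.
Qed.

Lemma pushA_fields A v : [/\ ab (pushA A v) = ab A, apar (pushA A v) = apar A,
  alast (pushA A v) = alast A, alst (pushA A v) = alst A & awat (pushA A v) = awat A].
Proof. by rewrite /pushA; case: ifP. Qed.

Lemma phi1_pushA A v : phi1 (pushA A v) <= phi1 A + alpha.
Proof.
rewrite /phi1 /watch_total; have [_ _ _ _ ->] := pushA_fields A v.
by have := size_pushA A v; move: (\sum_(i < _) _) => S; nia.
Qed.

(** Watchers are served from the end of their list; in the loop invariant [l2] is the part already
    served. The last premise is what the invariant guarantees for watchers that are not stale. *)
Lemma wp_fire st A r z0 :
  rep st A -> wf A -> r < 30 -> regs st r < n -> regs st 32 <= L ->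
  regs st 30 = z0 -> z0 <= Z 0 ->
  (forall v, v \in awat A (regs st r) (regs st 32) ->
     alast A v (regs st 32) = cell (regs st 32) z0 ->
     regs st r \in alst A v (regs st 32)) ->
  wp w (fire r) st (fun st' t => exists A', [/\ rep st' A', wf A', keep 33 st st',
   [/\ ab A' = ab A, apar A' = apar A & alast A' = alast A] &
   [/\ forall v i, v < n -> i <= L -> alst A' v i =
        if [&& i == regs st 32, v \in awat A (regs st r) i
             & alast A v i == cell i z0]
        then swap_del (alst A v i) (regs st r) else alst A v i,
       forall v i, v < n -> i <= L -> awat A' v i =
         upd2 (awat A) (regs st r) (regs st 32) [::] v i,
       forall v, (v \in astk A') = (v \in astk A) || (v \in awat A (regs st r) (regs st 32))
     & t + phi1 A' <= phi1 A + 20]]).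
Proof.
move=> R0 F0 r30 xn jL z30 z0Z xin; have [nM LM M1] := M_gt; have [w1 w2 w3] := W_facts.
set x := regs st r in xn xin *; set j := regs st 32 in jL xin *.
pose I k st1 T := exists A1 l1 l2, [/\ rep st1 A1, wf A1, keep 33 st st1,
  [/\ ab A1 = ab A, apar A1 = apar A & alast A1 = alast A] &
  [/\ awat A x j = l1 ++ l2 /\ k = size l1,
    forall v i, v < n -> i <= L -> alst A1 v i =
        if [&& i == j, v \in l2 & alast A v i == cell i z0]
        then swap_del (alst A v i) x else alst A v i,
    forall v i, v < n -> i <= L -> awat A1 v i = upd2 (awat A) x j l1 v i,
    forall v, (v \in astk A1) = (v \in astk A) || (v \in l2)
    & T + phi1 A1 <= phi1 A]].
apply: (@wp_while _ _ _ I (size (awat A x j))).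
- move=> k st1 T [A1 [l1 [l2 [R F K [eb' ep el] [[lE kE] lst wat stk ph]]]]].
  have r1 : regs st1 r = x by rewrite K //; lia.
  have r32 : regs st1 32 = j by rewrite K.
  have r30' : regs st1 30 = z0 by rewrite K.
  have wE : awat A1 x j = l1 by rewrite wat // /upd2 !eqxx.
  rewrite (ev_wlen R) /= ?r1 ?r32 // wE size_eq0.
  case/lastP: l1 => [|l1 v] // in lE kE wat ph wE * => _.
  have vin : v \in awat A x j by rewrite lE mem_cat mem_rcons mem_head.
  have vn : v < n by exact: w_watm F0 _ _ _ xn jL vin.
  have vl2 : v \notin l2.
    have := w_wat F0 xn jL; rewrite lE cat_uniq => /and3P[_ /hasPn h _].
    by apply/negP => /h; rewrite mem_rcons mem_head.
  have vlE : alst A1 v j = alst A v j by rewrite lst // (negbTE vl2) andbF.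
  apply: wp_seq.
  have P : awat A1 (regs st1 r) (regs st1 32) = rcons l1 v by rewrite r1 r32.
  have := wp_pop_watch (r2 := 32) R F isT _ _ _ P.
  rewrite r1 r32 => /(_ _ xn jL) P'; apply: wp_mono (P' _); last by lia.
  move=> {P P'}st2 t2 [R2 F2 K2 v2 t2b].
  set A2 := set_wat _ _ in R2 F2.
  have r1' : regs st2 r = x by rewrite K2 //; lia.
  have r32' : regs st2 32 = j by rewrite K2.
  have r30'' : regs st2 30 = z0 by rewrite K2.
  apply: wp_seq.
  have : wp w (If (Bin Eq (elast (Reg 34) (Reg 32)) (ecell (Reg 32) (Reg 30)))
            (del 34 32 r) Skip) st2 (fun st3 t3 => exists A3,
     [/\ rep st3 A3, wf A3, keep 40 st2 st3, t3 <= 150 &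
     [/\ [/\ ab A3 = ab A1, apar A3 = apar A1 & alast A3 = alast A1],
         forall v' i, alst A3 v' i =
           if [&& i == j, v' == v & alast A v' i == cell i z0]
           then swap_del (alst A1 v' i) x else alst A1 v' i,
         awat A3 = awat A2 & astk A3 = astk A1]]).
    apply: (@wp_if _ _ _ _ _ (alast A v j == cell j z0)).
      rewrite ev_eq (ev_last R2) ?(ev_cell R2) /= ?v2 ?r32' ?r30'' //.
      by rewrite eqb0 negbK el.
    case: ifP => [/eqP lz|lz].
      have xl : x \in alst A2 v j by rewrite /= vlE; apply: xin.
      have := wp_del (r1 := 34) (r2 := 32) (r3 := r) R2 F2 isT isT.
      rewrite v2 r1' r32' => P; apply: wp_mono (P _ vn jL xl); last by lia.
      move=> st3 t3 [R3 F3 K3 t3b]; exists (delA A2 v j x); split => //.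
      - by ecosts; lia.
      split => //= v' i; rewrite /upd2.
      by case: (v' =P v) => [->|_]; case: (i =P j) => [->|_] //=; rewrite lz eqxx.
    apply: wp_skip; exists A2; split => //.
    split => // v' i; case: (i =P j) => [->|] //=.
    by case: (v' =P v) => [->|] //=; rewrite lz.
  apply: wp_mono => st3 t3 [A3 [R3 F3 K3 t3b [[b3 p3 l3] lst3 wat3 stk3]]].
  have v3 : regs st3 34 = v.
    by rewrite K3.
  have vn3 : regs st3 34 < n by rewrite v3.
  apply: wp_mono (wp_push R3 F3 vn3 isT) => st4 t4.
  rewrite v3 => -[R4 F4 K4 t4b].
  have [b4 p4 l4 lst4 wat4] := pushA_fields A3 v.
  exists (size l1); split; first by rewrite kE size_rcons.
  exists (pushA A3 v), l1, (v :: l2); split => //.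
  - by move=> i i33; rewrite K4 ?K3 ?K2 ?K //; lia.
  - by rewrite b4 p4 l4 b3 p3 l3.
  split.
  - by rewrite lE cat_rcons.
  - move=> v' i vn' iL; rewrite lst4 lst3 lst // inE.
    case: (i =P j) => [->|_] //=; case: (v' =P v) => [->|_] //=.
    by rewrite (negbTE vl2).
  - move=> v' i vn' iL; rewrite wat4 wat3 /= /upd2 wat // /upd2.
    by case: ((v' == x) && (i == j)).
  - by move=> v'; rewrite mem_pushA stk3 stk inE orbA [in RHS]orbCA orbA.
  - have := phi1_pushA A3 v; ecosts.
    have wt : watch_total A3 + size (awat A1 x j) = watch_total A1 + size l1.
      by apply: watch_total_upd => // v' i _ _; rewrite wat3.
    rewrite wE size_rcons in wt.
    (* A popped watcher releases [alpha + 400]: [alpha] for the stack entry it may create, the rest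
       for this round. *)
    have : phi1 A3 + (alpha + 400) = phi1 A1.
      rewrite /phi1 stk3; move: (alpha + 400) => be.
      have -> : watch_total A1 = (watch_total A3).+1 by lia.
      by rewrite mulnS; lia.
    by lia.
- move=> k st1 T [A1 [l1 [l2 [R F K fl [[lE kE] lst wat stk ph]]]]] w0.
  have r1 : regs st1 r = x by rewrite K //; lia.
  have r32 : regs st1 32 = j by rewrite K.
  have wE : awat A1 x j = l1 by rewrite wat // /upd2 !eqxx.
  move: w0; rewrite (ev_wlen R) /= ?r1 ?r32 // wE => /size0nil l10.
  rewrite l10 /= in lE wat.
  exists A1; split => //; split => //.
  - move=> v i vn iL; rewrite lst //; case: (i =P j) => [->|] //=.
    by rewrite lE.
  - by move=> v; rewrite stk lE.
  - by ecosts; lia.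
exists A, (awat A x j), [::]; split => //; split => //.
- by rewrite cats0.
- by move=> v i vn iL; rewrite andbF.
- by move=> v i vn iL; rewrite /upd2; case: ifP => // /andP[/eqP-> /eqP->].
- by move=> v; rewrite orbF.
Qed.

Lemma rep_set_b st A x u b : rep st A -> x < n -> u < n ->
  rep (set_cell (set_cell st 1 x b) 3 x u)
    (Ast (upd (ab A) x b) (upd (apar A) x u) (alast A) (alst A) (awat A) (astk A)).
Proof.
move=> R xn un; fields R.
- by move=> v vn; rewrite /upd; case: ifP => // _; rewrite (p_b R).
- by move=> v vn; rewrite /upd; case: ifP => // _; rewrite (p_par R).
Qed.

(** Notifications are paid by the watchers, so what remains is [alpha] for pushing the head of the
    edge and a constant per level for comparing cells. *)
Lemma wp_relax st A ru rw : let u := regs st ru in let x := regs st rw in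
  rep st A -> wf A -> ru < 30 -> rw < 30 -> u < n -> x < n -> u != x -> ab A u < n ->
  (forall v i, i <= L -> v \in awat A x i -> alast A v i = zc A i x ->
     x \in alst A v i) ->
  wp w (relax ru rw) st (fun st' t => exists A', [/\ rep st' A', wf A',
    keep 30 st st', relaxed n num den A A' u x
    & t + phi1 A' <= phi1 A + alpha + 400 * L.+1]).
Proof.
move=> u x R0 F0 u30 x30 un xn ux bu xin.
have [nM LM M1] := M_gt; have [w1 w2 w3] := W_facts.
set z0 := Z (ab A x); set b1 := (ab A u).+1; set z1 := Z b1.
have bx : ab A x <= n by exact: w_b F0 _ xn.
have z0Z : z0 <= Z 0 by apply: Z_le0; lia.
have z1Z : z1 <= Z 0 by apply: Z_le0; rewrite /b1; lia.
have LW : L.+1 < 2 ^ w by lia.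
have rr r k : r < 30 -> 30 <= k -> (r == k) = false by move=> *; apply: ltn_eqF; lia.
apply: wp_seq; apply: (@wp_assign _ _ _ z0).
  by rewrite /= (p_b R0) // (p_z R0) //; exact: leqW.
apply: wp_seq; apply: (@wp_store _ _ _ _ x b1).
- by rewrite /= rr.
- have e : eval w (set_reg st 30 z0) (eb (Reg ru)) = ab A u.
    by rewrite /= rr // (p_b R0).
  by rewrite ev_inc e // ; lia.
apply: wp_seq; apply: (@wp_store _ _ _ _ x u); rewrite /= ?rr //.
have R1 := rep_set_b b1 (rep_set_reg (r := 30) z0 R0 isT isT isT isT) xn un.
move: R1; set st1 := set_cell _ _ _ _; set A1 := Ast _ _ _ _ _ _ => R1.
have x1 : regs st1 rw = x by rewrite /= rr.
have F1 : wf A1.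
  fields F0; move=> v vn; rewrite /upd; case: ifP => // _; exact: w_b F0 _ vn.
apply: wp_seq; apply: (@wp_assign _ _ _ z1).
  have e : eval w st1 (eb (Reg rw)) = b1.
    by rewrite ev_fetch [eval _ _ _]/= rr // (p_b R1) //= /upd eqxx.
  by rewrite ev_fetch e (p_z R1) //; rewrite /b1; lia.
apply: wp_seq; apply: (@wp_assign _ _ _ 0); first by apply: ev_const; lia.
apply: wp_seq.
set st2 := set_reg _ _ _.
have R2 : rep st2 A1 by do 2![apply: rep_set_reg => //].
have K2 : keep 30 st st2 by move=> i i30 /=; rewrite !rr.
pose chg i := zc A i x != cell i z1.
pose I k st3 T := exists A3 j, [/\ [/\ rep st3 A3, wf A3 & keep 30 st st3],
  [/\ j <= L.+1, k = L.+1 - j, regs st3 32 = j, regs st3 30 = z0 & regs st3 31 = z1],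
  [/\ ab A3 = ab A1, apar A3 = apar A1 & alast A3 = alast A] &
  [/\ forall v i, v < n -> i <= L -> alst A3 v i =
        if [&& i < j, chg i, v \in awat A x i & alast A v i == zc A i x]
        then swap_del (alst A v i) x else alst A v i,
    forall v i, v < n -> i <= L -> awat A3 v i =
       if [&& i < j, v == x & chg i] then [::] else awat A v i,
    forall v, (v \in astk A3) <-> v \in astk A \/
       exists i, [/\ i < j, i <= L, chg i & v \in awat A x i]
    & T + phi1 A3 <= phi1 A + 150 * j]].
have iL0 : I L.+1 st2 0.
  exists A1, 0; split => //; split => //; last 2 first.
  - by move=> v; split; [left | case=> // -[i []]].
  - by rewrite muln0 add0n addn0.
apply: (@wp_while _ _ _ I L.+1 _ _ _ _ iL0).
- move=> k st3 T [A3 [j [[R F K] [jL kE r32 r30 r31] [b3 p3 l3] [lst wat stk ph]]]].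
  have x3 : regs st3 rw = x by rewrite K.
  rewrite ev_lt eqb0 negbK ev_inc ?[eval _ _ _]/= ?(p_L R) ?r32 // ltnS => jL'.
  apply: wp_seq.
  have : wp w (If (Bin Eq (ecell (Reg 32) (Reg 30)) (ecell (Reg 32) (Reg 31)))
      Skip (fire rw)) st3 (fun st4 t4 => exists A4,
     [/\ [/\ rep st4 A4, wf A4 & keep 33 st3 st4],
     [/\ ab A4 = ab A3, apar A4 = apar A3 & alast A4 = alast A3] &
     [/\ forall v i, v < n -> i <= L -> alst A4 v i =
        if [&& i == j, chg i, v \in awat A x i & alast A v i == zc A i x]
        then swap_del (alst A v i) x else alst A3 v i,
      forall v i, v < n -> i <= L -> awat A4 v i =
       if [&& i == j, v == x & chg i] then [::] else awat A3 v i,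
      forall v, (v \in astk A4) = (v \in astk A3) || (chg j && (v \in awat A x j))
      & t4 + phi1 A4 <= phi1 A3 + 60]]).
    apply: (@wp_if _ _ _ _ _ (~~ chg j)).
      rewrite ev_eq eqb0 negbK !(ev_cell R) /= ?r30 ?r31 ?r32 //.
      by rewrite /chg negbK.
    have wE : awat A3 x j = awat A x j by rewrite wat // ltnn.
    have lE v : v < n -> alst A3 v j = alst A v j by move=> vn; rewrite lst // ltnn.
    case: ifP => [cj|/negbFE cj].
      apply: wp_skip; exists A3; split => //; split.
      - by move=> v i _ _; case: eqP => //= ->; rewrite (negbTE cj).
      - by move=> v i _ _; case: eqP => //= ->; rewrite (negbTE cj) andbF.
      - by move=> v; rewrite (negbTE cj) orbF.
      - by ecosts; lia.
    have xin3 v : v \in awat A3 (regs st3 rw) (regs st3 32) ->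
      alast A3 v (regs st3 32) = cell (regs st3 32) z0 ->
      regs st3 rw \in alst A3 v (regs st3 32).
      rewrite r32 x3 wE l3 => vw lz; rewrite lE; last exact: w_watm F0 _ _ _ xn jL' vw.
      exact: xin vw lz.
    have := wp_fire R F x30 _ _ r30 z0Z xin3; rewrite x3 r32 => /(_ xn jL').
    apply: wp_mono => st4 t4 [A4 [R4 F4 K4 [b4 p4 l4] [lst4 wat4 stk4 ph4]]].
    exists A4; split => //; split => //.
    - move=> v i vn iL; rewrite lst4 // l3.
      case: (i =P j) => [->|_] //=; by rewrite cj wE lE.
    - move=> v i vn iL; rewrite wat4 // /upd2.
      case: (i =P j) => [->|_] /=; last by rewrite andbF.
      by rewrite andbT cj andbT.
    - by move=> v; rewrite stk4 wE cj.
    - by ecosts; lia.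
  apply: wp_mono => st4 t4 [A4 [[R4 F4 K4] [b4 p4 l4] [lst4 wat4 stk4 ph4]]].
  have r32' : regs st4 32 = j by rewrite K4.
  apply: (@wp_assign _ _ _ j.+1); first by rewrite ev_inc /= r32' //; lia.
  exists (L.+1 - j.+1); split; first by rewrite kE; lia.
  exists A4, j.+1; split.
  - split => //; first exact: rep_set_reg.
    by move=> i i30 /=; rewrite rr // K4 ?K //; lia.
  - by split; rewrite //= ?K4 //; lia.
  - by rewrite b4 p4 l4.
  split.
  - move=> v i vn iL; rewrite lst4 // lst // [i < j.+1]ltnS [i <= j]leq_eqVlt.
    by case: (i =P j) => [->|_] //=; rewrite ltnn.
  - move=> v i vn iL; rewrite wat4 // wat // [i < j.+1]ltnS [i <= j]leq_eqVlt.
    by case: (i =P j) => [->|_] //=; rewrite ltnn.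
  - move=> v; rewrite stk4; split.
      case/orP => [/stk[->|[i [ij iL ci vi]]]|/andP[cj vj]]; first by left.
        by right; exists i; split => //; lia.
      by right; exists j; split.
    case=> [vs|[i [ij iL ci vi]]]; first by apply/orP; left; apply/stk; left.
    move: ij; rewrite ltnS leq_eqVlt => /orP[/eqP ij|ij].
      by apply/orP; right; rewrite -ij ci vi.
    by apply/orP; left; apply/stk; right; exists i.
  - by ecosts; lia.
- move=> k st3 T [A3 [j [[R F K] [jL kE r32 r30 r31] [b3 p3 l3] [lst wat stk ph]]]].
  have x3 : regs st3 rw = x by rewrite K.
  rewrite ev_lt ev_inc ?[eval _ _ _]/= ?(p_L R) ?r32 // => /eqP.
  rewrite eqb0 -leqNgt => jL'; have jE : j = L.+1 by lia.
  have xn3 : regs st3 rw < n by rewrite x3.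
  have x60 : rw < 60 by lia.
  apply: wp_mono (wp_push R F xn3 x60) => st4 t4; rewrite x3 => -[R4 F4 K4 t4b].
  have [b4 p4 l4 lst4 wat4] := pushA_fields A3 x.
  have zE i : zc (pushA A3 x) i x = cell i z1.
    by rewrite /zcell b4 b3 /= /upd eqxx.
  exists (pushA A3 x); split => //.
  - by move=> i i30; rewrite K4 ?K //; lia.
  - split.
    + by rewrite b4 b3.
    + by rewrite p4 p3.
    + by rewrite l4 l3.
    + by move=> v i vn iL; rewrite lst4 lst // jE ltnS iL zE.
    + by move=> v i vn iL; rewrite wat4 wat // jE ltnS iL zE.
    + exact: w_stk F4.
    + move=> v; rewrite mem_pushA; split.
        case/orP => [/eqP->|/stk[vs|[i [ij iL ci vi]]]]; [by constructor 2|by constructor 1|].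
        by constructor 3; exists i; rewrite zE.
      case=> [vs|->|[i [iL]]]; [|by rewrite eqxx|rewrite zE => ci vi].
        by apply/orP; right; apply/stk; left.
      by apply/orP; right; apply/stk; right; exists i; split => //; rewrite jE ltnS.
  - have := phi1_pushA A3 x; ecosts; rewrite jE in ph; lia.
Qed.

(** * Preservation of the invariant by new edges and scans *)

Notation inv := (inv n num den s).
Notation settled := (settled n num den).
Notation no_pend := (fun _ _ _ : nat => false).

Definition unpend (pend : nat -> nat -> nat -> bool) v j x :=
  fun v' j' x' => pend v' j' x' && ~~ [&& v' == v, j' == j & x' == x].

Lemma inv_ext A E E' pend pend' X : inv A E pend X -> E =i E' ->
  (forall v j x, pend v j x = pend' v j x) -> inv A E' pend' X.
Proof.
move=> I EE pp; fields I.
- by move=> u x; rewrite -EE; apply: i_E I _ _.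
- by move=> v vn v0 vs; rewrite -EE; apply: i_par I _ vn v0 vs.
- by move=> v x j; rewrite -EE -pp; apply: i_edge I _ _ _.
- by move=> v x j vn jL; rewrite -EE -pp; apply: i_mem I _ _ _ vn jL.
Qed.

(** A new edge is exempt at every level until it has been relaxed and entered in the lists, which
    [inv_skip] and [inv_add] do level by level. *)
Lemma inv_new_edge A E u x : inv A E no_pend [::] -> (u, x) \notin E ->
  u < n -> x < n ->
  inv A ((u, x) :: E) (fun v j y => (v == u) && (y == x)) [::].
Proof.
move=> I ux un xn; fields I.
- by move=> v y; rewrite inE => /orP[/eqP[-> ->]//|]; apply: i_E I _ _.
- move=> v vn v0 vs; have [p1 p2 p3] := i_par I vn v0 vs.
  by split => //; rewrite inE p2 orbT.
- move=> v y j; rewrite inE => /orP[/eqP[-> ->]|vy] jL; first by rewrite !eqxx.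
  by move=> _; apply: i_edge I _ _ _ vy jL isT.
- move=> v y j vn jL; rewrite (i_mem I) // inE xpair_eqE.
  by case: (v =P u) => [->|_] //=; case: (y =P x) => [->|_] //=; rewrite (negbTE ux).
Qed.

Lemma inv_skip A E pend X v j x : inv A E pend X -> v < n -> j <= L ->
  (0 < alast A v j -> zc A j x <= alast A v j) -> alast A v j != zc A j x ->
  inv A E (unpend pend v j x) X.
Proof.
move=> I vn jL le ne; fields I.
- move=> v' x' j' vE jL'; rewrite /unpend negb_and negbK.
  case/orP => [np|/and3P[/eqP-> /eqP-> /eqP->] //]; first exact: i_edge I _ _ _ vE jL' np.
- move=> v' x' j' vn' jL'; rewrite (i_mem I) // /unpend negb_and negbK.
  case: (v' =P v) => [->|_]; last by rewrite orbF.
  case: (j' =P j) => [->|_]; last by rewrite orbF.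
  case: (x' =P x) => [->|_]; last by rewrite orbF.
  by rewrite (negbTE ne) !andbF.
Qed.

Lemma inv_add A E pend X v j x : inv A E pend X -> v < n -> j <= L ->
  (v, x) \in E -> pend v j x -> alast A v j = zc A j x ->
  inv (addA A v j x) E (unpend pend v j x) X.
Proof.
move=> I vn jL vxE pd lz; have [_ xn] := i_E I vxE.
have xl : x \notin alst A v j by rewrite (i_mem I) // pd /= andbF.
have vw : v \notin awat A x j.
  by apply: contra xl => /(i_watm I xn jL)[_ _]; apply.
fields I.
- move=> v' x' j' vE jL'; rewrite /unpend negb_and negbK.
  case/orP => [np|/and3P[/eqP-> /eqP-> /eqP->] _]; first exact: i_edge I _ _ _ vE jL' np.
  by rewrite lz.
- move=> v' j' vn' jL'; rewrite upd2E; case: ifP => _; last exact: i_lst I _ _ vn' jL'.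
  by rewrite rcons_uniq xl (i_lst I).
- move=> v' x' j' vn' jL'; rewrite upd2E /unpend negb_and negbK.
  have m := i_mem I x' vn' jL'.
  case: (v' =P v) m => [->|_] m; last by rewrite orbF.
  case: (j' =P j) m => [->|_] m; last by rewrite orbF.
  rewrite /= mem_rcons inE; case: (x' =P x) => [->|_] /=; last by rewrite orbF (i_mem I).
  by rewrite vxE orbT /= /zcell /= -/(zc A j x) lz eqxx.
- move=> x' j' xn' jL'; rewrite upd2E; case: ifP => _; last exact: i_wat I _ _ xn' jL'.
  by rewrite rcons_uniq vw (i_wat I).
- have wm v' x' j' : x' < n -> j' <= L -> v' \in awat A x' j' ->
    [/\ v' < n, 0 < alast A v' j' <= zc A j' x'
      & alast A v' j' = zc A j' x' -> x' \in upd2 (alst A) v j (rcons (alst A v j) x) v' j'].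
    move=> xn' jL' /(i_watm I xn' jL')[h1 h2 h3]; split => // /h3.
    rewrite upd2E; case: ifP => // /andP[/eqP-> /eqP->].
    by rewrite mem_rcons inE orbC => ->.
  move=> v' x' j' xn' jL'; rewrite upd2E; case: ifP => [|_]; last exact: wm.
  case/andP => /eqP xx /eqP jj; rewrite mem_rcons inE => /orP[/eqP->|]; last first.
    by rewrite -{1}xx -{1}jj; apply: wm.
  rewrite xx jj; split; rewrite ?lz ?leqnn //.
  by rewrite upd2E !eqxx /= mem_rcons mem_head.
- move=> v' x' j' vn' jL'; rewrite !upd2E.
  case: (v' =P v) => [->|nv] /=.
    case: (j' =P j) => [->|nj] /=.
      rewrite mem_rcons inE; case: (x' =P x) => [->|_] /=.
        by rewrite mem_rcons mem_head.
      exact: i_lw I _ _ _ vn jL.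
    by rewrite andbF; apply: i_lw I _ _ _ vn jL'.
  move=> xl'; have vw' := i_lw I vn' jL' xl'; case: ifP => // /andP[/eqP xx /eqP jj].
  by rewrite mem_rcons inE -{1}xx -{1}jj vw' orbT.
- move=> v' vn' v0' vs' vX' j' jL' h; apply: (i_set I) => // i ij.
  apply: leq_ltn_trans (h i ij); rewrite /= upd2E; case: ifP => // /andP[/eqP-> /eqP->].
  by rewrite size_rcons.
Qed.

Definition eventA A v j :=
  Ast (ab A) (apar A) (upd2 (alast A) v j (yc A j v)) (upd2 (alst A) v j [::])
    (awat A) (astk A).

(** Level j + 1 is up to date, so an out-neighbour outside its list lies strictly below the cell of
    [v] there, and by nesting strictly below the new cell at level j. Only the members of that list
    become exempt and await the scan. *)
Lemma inv_event A E X v j : inv A E no_pend X -> v \in X -> v < n -> 0 < ab A v ->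
  j < L -> alast A v j != yc A j v -> alast A v j.+1 = yc A j.+1 v ->
  inv (eventA A v j) E
    (fun v' j' x => [&& v' == v, j' == j & x \in alst A v j.+1]) X.
Proof.
move=> I vX vn v0 jL ne up; have jL1 := ltnW jL.
have bn := inv_bn I.
have low x : (v, x) \in E -> x \notin alst A v j.+1 -> zc A j x < yc A j v.
  move=> vxE; rewrite (i_mem I) // vxE /= up => ne1.
  have [_ xn] := i_E I vxE.
  have l0 : 0 < alast A v j.+1 by rewrite up.
  have le := i_edge I vxE jL isT l0; rewrite up in le.
  rewrite ltnNge; apply: contra ne1 => h.
  rewrite eqn_leq le andbT; apply: cell_up h => //; apply: Z_le0.
    by have := bn _ vn; lia.
  by have := bn _ xn; lia.
(* The last scanned cell moves strictly down, so all old watcher entries of [v] at level j turn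
   stale, as [i_watm] allows. *)
have lt : 0 < alast A v j -> yc A j v < alast A v j.
  by move=> /(i_last I vn jL)[_ h]; rewrite ltn_neqAle eq_sym ne.
have yE v' j' : yc (eventA A v j) j' v' = yc A j' v' by [].
have zE v' j' : zc (eventA A v j) j' v' = zc A j' v' by [].
fields I.
- move=> v' vn'; rewrite upd2E; case: ifP => [/andP[_ /eqP e]|_]; first by move: jL; rewrite e ltnn.
  exact: i_lastL I _ vn'.
- move=> v' j' vn' jL'; rewrite upd2E; case: ifP => [/andP[/eqP-> /eqP->]//|_].
  exact: i_last I _ _ vn' jL'.
- move=> v' x j' vE jL'; rewrite upd2E zE.
  case: (v' =P v) vE => [->|_] vE /=; last by move=> _; apply: i_edge I _ _ _ vE jL' isT.
  case: (j' =P j) => [->|_] /=; last by move=> _; apply: i_edge I _ _ _ vE jL' isT.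
  by move=> xl _; apply/ltnW/low.
- by move=> v' j' vn' jL'; rewrite upd2E; case: ifP => // _; apply: i_lst I _ _ vn' jL'.
- move=> v' x j' vn' jL'; rewrite !upd2E zE.
  case: (v' =P v) => [->|_] /=; last by rewrite (i_mem I).
  case: (j' =P j) => [->|_] /=; last by rewrite (i_mem I).
  apply/esym/negbTE/negP => /and3P[vE xl /eqP e].
  by have := low _ vE xl; rewrite e ltnn.
- move=> v' x j' xn jL' vw; rewrite !upd2E zE.
  have [h1 /andP[h2 h3] h4] := i_watm I xn jL' vw.
  case: (v' =P v) h1 h2 h3 h4 => [->|_] h1 h2 h3 h4 /=; last by split => //; rewrite h2.
  case: (j' =P j) h2 h3 h4 => [->|_] h2 h3 h4 /=; last by split => //; rewrite h2.
  have h5 := leq_trans (lt h2) h3; split => //; first exact: ltnW.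
  by move=> e; move: h5; rewrite e ltnn.
- move=> v' x j' vn' jL'; rewrite upd2E; case: ifP => // _; exact: i_lw I _ _ _ vn' jL'.
- move=> v' vn' v0' vs' vX'.
  have vv : v' == v = false by apply: contraNF vX' => /eqP->.
  move=> j' jL' h; rewrite /= upd2E vv /= yE; apply: (i_set I) => // i ij.
  by have := h i ij; rewrite /= upd2E vv.
Qed.

Lemma sum_decr m (f f' : nat -> nat) x d : x < m -> f' x + d <= f x ->
  (forall v, v < m -> v != x -> f' v = f v) ->
  \sum_(v < m) f' v + d <= \sum_(v < m) f v.
Proof.
move=> xm h e; rewrite (bigD1 (Ordinal xm)) //= [leqRHS](bigD1 (Ordinal xm)) //=.
rewrite (eq_bigr (fun v : 'I_m => f v)); last first.
  by move=> v; rewrite -val_eqE => vx; apply: e.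
by move: (\sum_(i < _ | _) _) => S; lia.
Qed.

(** Infinity ranks above all finite encodings, so that reaching a vertex for the first time also
    releases credit. *)
Definition rank b := if b == 0 then n.+1 else b.

(** A level never scanned counts one more than its highest cell, so that the first scan is paid as
    well. *)
Definition cells_left A v j :=
  if alast A v j == 0 then (cell j (Z 0)).+1 else alast A v j.

(* A unit of [rank] pays for a relaxation, a cell still ahead for one scan. *)
Definition phi2 A :=
  (alpha + 400 * L.+1) * \sum_(v < n) rank (ab A v)
  + (alpha + 1000) * \sum_(v < n) \sum_(j < L) 2 ^ j.+1 * cells_left A v j.

Definition phi A := phi1 A + phi2 A.

Lemma wf_inv A E pend X : inv A E pend X -> wf A.
Proof.
move=> I; split.
- by move=> v; apply: inv_bn I.
- exact: i_lst I.
- by move=> v j x; apply: inv_lst_lt I.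
- exact: i_wat I.
- by move=> v j x; apply: inv_wat_lt I.
- exact: i_stk I.
- by move=> x /(i_stkm I)[].
Qed.

(** One unit of [rank] releases exactly the charge of [wp_relax], which makes relaxations free in
    amortised cost. *)
Lemma phi2_relaxed A A' u x : relaxed n num den A A' u x -> x < n ->
  (ab A u).+1 < rank (ab A x) -> phi2 A' + (alpha + 400 * L.+1) <= phi2 A.
Proof.
move=> R xn lt; rewrite /phi2 /cells_left (r_last R).
have h : \sum_(v < n) rank (ab A' v) + 1 <= \sum_(v < n) rank (ab A v).
  apply: (@sum_decr _ (fun v => rank (ab A v)) (fun v => rank (ab A' v)) x) => //.
    by rewrite (r_b R) /upd eqxx {1}/rank /= addn1.
  by move=> v _ vx; rewrite (r_b R) /upd (negbTE vx).
rewrite addnAC leq_add2r -[X in _ + X]muln1 -mulnDr; exact: leq_mul (leqnn _) h.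
Qed.

Lemma phi2_event A E X v j : inv A E no_pend X -> v < n -> j < L ->
  alast A v j != yc A j v -> 0 < ab A v ->
  phi2 (eventA A v j) + (alpha + 1000) * 2 ^ j.+1 <= phi2 A.
Proof.
move=> I vn jL ne v0; rewrite /phi2 /=.
have c : cells_left (eventA A v j) v j < cells_left A v j.
  rewrite /cells_left /= /upd2 !eqxx /=; case: ifP => [_|/negbT l0].
    rewrite ltnS; apply/cell_le/Z_le0; have := inv_bn I vn; lia.
  rewrite -lt0n in l0; have [_ h] := i_last I vn jL l0.
  by rewrite ltn_neqAle h eq_sym ne.
have h : \sum_(v' < n) \sum_(i < L) 2 ^ i.+1 * cells_left (eventA A v j) v' i + 2 ^ j.+1
    <= \sum_(v' < n) \sum_(i < L) 2 ^ i.+1 * cells_left A v' i.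
  apply: (@sum_decr _ (fun v' => \sum_(i < L) 2 ^ i.+1 * cells_left A v' i)
     (fun v' => \sum_(i < L) 2 ^ i.+1 * cells_left (eventA A v j) v' i) v) => //.
    apply: (@sum_decr _ (fun i => 2 ^ i.+1 * cells_left A v i)
       (fun i => 2 ^ i.+1 * cells_left (eventA A v j) v i) j) => //.
      by rewrite -mulnSr leq_mul2l c orbT.
    by move=> i _ ij; rewrite /cells_left /= /upd2 (negbTE ij) andbF.
  move=> v' _ vv; apply: eq_bigr => i _.
  by rewrite /cells_left /= /upd2 (negbTE vv).
rewrite -addnA leq_add2l -mulnDr; exact: leq_mul (leqnn _) h.
Qed.

(** * Amortised cost of relaxations, scans, processing and insertions *)

Lemma wp_relax_inv st A E pend X ru rw : let u := regs st ru in let x := regs st rw in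
  rep st A -> inv A E pend X -> ru < 30 -> rw < 30 ->
  (u, x) \in E -> 0 < ab A u -> ab A x = 0 \/ (ab A u).+1 < ab A x ->
  wp w (relax ru rw) st (fun st' t => exists A', [/\ rep st' A',
    inv A' E pend X, keep 30 st st', relaxed n num den A A' u x
    & t + phi A' <= phi A]).
Proof.
move=> u x R I u30 x30 uxE u0 ux; have [un xn] := i_E I uxE.
have une : u != x by apply/eqP => e; move: ux; rewrite -e; lia.
(* If [x] is unreached, at most n - 1 vertices are reached, and that number bounds every estimate;
   otherwise the larger estimate of [x] does. *)
have bu : ab A u < n.
  case: ux => [x0|]; last by have := inv_bn I xn; lia.
  apply: leq_ltn_trans (i_b I un) _.
  have xi : x \in iota 0 n by rewrite mem_iota.
  rewrite (permP (perm_to_rem xi)) /= x0 /= add0n.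
  apply: leq_ltn_trans (count_size _ _) _; rewrite size_rem // size_iota; lia.
have xin v i : i <= L -> v \in awat A x i -> alast A v i = zc A i x -> x \in alst A v i.
  by move=> iL vw; have [_ _] := i_watm I xn iL vw.
apply: wp_mono (wp_relax R (wf_inv I) u30 x30 un xn une bu xin) => st' t.
move=> [A' [R' F' K' rl ph]]; exists A'; split => //.
  exact: inv_relaxed I rl uxE u0 ux.
have rk : (ab A u).+1 < rank (ab A x).
  by rewrite /rank; case: eqP => [_|x0]; [rewrite ltnS | case: ux => // /x0].
by have := phi2_relaxed rl xn rk; rewrite /phi; lia.
Qed.

Lemma phi_add A v j x : v < n -> j <= L -> x < n ->
  phi (addA A v j x) = phi A + (alpha + 400).
Proof.
move=> vn jL xn; rewrite /phi /phi1 /=.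
have h := @watch_total_upd A (addA A v j x) x j (rcons (awat A x j) v) xn jL
   (fun _ _ _ _ => erefl _).
have -> : watch_total (addA A v j x) = (watch_total A).+1.
  by move: h; rewrite size_rcons; lia.
have -> : phi2 (addA A v j x) = phi2 A by [].
by rewrite mulnS; lia.
Qed.

Lemma rep_event st A v j : rep st A -> v < n -> j <= L ->
  rep (set_cell (set_cell st 6 (v * M + j) (yc A j v)) 8 (v * M + j) 0) (eventA A v j).
Proof.
move=> R vn jL; have [nM LM M1] := M_gt; fields R.
- move=> v' j' vn' jL'; rewrite upd2E idx2_eq; [|lia|lia].
  by case: ifP => // _; rewrite (p_last R).
- move=> v' j' vn' jL'; rewrite upd2E idx2_eq; [|lia|lia].
  by case: ifP => // _; rewrite (p_len R).
- by move=> v' j' i vn' jL'; rewrite upd2E; case: ifP => // _; apply: p_lst R _ _ _ vn' jL'.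
- by move=> v' j' i vn' jL'; rewrite upd2E; case: ifP => // _; apply: p_pos R _ _ _ vn' jL'.
Qed.

Lemma ev_farther st A ru rx : rep st A -> wf A -> regs st ru < n -> regs st rx < n ->
  eval w st (Bin Lt (eb (Reg ru)) (dec (eb (Reg rx)))) =
  (ab A (regs st rx) == 0) || ((ab A (regs st ru)).+1 < ab A (regs st rx)).
Proof.
move=> R F un xn; have [nM LM M1] := M_gt; have [w1 w2 w3] := W_facts.
have bu := w_b F un; have bx := w_b F xn.
have eu : eval w st (eb (Reg ru)) = ab A (regs st ru) by rewrite /= (p_b R).
have ex : eval w st (eb (Reg rx)) = ab A (regs st rx) by rewrite /= (p_b R).
rewrite ev_lt eu; congr nat_of_bool.
have [x0|x0] := eqVneq (ab A (regs st rx)) 0; first by rewrite ev_dec0 ?ex //=; lia.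
by rewrite ev_dec ex /=; lia.
Qed.

(** In the loop invariant the exempt edges are those to [drop i l], the part of the upper list not
    yet scanned. *)
Lemma wp_event st A E v j : rep st A -> inv A E no_pend [:: v] ->
  v < n -> 0 < ab A v -> j < L -> alast A v j != yc A j v ->
  alast A v j.+1 = yc A j.+1 v -> size (alst A v j.+1) < 2 ^ j.+1 ->
  regs st 14 = v -> regs st 15 = j -> regs st 16 = yc A j v ->
  wp w event st (fun st' t => exists A', [/\ rep st' A',
    inv A' E no_pend [:: v], keep 17 st st',
    [/\ ab A' v = ab A v, alast A' v j = yc A j v
      & forall i, i != j -> alast A' v i = alast A v i]
    & t + phi A' <= phi A]).
Proof.
move=> R0 I0 vn v0 jL ne up sz r14 r15 r16.
have [nM LM M1] := M_gt; have [w1 w2 w3] := W_facts; have jL1 := ltnW jL.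
have I1 := inv_event I0 (mem_head v [::]) vn v0 jL ne up.
set pd := (fun _ _ _ : nat => _) in I1.
have R1 := rep_event R0 vn jL1; set A1 := eventA A v j in I1 R1.
have ph1 : phi A1 + (alpha + 1000) * 2 ^ j.+1 <= phi A.
  have := phi2_event I0 vn jL ne v0; rewrite /phi -/A1.
  have -> : phi1 A1 = phi1 A by []. lia.
apply: wp_seq; apply: (@wp_store _ _ _ _ (v * M + j) (yc A j v)).
- by rewrite ev_idx2 /= ?(p_M R0) ?r14 ?r15 //; lia.
- by [].
apply: wp_seq; apply: (@wp_store _ _ _ _ (v * M + j) 0).
- by rewrite ev_idx2 /= ?(p_M R0) ?r14 ?r15 //; lia.
- by apply: ev_const; lia.
set st1 := set_cell _ _ _ _ in R1 *.
apply: wp_seq; apply: (@wp_assign _ _ _ j.+1); first by rewrite ev_inc /= r15 //; lia.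
apply: wp_seq; apply: (@wp_assign _ _ _ 0); first by apply: ev_const; lia.
set st2 := set_reg _ _ _.
have R2 : rep st2 A1 by do 2![apply: rep_set_reg => //].
set l := alst A v j.+1 in sz pd I1.
have uniq_l : uniq l by apply: i_lst I0 _ _ vn jL.
pose I k st3 T := exists A3 i, [/\ [/\ rep st3 A3, keep 17 st st3,
     regs st3 17 = j.+1 & regs st3 20 = i],
  [/\ i <= size l, k = size l - i & T + phi A3 <= phi A1 + i * (alpha + 800)],
  inv A3 E (fun v' j' x => [&& v' == v, j' == j & x \in drop i l]) [:: v] &
  [/\ alst A3 v j.+1 = l, ab A3 v = ab A v & alast A3 = alast A1]].
have i0 : I (size l) st2 0.
  exists A1, 0; split => //.
  - split => // r r17 /=; rewrite !ltn_eqF //; lia.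
  - by rewrite subn0 addn0.
  - by apply: inv_ext I1 _ _ => // v' j' x; rewrite drop0.
  - by split => //=; rewrite upd2E (gtn_eqF (ltnSn _)) andbF.
have ups A3 : ab A3 v = ab A v -> yc A3 ^~ v =1 yc A ^~ v.
  by move=> e i; rewrite /ycell e.
apply: (@wp_while _ _ _ I (size l) _ _ _ _ i0).
- move=> k st3 T [A3 [i [[R3 K3 r17 r20] [il kE ph3] I3 [l3 b3 la3]]]].
  have r14' : regs st3 14 = v by rewrite K3.
  have r15' : regs st3 15 = j by rewrite K3.
  have r16' : regs st3 16 = yc A j v by rewrite K3.
  have e14 : eval w st3 (Reg 14) = v by [].
  have e17 : eval w st3 (Reg 17) = j.+1 by [].
  have e20 : eval w st3 (Reg 20) = i by [].
  rewrite ev_lt (ev_len R3) ?e14 ?e17 // eqb0 negbK l3 e20 => il'.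
  set x := nth 0 l i; have xl : x \in l by exact: mem_nth.
  have vxE : (v, x) \in E by move: xl; rewrite (i_mem I0) // => /and3P[].
  have [_ xn] := i_E I0 vxE.
  have dE : drop i l = x :: drop i.+1 l by exact: drop_nth.
  have xd : x \notin drop i.+1 l.
    by have := drop_uniq i uniq_l; rewrite dE => /andP[].
  apply: wp_seq; apply: (@wp_assign _ _ _ x).
    by rewrite (ev_lst R3 (wf_inv I3)) ?e14 ?e17 ?e20 ?l3.
  set st4 := set_reg _ _ _.
  have R4 : rep st4 A3 by exact: rep_set_reg.
  have a3 : alast A3 v j.+1 = yc A3 j.+1 v.
    by rewrite la3 ups //= upd2E (gtn_eqF (ltnSn _)) andbF.
  apply: wp_seq.
  have : wp w (If (Bin Lt (eb (Reg 14)) (dec (eb (Reg 21)))) (relax 14 21) Skip) st4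
     (fun st5 t5 => exists A5, [/\ rep st5 A5, keep 30 st4 st5,
        inv A5 E (fun v' j' x => [&& v' == v, j' == j & x \in drop i l]) [:: v],
        [/\ alst A5 v j.+1 = l, ab A5 v = ab A v, alast A5 = alast A1
          & 0 < ab A5 x <= (ab A v).+1] & t5 + phi A5 <= phi A3 + 50]).
    apply: (@wp_if _ _ _ _ _ ((ab A3 x == 0) || ((ab A3 v).+1 < ab A3 x))).
      by rewrite (ev_farther R4 (wf_inv I3)) /= ?r14' // eqb0 negbK.
    case: ifP => [far|/negbT near]; last first.
      apply: wp_skip; exists A3; split => //; last by ecosts; lia.
      by split => //; move: near; rewrite b3; lia.
    have far' : ab A3 x = 0 \/ (ab A3 v).+1 < ab A3 x.
      by case/orP: far => [/eqP|]; [left | right].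
    have := @wp_relax_inv st4 A3 E _ [:: v] 14 21 R4 I3 isT isT.
    rewrite /= r14' b3 => /(_ vxE v0); rewrite -b3 => /(_ far').
    apply: wp_mono => st5 t5 [A5 [R5 I5 K5 rl ph5]].
    have b5 : ab A5 x = (ab A3 v).+1 by rewrite (r_b rl) /upd eqxx.
    exists A5; split => //; last by ecosts; lia.
    split; rewrite ?(r_last rl) //; last by rewrite b5 b3 leqnn.
      (* The list being read is stable: relaxing [x] from [v] makes d(x) - 1 equal to d(v), whose
         level-(j+1) cell is the one recorded for this list, so [x] is not deleted from it. *)
      rewrite (r_lst rl) // l3; case: ifP => // /and3P[ch _ /eqP e].
      case/eqP: ch; rewrite -e a3 /zcell b5 //.
    rewrite (r_b rl) /upd; case: eqP => // vx; move: far'; rewrite -vx b3; lia.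
  apply: wp_mono => st5 t5 [A5 [R5 K5 I5 [l5 b5 la5 bx5] ph5]].
  have r14'' : regs st5 14 = v by rewrite K5.
  have r15'' : regs st5 15 = j by rewrite K5.
  have r16'' : regs st5 16 = yc A j v by rewrite K5.
  have r21 : regs st5 21 = x by rewrite K5.
  have laj : alast A5 v j = yc A j v by rewrite la5 /= upd2E !eqxx.
  have bv := inv_bn I0 vn.
  have zy : zc A5 j x <= yc A j v by apply/cell_le/Z_le; rewrite /ble; lia.
  have pE v' j' y : unpend (fun v' j' x => [&& v' == v, j' == j & x \in drop i l]) v j x v' j' y =
     [&& v' == v, j' == j & y \in drop i.+1 l].
    rewrite /unpend dE inE; case: (v' =P v); case: (j' =P j); rewrite ?andbF //= => _ _.
    by case: (y =P x) => [->|_] /=; rewrite ?andbT ?(negbTE xd).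
  apply: wp_seq.
  have : wp w (If (Bin Eq (ecell (Reg 15) (ez (eb (Reg 21)))) (Reg 16))
                  (add 14 15 21) Skip) st5
     (fun st6 t6 => exists A6, [/\ rep st6 A6, keep 40 st5 st6,
        inv A6 E (fun v' j' x => [&& v' == v, j' == j & x \in drop i.+1 l]) [:: v],
        [/\ alst A6 v j.+1 = l, ab A6 v = ab A v & alast A6 = alast A1]
        & t6 + phi A6 <= phi A5 + (alpha + 600)]).
    have ex : eval w st5 (ez (eb (Reg 21))) = Z (ab A5 x).
      by rewrite /= r21 (p_b R5) // (p_z R5) //; have := inv_bn I5 xn; lia.
    apply: (@wp_if _ _ _ _ _ (zc A5 j x == yc A j v)).
      have e15 : eval w st5 (Reg 15) = j by [].
      have e16 : eval w st5 (Reg 16) = yc A j v by [].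
      rewrite ev_eq eqb0 negbK e16 (ev_cell R5) ?ex ?e15 //.
      by apply: Z_le0; apply: leqW; apply: inv_bn I5 xn.
    case: ifP => [/eqP zE|zE]; last first.
      apply: wp_skip; exists A5; split => //; last by ecosts; lia.
      apply: inv_ext (inv_skip I5 vn jL1 _ _) _ pE => //; first by rewrite laj.
      by rewrite laj eq_sym zE.
    have pdx : [&& v == v, j == j & x \in drop i l] by rewrite !eqxx dE mem_head.
    have xnl : x \notin alst A5 v j by rewrite (i_mem I5) // pdx andbF.
    have vnw : v \notin awat A5 x j.
      by apply: contra xnl => /(i_watm I5 xn jL1)[_ _]; apply; rewrite laj.
    have := wp_add (r1 := 14) (r2 := 15) (r3 := 21) R5 (wf_inv I5) isT isT isT.
    rewrite r14'' r15'' r21 => /(_ vn jL1 xn xnl vnw).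
    apply: wp_mono => st6 t6 [R6 F6 K6 t6b]; exists (addA A5 v j x); split => //.
    - apply: inv_ext (inv_add I5 vn jL1 vxE pdx _) _ pE => //; by rewrite laj.
    - split => //=; by rewrite upd2E (gtn_eqF (ltnSn _)) andbF.
    - by rewrite phi_add //; ecosts; lia.
  apply: wp_mono => st6 t6 [A6 [R6 K6 I6 [l6 b6 la6] ph6]].
  have r20' : regs st6 20 = i by rewrite K6 // K5 //= .
  have sl := size_lst_le (wf_inv I0) vn jL; rewrite -/l in sl.
  apply: (@wp_assign _ _ _ i.+1); first by rewrite ev_inc /= r20' //; lia.
  exists (size l - i.+1); split; first by rewrite kE; lia.
  exists A6, i.+1; split => //.
  - split => //=; first exact: rep_set_reg.
      move=> r r17'; have a1 : (r == 20) = false by lia.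
      have a2 : (r == 21) = false by lia.
      by rewrite /= a1 K6 ?K5 /= ?a2 ?K3 //; lia.
    by rewrite K6 // K5.
  - by split => //; ecosts; rewrite mulSn; lia.
- move=> k st3 T [A3 [i [[R3 K3 r17 r20] [il kE ph3] I3 [l3 b3 la3]]]].
  have r14' : regs st3 14 = v by rewrite K3.
  have e14 : eval w st3 (Reg 14) = v by [].
  have e17 : eval w st3 (Reg 17) = j.+1 by [].
  have e20 : eval w st3 (Reg 20) = i by [].
  rewrite ev_lt (ev_len R3) ?e14 ?e17 // => /eqP; rewrite eqb0 l3 e20 -leqNgt => il'; have iE : i = size l by lia.
  exists A3; split => //.
  - by apply: inv_ext I3 _ _ => // v' j' x; rewrite iE drop_size !andbF.
  - by rewrite la3 b3 /= ; split => // [|i' ne']; rewrite upd2E ?eqxx // (negbTE ne') andbF.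
  - move: ph1 ph3; rewrite iE; ecosts.
    (* Fewer than 2^(j+1) rounds of at most [alpha + 800] each, against a release of [alpha + 1000]
       for each of 2^(j+1) units; the surplus covers the overhead. *)
    have := leq_mul sz (leqnn (alpha + 1000)); rewrite mulSn [2 ^ _ * _]mulnC.
    move: (2 ^ j.+1) (phi A) (phi A1) (phi A3) (size l) => a b c d e; nia.
Qed.

(** The credit of one stack entry must cover a descent through all levels. *)
Hypothesis alpha_ge : 300 * L.+1 <= alpha.

(** All levels from the current one upwards are kept up to date; this is what a scan one level below
    requires. Scans pay for themselves, so only the descent is charged. *)
Lemma wp_process st A E v : rep st A -> inv A E no_pend [:: v] ->
  v < n -> 0 < ab A v -> regs st 14 = v ->
  wp w process st (fun st' t => exists A', [/\ rep st' A',
    inv A' E no_pend [::], keep 14 st st' & t + phi A' <= phi A + 150 * L.+1]).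
Proof.
move=> R0 I0 vn v0 r14.
have [nM LM M1] := M_gt; have [w1 w2 w3] := W_facts.
apply: wp_seq; apply: (@wp_assign _ _ _ L); first exact: p_L R0.
set st1 := set_reg _ _ _.
pose I k st2 T := exists A2 j, [/\ [/\ rep st2 A2, inv A2 E no_pend [:: v]
     & keep 15 st st2],
  [/\ j <= L, k = j & regs st2 15 = j], 0 < ab A2 v,
  forall i, j <= i -> i < L -> alast A2 v i = yc A2 i v
  & T + phi A2 <= phi A + 100 * (L - j)].
have i0 : I L st1 0.
  exists A, L; split => //; last exact: leq_addr.
    by split => //; [exact: rep_set_reg | exact: keep_set_reg].
  by move=> i Li iL; lia.
have cur A2 X j : inv A2 E no_pend X -> j <= L ->
  (forall i, j <= i -> i < L -> alast A2 v i = yc A2 i v) -> alast A2 v j = yc A2 j v.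
  move=> I2 jL h; have [jL'|Lj|jE] := ltngtP j L; [exact: h | lia | rewrite jE].
  by rewrite (i_lastL I2) // /ycell cellL // Z_le0 // ltnS; apply: inv_bn I2 vn.
have test st2 A2 j : rep st2 A2 -> regs st2 14 = v -> regs st2 15 = j -> j <= L ->
  eval w st2 (Bin Mul (Bin Lt (Const 0) (Reg 15))
                (Bin Lt (elen (Reg 14) (Reg 15)) (Fetch 5 (Reg 15))))
  = (0 < j) && (size (alst A2 v j) < D j).
  move=> R2 e14 e15 jL; apply: ev_and.
    by rewrite ev_lt ev_const /= ?e15 //; lia.
  rewrite ev_lt (ev_len R2) /= ?e14 ?e15 // (p_d R2) //.
apply: (@wp_while _ _ _ I L _ _ _ _ i0).
- move=> k st2 T [A2 [j [[R2 I2 K2] [jL kE r15] v02 lastE ph2]]].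
  have e14 : regs st2 14 = v by rewrite K2.
  rewrite (test _ _ _ R2 e14 r15 jL) eqb0 negbK => /andP[j0 light].
  case: j => // j in jL kE r15 lastE ph2 j0 light *.
  apply: wp_seq; apply: (@wp_assign _ _ _ j).
    by rewrite ev_dec /= r15 //; lia.
  set st3 := set_reg _ _ _; have R3 : rep st3 A2 by exact: rep_set_reg.
  have b2 := inv_bn I2 vn.
  apply: wp_seq; apply: (@wp_assign _ _ _ (yc A2 j v)).
    have e1 : eval w st3 (eb (Reg 14)) = ab A2 v by rewrite /= e14 (p_b R2).
    have e2 : eval w st3 (ez (inc (eb (Reg 14)))) = Z (ab A2 v).+1.
      by rewrite ev_fetch ev_inc e1 ?(p_z R3) //; lia.
    have e3 : eval w st3 (Reg 15) = j by [].
    rewrite (ev_cell R3) ?e2 ?e3 //; first by lia.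
    by apply: Z_le0; lia.
  set st4 := set_reg _ _ _; have R4 : rep st4 A2 by exact: rep_set_reg.
  apply: (@wp_if _ _ _ _ _ (alast A2 v j == yc A2 j v)).
    have e1 : eval w st4 (Reg 14) = v by [].
    have e2 : eval w st4 (Reg 15) = j by [].
    have e3 : eval w st4 (Reg 16) = yc A2 j v by [].
    by rewrite ev_eq (ev_last R4) ?e1 ?e2 ?e3 ?eqb0 ?negbK //; lia.
  have K4 : keep 15 st2 st4.
    by move=> r r15'; rewrite /= !ltn_eqF //; lia.
  case: ifP => [/eqP le|/negbT ne].
    apply: wp_skip; exists j; split; first by rewrite kE.
    exists A2, j; split => //.
    - by split => // r r15'; rewrite K4 // K2.
    - by split => //; lia.
    - by move=> i; rewrite leq_eqVlt => /orP[/eqP <- //|]; apply: lastE.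
    - by ecosts; lia.
  have jL' : j < L by lia.
  have sz : size (alst A2 v j.+1) < 2 ^ j.+1.
    have [jl|jl|jE] := ltngtP j.+1 L; [by move: light; rewrite /cell_width jl | by lia |].
    by apply: leq_ltn_trans (size_lst_le (wf_inv I2) vn jL) _; rewrite jE; apply: levelsP.
  have := @wp_event st4 A2 E v j R4 I2 vn v02 jL' ne (cur _ _ _ I2 jL lastE) sz e14.
  move=> /(_ erefl erefl); apply: wp_mono => st5 t5 [A5 [R5 I5 K5 [b5 lj5 li5] ph5]].
  exists j; split; first by rewrite kE.
  exists A5, j; split => //.
  - by split => // r r15'; rewrite K5 ?K4 ?K2 //; lia.
  - by split; rewrite ?K5 //; lia.
  - by rewrite b5.
  - move=> i; rewrite /ycell b5 leq_eqVlt => /orP[/eqP <- //|ji] iL.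
    by rewrite li5 ?gtn_eqF //; apply: lastE.
  - by ecosts; lia.
- move=> k st2 T [A2 [j [[R2 I2 K2] [jL kE r15] v02 lastE ph2]]].
  have e14 : regs st2 14 = v by rewrite K2.
  rewrite (test _ _ _ R2 e14 r15 jL) => /eqP; rewrite eqb0 => stop.
  exists A2; split => //; last first.
  - by ecosts; lia.
  - by move=> r r14'; apply: K2; lia.
  have sv : settled A2 v.
    move=> i iL h; have [ji|ij] := leqP j i; first exact: lastE.
    (* Below j the premise of [settled] fails: the loop stopped above level 0 because the list at
       level j is heavy. *)
    move: stop; rewrite (leq_ltn_trans _ ij) //= -leqNgt leqNgt h //.
    by rewrite ij.
  split; try solve [destruct I2; assumption].
  move=> v' vn' v0' vs' _; have [->|ne] := eqVneq v' v; first exact: sv.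
  by apply: (i_set I2) => //; rewrite inE.
Qed.

(** The potential is also the loop measure: each pop releases [alpha], more than the net cost of the
    round, so it strictly decreases. *)
Lemma wp_drain st A E : rep st A -> inv A E no_pend [::] ->
  wp w drain st (fun st' t => exists A', [/\ rep st' A',
    inv A' E no_pend [::], astk A' = [::], keep 14 st st' & t + phi A' <= phi A + 10]).
Proof.
move=> R0 I0.
pose I k st2 T := exists A2, [/\ rep st2 A2, inv A2 E no_pend [::],
  keep 14 st st2, k = phi A2 & T + phi A2 <= phi A].
apply: (@wp_while _ _ _ I (phi A)); last by exists A.
- move=> k st2 T [A2 [R2 I2 K2 kE ph2]]; rewrite /= (p_sp R2) size_eq0 => ne.
  case/lastP sE: (astk A2) ne => [|l v] // _.
  have vs : v \in astk A2 by rewrite sE mem_rcons mem_head.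
  have [vn v0] := i_stkm I2 vs.
  apply/wp_seq; apply: wp_mono (wp_pop_stack R2 (wf_inv I2) sE).
  move=> st3 t3 [R3 F3 K3 r14 t3b]; set A3 := set_stk A2 l in R3 F3.
  have ph3 : phi A3 + alpha = phi A2.
    rewrite /phi /phi1 sE size_rcons /= mulnS.
    have -> : watch_total A3 = watch_total A2 by [].
    have -> : phi2 A3 = phi2 A2 by []. lia.
  have I3 : inv A3 E no_pend [:: v].
    have lsub x : x \in l -> x \in astk A2 by rewrite sE mem_rcons inE orbC => ->.
    split; try solve [destruct I2; assumption].
    - by have := i_stk I2; rewrite sE rcons_uniq => /andP[].
    - by move=> x /lsub; apply: i_stkm I2 _.
    - move=> x xn x0 xl; rewrite inE => xv; apply: (i_set I2) => //.
      by rewrite sE mem_rcons inE negb_or xv.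
  apply: wp_mono (wp_process R3 I3 vn v0 r14) => st4 t4 [A4 [R4 I4 K4 ph4]].
  exists (phi A4); split; first by rewrite kE; lia.
  exists A4; split => //; first by move=> r r14'; rewrite K4 ?K3 ?K2.
  by ecosts; lia.
- move=> k st2 T [A2 [R2 I2 K2 kE ph2]]; rewrite /= (p_sp R2) => /size0nil s0.
  by exists A2; split => //; ecosts; lia.
Qed.

(** Entering the edge creates at most one watcher per level, which is the [alpha] in the charge.
    Longer lists only weaken what [settled] demands, so the tail need not be pushed. *)
Lemma wp_insert_edge st A E u x : rep st A -> inv A E no_pend [::] ->
  astk A = [::] -> u < n -> x < n -> (u, x) \notin E ->
  regs st 0 = u -> regs st 1 = x ->
  wp w insert_edge st (fun st' t => exists A', [/\ rep st' A',
    inv A' ((u, x) :: E) no_pend [::], astk A' = [::], keep 14 st st'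
    & t + phi A' <= phi A + L.+1 * (alpha + 1000)]).
Proof.
move=> R0 I0 s0 un xn ux r0 r1.
have [nM LM M1] := M_gt; have [w1 w2 w3] := W_facts.
have I1 := inv_new_edge I0 ux un xn.
set E1 := (u, x) :: E in I1 *; have uxE : (u, x) \in E1 by exact: mem_head.
set pd := (fun _ _ _ : nat => _) in I1.
apply: wp_seq.
have : wp w (If (Bin Mul (Bin Lt (Const 0) (eb (Reg 0)))
             (Bin Lt (eb (Reg 0)) (dec (eb (Reg 1))))) (relax 0 1) Skip) st
  (fun st2 t2 => exists A2, [/\ rep st2 A2, inv A2 E1 pd [::], keep 30 st st2,
     0 < ab A2 u -> 0 < ab A2 x <= (ab A2 u).+1 & t2 + phi A2 <= phi A + 50]).
  apply: (@wp_if _ _ _ _ _ ((0 < ab A u) && ((ab A x == 0) || ((ab A u).+1 < ab A x)))).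
    rewrite (ev_and (x := 0 < ab A u) (y := (ab A x == 0) || ((ab A u).+1 < ab A x))).
    - by rewrite eqb0 negbK.
    - by rewrite ev_lt ev_const /= ?r0 ?(p_b R0) //; lia.
    - by rewrite (ev_farther R0 (wf_inv I0)) ?r0 ?r1.
  case: ifP => [/andP[u0 far]|near]; last first.
    apply: wp_skip; exists A; split => //; last by ecosts; lia.
    by move=> u0; move: near; rewrite u0 /=; lia.
  have far' : ab A x = 0 \/ (ab A u).+1 < ab A x.
    by case/orP: far => [/eqP|]; [left | right].
  have := @wp_relax_inv st A E1 pd [::] 0 1 R0 I1 isT isT.
  rewrite r0 r1 => /(_ uxE u0 far').
  apply: wp_mono => st2 t2 [A2 [R2 I2 K2 rl ph2]].
  exists A2; split => //; last by ecosts; lia.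
  rewrite (r_b rl) /upd eqxx; case: eqP => [uxe|_]; last by rewrite leqnn.
  by move: far'; rewrite uxe; lia.
apply: wp_mono => st2 t2 [A2 [R2 I2 K2 near ph2]].
apply: wp_seq; apply: (@wp_assign _ _ _ 0); first by apply: ev_const; lia.
set st3 := set_reg _ _ _; have R3 : rep st3 A2 by exact: rep_set_reg.
apply: wp_seq.
pose I k st4 T := exists A4 j, [/\ [/\ rep st4 A4, keep 17 st st4 & regs st4 17 = j],
  [/\ j <= L.+1, k = L.+1 - j, ab A4 = ab A2 & alast A4 = alast A2],
  inv A4 E1 (fun v i y => [&& v == u, y == x & j <= i]) [::]
  & T + phi A4 <= phi A2 + j * (alpha + 700)].
have i0 : I L.+1 st3 0.
  exists A2, 0; split => //; last by rewrite addn0.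
    split => // r r17; rewrite /= ltn_eqF // K2 //; lia.
  by apply: inv_ext I2 _ _ => // v j y; rewrite andbT.
have LW : L.+1 < 2 ^ w by lia.
apply: (@wp_while _ _ _ I L.+1 _ _ _ _ i0).
- move=> k st4 T [A4 [j [[R4 K4 r17] [jL kE b4 la4] I4 ph4]]].
  have e0 : eval w st4 (Reg 0) = u by rewrite /= K4.
  have e1 : eval w st4 (Reg 1) = x by rewrite /= K4.
  have e17 : eval w st4 (Reg 17) = j by [].
  have eL : eval w st4 (Reg 8) = L by exact: p_L R4.
  rewrite ev_lt eqb0 negbK ev_inc ?eL ?e17 // ltnS => jL'.
  have bx := inv_bn I4 xn.
  have ezx : eval w st4 (ez (eb (Reg 1))) = Z (ab A4 x).
    by rewrite /= K4 // r1 (p_b R4) // (p_z R4) //; lia.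
  have pE v' j' y : unpend (fun v i y => [&& v == u, y == x & j <= i]) u j x v' j' y =
     [&& v' == u, y == x & j < j'].
    rewrite /unpend; case: (v' =P u); case: (y =P x); rewrite ?andbF ?andbT //= => _ _.
    by rewrite ltn_neqAle eq_sym andbC.
  (* Because the relaxation came first, d(x) - 1 <= d(u), and the cell of d(u) never exceeds the
     last scanned one. *)
  have zle : 0 < alast A4 u j -> zc A4 j x <= alast A4 u j.
    move=> l0; have [jl|jl|jE] := ltngtP j L; [|by lia|].
      have [u0 yl] := i_last I4 un jl l0; apply: leq_trans yl.
      have bu := inv_bn I4 un; have := near; rewrite -b4 => /(_ u0) h.
      by apply/cell_le/Z_le; rewrite /ble; lia.
    by rewrite jE (i_lastL I4) // /zcell cellL // Z_le0 //; lia.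
  apply: wp_seq.
  have : wp w (If (Bin Eq (elast (Reg 0) (Reg 17))
                      (ecell (Reg 17) (ez (eb (Reg 1))))) (add 0 17 1) Skip) st4
     (fun st5 t5 => exists A5, [/\ rep st5 A5, keep 40 st4 st5,
       ab A5 = ab A2 /\ alast A5 = alast A2,
       inv A5 E1 (fun v i y => [&& v == u, y == x & j < i]) [::]
       & t5 + phi A5 <= phi A4 + (alpha + 600)]).
    apply: (@wp_if _ _ _ _ _ (alast A4 u j == zc A4 j x)).
      rewrite ev_eq eqb0 negbK (ev_last R4) ?(ev_cell R4) ?ezx ?e0 ?e17 //.
      by apply: Z_le0; lia.
    case: ifP => [/eqP lz|lz]; last first.
      apply: wp_skip; exists A4; split => //; last by ecosts; lia.
      by apply: inv_ext (inv_skip I4 un jL' zle _) _ pE => //; rewrite lz.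
    have pdx : [&& u == u, x == x & j <= j] by rewrite !eqxx leqnn.
    have xnl : x \notin alst A4 u j by rewrite (i_mem I4) // pdx andbF.
    have unw : u \notin awat A4 x j.
      by apply: contra xnl => /(i_watm I4 xn jL')[_ _]; apply.
    have := wp_add (r1 := 0) (r2 := 17) (r3 := 1) R4 (wf_inv I4) isT isT isT.
    rewrite -![regs st4 _]/(eval w st4 (Reg _)) e0 e1 e17 => /(_ un jL' xn xnl unw).
    apply: wp_mono => st5 t5 [R5 F5 K5 t5b]; exists (addA A4 u j x); split => //.
    - by apply: inv_ext (inv_add I4 un jL' uxE pdx lz) _ pE.
    - by rewrite phi_add //; ecosts; lia.
  apply: wp_mono => st5 t5 [A5 [R5 K5 [b5 la5] I5 ph5]].
  have r17' : regs st5 17 = j by rewrite K5.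
  apply: (@wp_assign _ _ _ j.+1); first by rewrite ev_inc /= r17' //; lia.
  exists (L.+1 - j.+1); split; first by rewrite kE; lia.
  exists A5, j.+1; split => //.
  - split => //; first exact: rep_set_reg.
    by move=> r r17''; rewrite /= ltn_eqF // K5 ?K4 //; lia.
  - by ecosts; rewrite mulSn; lia.
- move=> k st4 T [A4 [j [[R4 K4 r17] [jL kE b4 la4] I4 ph4]]].
  have e17 : eval w st4 (Reg 17) = j by [].
  have eL : eval w st4 (Reg 8) = L by exact: p_L R4.
  rewrite ev_lt ev_inc ?eL ?e17 // => /eqP; rewrite eqb0 -leqNgt => jL'.
  have jE : j = L.+1 by lia.
  have I4' : inv A4 E1 no_pend [::].
    split; try solve [destruct I4; assumption].
    + move=> v y i vE iL _; apply: (i_edge I4) => //.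
      by rewrite jE ltnNge iL !andbF.
    + by move=> v y i vn iL; rewrite (i_mem I4) // jE ltnNge iL !andbF.
  apply: wp_mono (wp_drain R4 I4') => st5 t5 [A5 [R5 I5 s5 K5 ph5]].
  exists A5; split => //; first by move=> r r14; rewrite K5 ?K4 //; lia.
  by ecosts; rewrite jE in ph4; lia.
Qed.

(** * Initialisation: levels, tables and initial edges *)

Fixpoint no_store b c := match c with
  | Store b' _ _ => b' != b
  | Seq c1 c2 | If _ c1 c2 => no_store b c1 && no_store b c2
  | While _ c1 => no_store b c1
  | _ => true
  end.

Lemma exec_no_store b c st st' t : exec w c st st' t -> no_store b c ->
  banks st' b = banks st b.
Proof.
elim=> {c st st' t} //=.
- by move=> b' a e st /negbTE bb; rewrite eq_sym bb.
- by move=> c1 c2 st st1 st2 t1 t2 _ h1 _ h2 /andP[/h1 <- /h2].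
- by move=> e c1 c2 st st' t _ _ h /andP[/h].
- by move=> e c1 c2 st st' t _ _ h /andP[_ /h].
- by move=> e c st st1 st2 t1 t2 _ _ h1 _ h2 nc; rewrite h2 // h1.
Qed.

(** Initial edges are read from bank 0 between insertions; a syntactic check shows that nothing
    overwrites them. *)
Lemma wp_no_store b c st (Q : state -> nat -> Prop) : no_store b c ->
  wp w c st Q -> wp w c st (fun st' t => Q st' t /\ banks st' b = banks st b).
Proof.
by move=> nc [st' [t [e q]]]; exists st', t; split => //; split => //; apply: exec_no_store e nc.
Qed.

Lemma levels_eq k : (forall i, i < k -> 2 ^ i <= n) -> n < 2 ^ k -> k = L.
Proof.
move=> lo hi; apply/eqP; rewrite eqn_leq; apply/andP; split; last exact: up_log_min.
case: k lo {hi} => // k lo; rewrite ltnNge; apply/negP => Lk.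
by have := lo _ Lk; rewrite leqNgt levelsP.
Qed.

Lemma wp_init_levels st : regs st 5 = n ->
  wp w init_levels st (fun st' t => [/\ regs st' 7 = M /\ regs st' 8 = L,
    forall r, r != 7 -> r != 8 -> regs st' r = regs st r,
    forall b, b != 5 -> banks st' b = banks st b,
    forall j, j < L -> banks st' 5 j = 2 ^ j & t <= 50 * L.+1]).
Proof.
move=> r5; have [nM LM M1] := M_gt; have [w1 w2 w3] := W_facts.
apply: wp_seq; apply: (@wp_assign _ _ _ 1); first exact: ev_const.
apply: wp_seq; apply: (@wp_assign _ _ _ 0); first by apply: ev_const; lia.
set st1 := set_reg _ _ _.
pose I k st2 T := exists i, [/\ i <= L, k = L - i, T <= 30 * i,
  [/\ regs st2 7 = 2 ^ i, regs st2 8 = i,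
      forall r, r != 7 -> r != 8 -> regs st2 r = regs st r
    & forall b, b != 5 -> banks st2 b = banks st b] &
  forall j, j < i -> 2 ^ j <= n /\ banks st2 5 j = 2 ^ j].
have i0 : I L st1 0.
  exists 0; split => //; first by rewrite subn0.
  by split => // r h1 h2; rewrite /= (negbTE h1) (negbTE h2).
apply: (@wp_while _ _ _ I L _ _ _ _ i0).
- move=> k st2 T [i [iL kE Tb [r7 r8 rr bb] low]].
  have e7 : eval w st2 (Reg 7) = 2 ^ i by [].
  have e5 : eval w st2 (Reg 5) = n by rewrite /= rr.
  rewrite ev_lt ev_inc ?e5; last by lia.
  rewrite e7 eqb0 negbK ltnS => le.
  have iL' : i < L.
    rewrite ltn_neqAle iL andbT; apply: contraL le => /eqP->.
    by rewrite -ltnNge; apply: levelsP.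
  have pw : 2 ^ i.+1 <= M by rewrite leq_exp2l.
  apply: wp_seq; apply: (@wp_store _ _ _ _ i (2 ^ i)) => //.
  apply: wp_seq; apply: (@wp_assign _ _ _ (2 ^ i.+1)).
    rewrite expnSr in pw *; rewrite [LHS]/= r7 (@modn_small 2); last by lia.
    by rewrite modn_small //; lia.
  apply: (@wp_assign _ _ _ i.+1); first by rewrite ev_inc /= r8 //; lia.
  exists (L - i.+1); split; first by lia.
  exists i.+1; split => //; first by ecosts; lia.
    split => //=; first by move=> r h1 h2; rewrite (negbTE h1) (negbTE h2) rr.
    by move=> b b5; rewrite (negbTE b5) bb.
  move=> j; rewrite ltnS /= leq_eqVlt; case: eqP => [->|_] //=; exact: low.
move=> k st2 T [i [iL kE Tb [r7 r8 rr bb] low]].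
have e7 : eval w st2 (Reg 7) = 2 ^ i by [].
have e5 : eval w st2 (Reg 5) = n by rewrite /= rr.
rewrite ev_lt ev_inc ?e5; last by lia.
rewrite e7 => /eqP; rewrite eqb0 -leqNgt => lt.
have iE : i = L by apply: levels_eq => // j /low[].
split; rewrite ?r7 ?r8 ?iE //; last by ecosts; lia.
by move=> j; rewrite -iE => /low[].
Qed.

Lemma wp_init_table st : regs st 5 = n -> regs st 2 = num -> regs st 3 = den ->
  regs st 7 = M -> regs st 8 = L -> 0 < num -> 0 < den ->
  4 * n * den < 2 ^ w -> num * n.+1 < 2 ^ w -> pot n num den n.+2 < 2 ^ w ->
  n.+2 < 2 ^ w -> (forall a, banks st 6 a = 0) ->
  wp w init_table st (fun st' t => [/\
    forall r, r != 9 -> r != 10 -> regs st' r = regs st r,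
    forall b, b != 4 -> b != 6 -> banks st' b = banks st b,
    forall i, 0 < i <= n.+1 -> banks st' 4 i = Z i,
    forall v j, v < n -> j <= L -> banks st' 6 (v * M + j) = (j == L)
    & t <= 100 * n.+2]).
Proof.
move=> r5 r2 r3 r7 r8 num0 den0 b1 b2 b3 b4 z6.
have [nM LM M1] := M_gt; have [w1 w2 w3] := W_facts.
apply: wp_seq; apply: (@wp_assign _ _ _ 0); first by apply: ev_const; lia.
apply: wp_seq; apply: (@wp_assign _ _ _ 1); first exact: ev_const.
set st1 := set_reg _ _ _.
pose I k st2 T := exists i, [/\ 0 < i <= n.+2, k = n.+2 - i, T <= 60 * i,
  [/\ regs st2 9 = pot n num den i, regs st2 10 = i,
      forall r, r != 9 -> r != 10 -> regs st2 r = regs st r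
    & forall b, b != 4 -> b != 6 -> banks st2 b = banks st b] &
  (forall j, 0 < j < i -> banks st2 4 j = pot n num den j) /\
  (forall v j, j <= L -> banks st2 6 (v * M + j) = (j == L) && (v.+1 < i))].
have i0 : I n.+1 st1 0.
  exists 1; split => //.
    split => //=; first by rewrite /pot big_geq.
    by move=> r h1 h2; rewrite (negbTE h1) (negbTE h2).
  by split => [j|v j jL]; [lia | rewrite /= z6 andbF].
apply: (@wp_while _ _ _ I n.+1 _ _ _ _ i0).
- move=> k st2 T [i [iL kE Tb [r9 r10 rr bb] [tab lst]]].
  have e10 : eval w st2 (Reg 10) = i by [].
  have e5 : eval w st2 (Reg 5) = n by rewrite /= rr.
  have e55 : eval w st2 (inc (inc (Reg 5))) = n.+2.
    by rewrite ev_inc ev_inc ?e5 //; lia.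
  rewrite ev_lt e55 e10 eqb0 negbK => lt.
  apply: wp_seq; apply: (@wp_store _ _ _ _ i (pot n num den i)) => //.
  apply: wp_seq; apply: (@wp_store _ _ _ _ (i.-1 * M + L) 1).
  - set st3 := set_cell _ _ _ _.
    have e : eval w st3 (dec (Reg 10)) = i.-1.
      by rewrite ev_dec /= r10 //; lia.
    rewrite ev_idx2 ?e /= ?rr //; lia.
  - exact: ev_const.
  apply: wp_seq; apply: (@wp_assign _ _ _ (pot n num den i.+1)).
    set st3 := set_cell _ _ _ _.
    have eq3 : eval w st3 (Bin Mul (Bin Mul (Const 4) (Reg 5)) (Reg 3)) = 4 * n * den.
      have m4 : 4 * n < 2 ^ w by apply: leq_ltn_trans b1; rewrite leq_pmulr.
      have W4 : 4 < 2 ^ w by apply: leq_ltn_trans m4; rewrite leq_pmulr //; lia.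
      rewrite [LHS]/= !rr // r5 r3 (modn_small W4).
      by rewrite (modn_small m4) modn_small.
    have eq4 : eval w st3 (Bin Mul (Reg 2) (Reg 10)) = num * i.
      rewrite [LHS]/= rr // r2 r10 modn_small //; apply: leq_ltn_trans b2.
      by rewrite leq_mul2l; apply/orP; right; lia.
    have piS : pot n num den i.+1 < 2 ^ w by apply: leq_ltn_trans b3; apply: pot_le; lia.
    have i1 : 0 < i by lia.
    have pE := potS n num den i1.
    have eq5 : eval w st3 (Bin Div (Bin Mul (Bin Mul (Const 4) (Reg 5)) (Reg 3))
                                (Bin Mul (Reg 2) (Reg 10))) = (4 * n * den) %/ (num * i).
      rewrite -eq3 -eq4 [LHS]/= modn_small // [X in X < _](_ : _ = (4 * n * den) %/ (num * i)).
        by apply: leq_ltn_trans b1; apply: leq_div.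
      by rewrite -eq3 -eq4.
    set d := (4 * n * den) %/ (num * i) in eq5 pE.
    have eq6 : eval w st3 (inc (Bin Div (Bin Mul (Bin Mul (Const 4) (Reg 5)) (Reg 3))
                                (Bin Mul (Reg 2) (Reg 10)))) = d.+1.
      by rewrite ev_inc eq5 //; lia.
    have ev_plus a b : eval w st3 (Bin Add a b) = (eval w st3 a + eval w st3 b) %% 2 ^ w by [].
    have eq7 : eval w st3 (Reg 9) = pot n num den i by [].
    by rewrite ev_plus eq6 eq7 modn_small; rewrite -[d.+1]addn1 -pE.
  apply: (@wp_assign _ _ _ i.+1); first by rewrite ev_inc /= r10 //; lia.
  exists (n.+2 - i.+1); split; first by lia.
  exists i.+1; split => //.
  - by ecosts; lia.
  - split => //=.
      by move=> r h1 h2; rewrite (negbTE h1) (negbTE h2) rr.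
    by move=> b h1 h2; rewrite (negbTE h1) (negbTE h2) bb.
  split => [j ji|v j jL] /=.
    by case: eqP => [->//|ne]; apply: tab; lia.
  rewrite idx2_eq; [|lia|lia].
  case: (v =P i.-1) => [->|ne] /=; last first.
    by rewrite lst // ltnS; congr (nat_of_bool (_ && _)); apply/idP/idP; lia.
  have i1' : 0 < i by lia.
  rewrite (ltn_predK i1') ltnS leqnn andbT; case: eqP => // ne.
  by rewrite lst //; case: eqP ne.
move=> k st2 T [i [iL kE Tb [r9 r10 rr bb] [tab lst]]].
have e10 : eval w st2 (Reg 10) = i by [].
have e5 : eval w st2 (Reg 5) = n by rewrite /= rr.
have e55 : eval w st2 (inc (inc (Reg 5))) = n.+2.
  by rewrite ev_inc ev_inc ?e5 //; lia.
rewrite ev_lt e55 e10 => /eqP; rewrite eqb0 -leqNgt => le.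
have iE : i = n.+2 by lia.
split => //; last by ecosts; lia.
- move=> j jn; rewrite tab /ztable; last by lia.
  by case: eqP jn => // ->.
- by move=> v j vn jL; rewrite lst // iE !ltnS ltnW // andbT.
Qed.

(** State for the empty graph: only the source is reached, and only the top level counts as scanned,
    in its single cell 1. *)
Definition A0 := Ast (fun v => (v == s) : nat) (fun=> 0) (fun _ j => (j == L) : nat)
  (fun _ _ => [::]) (fun _ _ => [::]) [:: s].

Lemma inv_init : inv A0 [::] no_pend [::].
Proof.
have Z0 (v : nat) : v < n -> Z ((v == s) : nat) <= Z 0.
  by move=> vn; apply: Z_le0; case: (v == s).
split => //=.
- move=> v vn; rewrite (@eq_count _ _ (pred1 s)); last first.
    by move=> x /=; case: (x == s).
  by rewrite count_uniq_mem ?iota_uniq // mem_iota /= sn; case: (v == s).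
- by rewrite eqxx.
- by move=> v vn; case: eqP.
- by move=> v vn; rewrite eqxx.
- by move=> v j vn jL; rewrite ltn_eqF.
- by move=> v; rewrite inE => /eqP->; rewrite eqxx.
- by move=> v vn; rewrite inE; case: eqP.
Qed.

Lemma wp_init_edges st (Es : seq (nat * nat)) : rep st A0 -> uniq Es ->
  (forall u x, (u, x) \in Es -> u < n /\ x < n) ->
  regs st 4 = size Es -> 2 * size Es < 2 ^ w ->
  (forall i, i < size Es -> banks st 0 (2 * i) = (nth (0, 0) Es i).1 /\
     banks st 0 (2 * i).+1 = (nth (0, 0) Es i).2) ->
  wp w (Seq drain init_edges) st (fun st' t => exists A, [/\ rep st' A,
    inv A Es no_pend [::], astk A = [::]
    & t + phi A <= phi A0 + 20 + size Es * (L.+1 * (alpha + 1000) + 50)]).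
Proof.
move=> R0 uE En r4 b2 cells; have [nM LM M1] := M_gt; have [w1 w2 w3] := W_facts.
apply: wp_seq; apply: wp_mono (wp_no_store (b := 0) _ (wp_drain R0 inv_init)) => //.
move=> st1 t1 [[A1 [R1 I1 s1 K1 ph1]] z1].
apply: wp_seq; apply: (@wp_assign _ _ _ 0); first by apply: ev_const; lia.
set st2 := set_reg _ _ _.
pose I k st3 T := exists A3 i, [/\ [/\ rep st3 A3, inv A3 (take i Es) no_pend [::]
     & astk A3 = [::]],
  [/\ i <= size Es, k = size Es - i & regs st3 9 = i],
  regs st3 4 = size Es /\ banks st3 0 = banks st 0
  & T + phi A3 <= phi A1 + i * (L.+1 * (alpha + 1000) + 50)].
have i0 : I (size Es) st2 0.
  exists A1, 0; split.
  - by split => //; [exact: rep_set_reg | rewrite take0].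
  - by rewrite subn0.
  - by split => //=; rewrite K1.
  - by rewrite addn0.
apply: (@wp_while _ _ _ I (size Es) _ _ _ _ i0).
- move=> k st3 T [A3 [i [[R3 I3 s3] [iE kE r9] [r4' z3] ph3]]].
  have e9 : eval w st3 (Reg 9) = i by [].
  have e4 : eval w st3 (Reg 4) = size Es by [].
  rewrite ev_lt e9 e4 eqb0 negbK => lt.
  have [c1 c2] := cells _ lt; have := mem_nth (0, 0) lt.
  case nE: (nth (0, 0) Es i) c1 c2 => [u x] /= c1 c2 uxE.
  have [un xn] := En _ _ uxE.
  have ev2 st' : regs st' 9 = i -> eval w st' (Bin Mul (Const 2) (Reg 9)) = 2 * i.
    by move=> r; rewrite [LHS]/= r modn_small modn_small; lia.
  apply: wp_seq; apply: (@wp_assign _ _ _ u).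
    by rewrite ev_fetch ev2 // z3.
  apply: wp_seq; apply: (@wp_assign _ _ _ x).
    by rewrite ev_fetch ev_inc ev2 //= ?z3 //; lia.
  set st4 := set_reg _ _ _.
  have R4 : rep st4 A3 by do 2![apply: rep_set_reg => //].
  have ux : (u, x) \notin take i Es.
    have : uniq (take i Es ++ drop i Es) by rewrite cat_take_drop.
    rewrite cat_uniq (drop_nth (0, 0) lt) nE.
    by case/and3P => _ /hasPn h _; apply: h; rewrite mem_head.
  apply: wp_seq.
  have := wp_insert_edge R4 I3 s3 un xn ux erefl erefl.
  move/(wp_no_store (b := 0) (c := insert_edge) isT); apply: wp_mono => st5 t5 [[A5 [R5 I5 s5 K5 ph5]] z5].
  have r9' : regs st5 9 = i by rewrite K5.
  apply: (@wp_assign _ _ _ i.+1); first by rewrite ev_inc /= r9' //; lia.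
  exists (size Es - i.+1); split; first by lia.
  exists A5, i.+1; split => //.
  - split => //; first exact: rep_set_reg.
    apply: inv_ext I5 _ _ => // e.
    by rewrite (take_nth (0, 0)) // mem_rcons nE.
  - by split; rewrite /= ?K5 // z5 /= z3.
  - by ecosts; rewrite mulSn; lia.
- move=> k st3 T [A3 [i [[R3 I3 s3] [iE kE r9] [r4' z3] ph3]]].
  have e9 : eval w st3 (Reg 9) = i by [].
  have e4 : eval w st3 (Reg 4) = size Es by [].
  rewrite ev_lt e9 e4 => /eqP; rewrite eqb0 -leqNgt => le.
  have iE' : i = size Es by lia.
  exists A3; split => //; first by move: I3; rewrite iE' take_size.
  by ecosts; rewrite iE' in ph3; lia.
Qed.

Lemma wp_init_all st (Es : seq (nat * nat)) num0 : num = minn num0 den -> 0 < num -> 0 < den ->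
  regs st 0 = n -> regs st 1 = s -> regs st 2 = num0 -> regs st 3 = den ->
  regs st 4 = size Es -> (forall b a, b != 0 -> banks st b a = 0) ->
  uniq Es -> (forall u x, (u, x) \in Es -> u < n /\ x < n) ->
  (forall i, i < size Es -> banks st 0 (2 * i) = (nth (0, 0) Es i).1 /\
     banks st 0 (2 * i).+1 = (nth (0, 0) Es i).2) ->
  4 * n * den < 2 ^ w -> num * n.+1 < 2 ^ w -> pot n num den n.+2 < 2 ^ w ->
  n.+2 < 2 ^ w -> 2 * size Es < 2 ^ w ->
  wp w init_all st (fun st' t => exists A, [/\ rep st' A,
    inv A Es no_pend [::], astk A = [::]
    & t + phi A <= phi A0 + 200 * (n + L.+3)
                   + size Es * (L.+1 * (alpha + 1000) + 50)]).
Proof.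
move=> numE num_gt den_gt r0 r1 r2 r3 r4 z uE En cells b1 b2 b3 b4 b5.
have [nM LM M1] := M_gt; have [w1 w2 w3] := W_facts.
apply: wp_seq; apply: (@wp_assign _ _ _ n) => //.
apply: wp_seq; apply: (@wp_assign _ _ _ s) => //.
set st1 := set_reg _ _ _.
apply: wp_seq.
have : wp w (If (Bin Lt (Reg 3) (Reg 2)) (Assign 2 (Reg 3)) Skip) st1 (fun st2 t2 =>
   [/\ regs st2 2 = num, banks st2 = banks st, t2 <= 10
     & forall r, r != 2 -> regs st2 r = regs st1 r]).
  apply: (@wp_if _ _ _ _ _ (den < num0)).
    by rewrite ev_lt eqb0 negbK /= r2 r3.
  case: ltnP => [lt|le].
    apply: (@wp_assign _ _ _ den) => //; split => //=; first by rewrite numE; lia.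
    by move=> r /negbTE->.
  by apply: wp_skip; split => //=; rewrite r2 numE; lia.
apply: wp_mono => st2 t2 [n2 bk2 t2b rr2].
apply: wp_seq; apply: wp_mono (wp_init_levels (st := st2) _); last by rewrite rr2.
move=> st3 t3 [[r7 r8] rr3 bb3 d3 t3b].
apply: wp_seq; apply: wp_mono (wp_init_table (st := st3) _ _ _ _ _ _ _ _ _ _ _ _) => //; last first.
- by move=> a; rewrite bb3 // bk2 z.
- by rewrite rr3 // rr2.
- by rewrite rr3.
- by rewrite rr3 // rr2.
move=> st4 t4 [rr4 bb4 z4 l4 t4b].
have r5 : regs st4 5 = n by rewrite rr4 // rr3 // rr2.
have r6 : regs st4 6 = s by rewrite rr4 // rr3 // rr2.
have r7' : regs st4 7 = M by rewrite rr4.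
have r8' : regs st4 8 = L by rewrite rr4.
have Zn : Z n.+1 = pot n num den n.+1 by [].
apply: wp_seq; apply: (@wp_store _ _ _ _ 0 (Z 0)); first by apply: ev_const; lia.
  have e : eval w st4 (inc (Reg 5)) = n.+1 by rewrite ev_inc /= r5; lia.
  have -> : eval w st4 (Bin Add (Fetch 4 (inc (Reg 5))) (Reg 7)) =
     (banks st4 4 (eval w st4 (inc (Reg 5))) + regs st4 7) %% 2 ^ w by [].
  rewrite e z4; last by lia.
  by rewrite r7' Zn modn_small // -[X in X < _]/(Z 0); lia.
set st5 := set_cell _ _ _ _.
apply: wp_seq; apply: (@wp_store _ _ _ _ L (Z 0).+1) => //.
  have e : eval w st5 (Fetch 4 (Const 0)) = Z 0.
    by rewrite ev_fetch ev_const //; lia.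
  by rewrite ev_inc e.
set st6 := set_cell _ _ _ _.
apply: wp_seq; apply: (@wp_store _ _ _ _ s 1) => //; first exact: ev_const.
apply: wp_seq; apply: (@wp_store _ _ _ _ 0 s) => //; first by apply: ev_const; lia.
apply: wp_seq; apply: (@wp_store _ _ _ _ s 1) => //; first exact: ev_const.
apply: wp_seq; apply: (@wp_assign _ _ _ 1); first exact: ev_const.
set st7 := set_reg _ _ _.
have z4' b a : b != 0 -> b != 4 -> b != 5 -> b != 6 -> banks st4 b a = 0.
  by move=> h0 h4 h5 h6; rewrite bb4 // bb3 // bk2 z.
have R7 : rep st7 A0.
  split => //=.
  - by move=> v vn; case: eqP => // _; rewrite z4'.
  - by move=> v vn; rewrite z4'.
  - move=> i ni; case: eqP => [->//|/eqP i0]; rewrite z4 //; lia.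
  - move=> j jL; rewrite /cell_width; case: eqP => [->|ne]; first by rewrite ltnn.
    have jL' : j < L by lia.
    by rewrite bb4 // jL' d3.
  - by move=> v j vn jL; rewrite z4'.
  - by move=> v j vn jL; rewrite z4'.
  - by case.
  - by move=> v vn; rewrite inE; case: eqP => // _; rewrite z4'.
have bk0 : banks st7 0 = banks st 0 by rewrite /= bb4 // bb3 // bk2.
have r4' : regs st7 4 = size Es by rewrite /= rr4 // rr3 // rr2.
have cells7 i : i < size Es -> banks st7 0 (2 * i) = (nth (0, 0) Es i).1 /\
     banks st7 0 (2 * i).+1 = (nth (0, 0) Es i).2 by rewrite bk0; apply: cells.
apply: wp_mono (wp_init_edges R7 uE En r4' b5 cells7) => st8 t8 [A [R8 I8 s8 ph8]].
exists A; split => //; ecosts; lia.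
Qed.

End Representation.

(** * The time budget *)

Section Budget.

Variables n num den s : nat.
Hypothesis sn : s < n.
Hypothesis num_gt : 0 < num.
Hypothesis num_le : num <= den.
Notation L := (levels n).
Notation Z := (ztable n num den).
Notation cell := (cell_of n num den).
Notation alpha := (300 * (levels n).+1).

(** The quotients sum to 4 n den L by the harmonic bound, the summands 1 to at most n den, and the
    offset of infinity to at most 2 n den; 7 = 4 + 1 + 2. *)
Lemma num_pot_le : num * Z 0 <= 7 * (n * den * L.+1).
Proof.
have h : num * pot n num den n.+1 <= 4 * n * den * L + num * n.
  rewrite /pot big_split /= mulnDr sum_nat_const_nat muln1 subn1 leq_add2r.
  have h1 := harmonic_le (4 * n * den) L; apply: leq_trans h1.
  rewrite (big_cat_nat (isT : 1 <= n.+1) (levelsP n)) /=.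
  apply: leq_trans (leq_addr _ _).
  rewrite big_distrr /=; apply: leq_sum => k _.
  by move: (4 * n * den) => X; rewrite mulnC [num * k]mulnC divnMA leq_trunc_div.
have := pow_levels_le (leq_ltn_trans (leq0n _) sn); rewrite /ztable /=; move: (pot _ _ _ _) (2 ^ L) h => p m h m2.
rewrite mulnDr mulnS; move: h m2 num_le; nia.
Qed.

(** All levels cost the same: level j has Z 0 / 2^j + 2 cells ahead at weight 2^(j+1), at most 4 Z 0
    because 2^(j+1) <= Z 0. *)
Lemma phi_init_le :
  phi n num den alpha (A0 n s) <= 300 * L.+1 + 700 * L.+1 * (n * n.+1)
     + 1300 * L.+1 * (n * (L * (4 * Z 0))).
Proof.
rewrite /phi /phi1 /watch_total /= big1 ?muln0 ?addn0 ?muln1; last first.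
  by move=> v _; apply: big1.
rewrite /phi2 -addnA leq_add2l; apply: leq_add.
  apply: leq_mul; first by lia.
  apply: (@leq_trans (\sum_(v < n) n.+1)); last by rewrite sum_nat_const card_ord.
  by apply: leq_sum => v _; rewrite /rank /=; case: (nat_of_ord v == s).
apply: leq_mul; first by lia.
apply: (@leq_trans (\sum_(v < n) (L * (4 * Z 0)))); last by rewrite sum_nat_const card_ord.
apply: leq_sum => v _.
apply: (@leq_trans (\sum_(j < L) 4 * Z 0)); last by rewrite sum_nat_const card_ord.
apply: leq_sum => j _; rewrite /cells_left /= (ltn_eqF (ltn_ord j)) /= /cell_of /cell_width ltn_ord.
have p0 : 0 < 2 ^ j by rewrite expn_gt0.
have jM : 2 ^ j.+1 <= Z 0.
  rewrite /ztable /=; apply: leq_trans (leq_addl _ _).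
  by rewrite leq_exp2l.
have := leq_trunc_div (Z 0) (2 ^ j).
move: jM; rewrite expnS; set a := Z 0 %/ 2 ^ j; move: a => a.
by move: p0; move: (Z 0) (2 ^ j) => c b p0; nia.
Qed.

Lemma total_le T m k : 1 < n -> m + k <= n * n ->
  T <= phi n num den alpha (A0 n s) + 200 * (n + L.+3)
       + m * (L.+1 * (alpha + 1000) + 50) + k * (L.+1 * (alpha + 1000)) ->
  num * T <= 100 * 100 * 7 * 27 * (n ^ 2 * up_log 2 n ^ 5 * den).
Proof.
move=> n1 mk TT.
have zl := num_pot_le.
set Z0 := Z 0 in zl; set l := L.+1 in zl TT *.
have nZ : n <= Z0.
  rewrite /Z0 /ztable /=; apply: leq_trans (leq_addl _ _); apply/ltnW/levelsP.
have lle : l <= 3 * up_log 2 n.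
  have u0 : 0 < up_log 2 n by rewrite up_log_gt0.
  have : L <= (up_log 2 n).+1.
    apply: up_log_min => //; rewrite expnS.
    by have := up_logP n (isT : 1 < 2); lia.
  by rewrite /l; lia.
have T1 : T <= 100 * 100 * (l * l * (n * Z0)).
  apply: leq_trans TT _; have := phi_init_le; rewrite -/Z0 -/l.
  have l1 : 1 < l by rewrite /l ltnS levels_gt0 //; lia.
  have Ll : L <= l by exact: leqnSn.
  have lE : l = L.+1 by [].
  move: (phi _ _ _ _ _) => ph hph.
  have a1 : n * n <= n * Z0 by rewrite leq_mul2l nZ orbT.
  have a2 : n * (L * (4 * Z0)) <= 4 * (l * (n * Z0)).
    have -> : n * (L * (4 * Z0)) = 4 * (L * (n * Z0)) by clear; lia.
    by rewrite leq_mul2l leq_mul2r Ll !orbT.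
  set q := n * Z0 in a1 a2 *; set lq := l * q.
  have q1 : n <= q by rewrite /q leq_pmulr //; lia.
  have b1 : l <= lq by rewrite /lq leq_pmulr //; lia.
  have b2 : q <= lq by rewrite /lq leq_pmull //; lia.
  have b3 : 2 * lq <= l * lq by rewrite leq_mul2r l1 orbT.
  have b4 : l * (n * n.+1) <= 2 * lq.
    have nn : n * n.+1 <= 2 * q by rewrite mulnS; move: a1 q1; lia.
    by apply: leq_trans (leq_mul (leqnn l) nn) _; rewrite mulnCA.
  have b5 : l * (n * (L * (4 * Z0))) <= 4 * (l * lq).
    by apply: leq_trans (leq_mul (leqnn l) a2) _; rewrite mulnCA.
  have b6 : m * (l * (300 * l + 1000) + 50) + k * (l * (300 * l + 1000))
      <= q * (l * (300 * l + 1000) + 50).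
    apply: (@leq_trans ((m + k) * (l * (300 * l + 1000) + 50))).
      by rewrite mulnDl leq_add2l leq_mul2l leq_addr orbT.
    by rewrite leq_mul2r (leq_trans mk a1) orbT.
  have b7 : q * (l * (300 * l + 1000) + 50) <= 300 * (l * lq) + 1000 * lq + 50 * q.
    by rewrite /lq; lia.
  have -> : l * l * q = l * lq by rewrite /lq mulnA.
  have q0 : n <= lq by exact: leq_trans q1 b2.
  rewrite -[700 * l * _]mulnA -[1300 * l * _]mulnA in hph.
  have b8 := leq_trans b6 b7; move: hph b1 b2 b3 b4 b5 b8 q0; clear -lE.
  move: (l * (n * n.+1)) (l * (n * (L * (4 * Z0)))) => c2 c3.
  move: (m * _) (k * _) (l * lq) => c4 c5 c6; lia.
have l3 : l ^ 3 <= 27 * up_log 2 n ^ 5.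
  apply: (@leq_trans ((3 * up_log 2 n) ^ 3)); first by rewrite leq_exp2r.
  rewrite expnMn leq_mul2l; apply/orP; right.
  by rewrite leq_pexp2l // up_log_gt0.
apply: (@leq_trans (100 * 100 * (l * l * n * (num * Z0)))).
  have -> : 100 * 100 * (l * l * n * (num * Z0)) = num * (100 * 100 * (l * l * (n * Z0))).
    by rewrite !mulnA; lia.
  by rewrite leq_mul2l T1 orbT.
apply: (@leq_trans (100 * 100 * (l * l * n * (7 * (n * den * l))))).
  by rewrite leq_mul2l leq_mul2l zl !orbT.
have -> : 100 * 100 * (l * l * n * (7 * (n * den * l))) =
   100 * 100 * 7 * (n ^ 2 * den * l ^ 3).
  by rewrite !expnS expn0; lia.
have -> : 100 * 100 * 7 * 27 * (n ^ 2 * up_log 2 n ^ 5 * den) =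
   100 * 100 * 7 * (n ^ 2 * den * (27 * up_log 2 n ^ 5)).
  by move: (n ^ 2) (_ ^ 5) => a b; lia.
by rewrite leq_mul2l leq_mul2l l3 !orbT.
Qed.

End Budget.

Import Order.TTheory GRing.Theory Num.Theory.

(** With N = n + num0 + den, the bounded quantities stay within 9 N^3, and 9 <= N^2 because the
    three summands are positive; hence the exponent 5. *)
Lemma word_bounds n num0 den num w : 0 < n -> 0 < num0 -> 0 < den ->
  num = minn num0 den -> (n + num0 + den) ^ 5 <= 2 ^ w ->
  [/\ 2 ^ levels n * 2 ^ levels n * 2 ^ levels n <= 2 ^ w,
      (ztable n num den 0).+1 < 2 ^ w, 4 * n * den < 2 ^ w, num * n.+1 < 2 ^ w &
  [/\ pot n num den n.+2 < 2 ^ w, n.+2 < 2 ^ w & 2 * (n * n) < 2 ^ w]].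
Proof.
move=> n0 num_gt den_gt numE; set N := n + num0 + den => NW.
have N3 : 3 <= N by rewrite /N; lia.
have nN : n.+2 <= N by rewrite /N; lia.
have uN : num <= N by rewrite /N numE; lia.
have dN : den <= N by rewrite /N; lia.
pose K := N * N * N.
have KN : 9 * K <= 2 ^ w.
  apply: leq_trans NW; rewrite !expnS expn0 muln1 /K.
  have : 9 <= N * N by nia.
  by move=> h; have := leq_mul h (leqnn (N * N * N)); rewrite -!mulnA.
have NN : 3 * N <= N * N by rewrite leq_mul2r N3 orbT.
have NK : 3 * (N * N) <= K by rewrite /K mulnC leq_mul2l N3 orbT.
have ml := pow_levels_le n0.
have mmm : 2 ^ levels n * 2 ^ levels n * 2 ^ levels n <= 8 * K.
  have mN : 2 ^ levels n <= 2 * N by lia.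
  have := leq_mul (leq_mul mN mN) mN; rewrite /K; lia.
have nd : n * den <= N * N by apply: leq_mul => //; lia.
have p2 i : i <= N -> pot n num den i <= 4 * K + N * N.
  move=> iN; apply: leq_trans (pot_le_lin _ _ _ _) _.
  rewrite -mulnA mulnDr muln1 leq_add //.
    rewrite mulnCA leq_mul2l /= /K -mulnA; exact: leq_mul.
  by nia.
have q1 := p2 n.+1 (ltnW nN); have q2 := p2 n.+2 nN.
have nn : n * n <= N * N by apply: leq_mul; lia.
have un : num * n.+1 <= N * N by apply: leq_mul => //; lia.
split; [lia | by rewrite /ztable /=; lia | by rewrite -mulnA; lia | lia | by split; lia].
Qed.

Section Dist.

Variables (V : finType) (e : rel V).

Lemma walkP x y k : reflect (exists p, [/\ path e x p, last x p = y & size p = k])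
  (walk e x y k).
Proof.
apply: (iffP existsP) => [[p /andP[h /eqP l]]|[p [h l <-]]].
  by exists p; rewrite size_tuple.
by exists (in_tuple p); rewrite h /= l.
Qed.

Lemma dist_spec x y : match dist e x y with
  | Some d => walk e x y d /\ forall k, walk e x y k -> d <= k
  | None => ~~ connect e x y end.
Proof.
rewrite /dist; case: {-}_ / idP => [c|/negP //].
by case: ex_minnP => d wd dm; split.
Qed.

End Dist.

(** * Runs on graphs over ['I_n] and the guarantees in rational form *)

Section Final.

Variables (n : nat) (s : 'I_n) (eps : rat).
Hypothesis eps_gt0 : (0 < eps)%R.
Notation num0 := `|numq eps|%N.
Notation den := `|denq eps|%N.
Notation num := (minn `|numq eps| `|denq eps|).
Notation alpha := (300 * (levels n).+1).
Notation L := (levels n).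
Notation rep := (rep n num den s).
Notation inv A E := (inv n num den s A E (fun _ _ _ : nat => false) [::]).
Notation phi := (phi n num den alpha).

Definition dynamic_sssp := Algorithm init_all insert_edge query_path.

Definition nat_edges (E : seq ('I_n * 'I_n)) : seq (nat * nat) :=
  [seq (val e.1, val e.2) | e <- E].

Lemma val2_inj : injective (fun e : 'I_n * 'I_n => (val e.1, val e.2)).
Proof. by move=> [a b] [c d] [/val_inj-> /val_inj->]. Qed.

Lemma mem_nat_edges E (u v : 'I_n) : ((val u, val v) \in nat_edges E) = ((u, v) \in E).
Proof. exact: (mem_map val2_inj E (u, v)). Qed.

Lemma nat_edges_lt E u v : (u, v) \in nat_edges E -> u < n /\ v < n.
Proof. by case/mapP => -[a b] _ [-> ->]. Qed.

Lemma num0_gt0 : 0 < num0.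
Proof. by rewrite absz_gt0 numq_eq0 gt_eqF. Qed.

Lemma den_gt0 : 0 < den.
Proof. by rewrite absz_gt0 denq_neq0. Qed.

Lemma num_gt0 : 0 < num.
Proof. by have := num0_gt0; have := den_gt0; lia. Qed.

Lemma size_uniq_edges (E : seq ('I_n * 'I_n)) : uniq E -> size E <= n * n.
Proof.
move/card_uniqP => <-; apply: leq_trans (max_card _) _.
by rewrite card_prod card_ord.
Qed.

Lemma nth_flatten_pairs (Es : seq (nat * nat)) i : i < size Es ->
  nth 0 (flatten [seq [:: e.1; e.2] | e <- Es]) (2 * i) = (nth (0, 0) Es i).1 /\
  nth 0 (flatten [seq [:: e.1; e.2] | e <- Es]) (2 * i).+1 = (nth (0, 0) Es i).2.
Proof.
elim: Es i => // -[a b] Es IH [|i] //; rewrite ltnS => /IH.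
by have -> : 2 * i.+1 = (2 * i).+2 by lia.
Qed.

Lemma graph_path E (p : seq 'I_n) (x : 'I_n) : path (graph_rel E) x p ->
  path (fun u v => (u, v) \in nat_edges E) x (map val p) /\
  last (val x) (map val p) = val (last x p).
Proof.
elim: p x => [|y p IH] x //= /andP[xy /IH[h1 h2]]; split => //.
by rewrite mem_nat_edges h1 andbT; exact: xy.
Qed.

Lemma nat_path E (p : seq nat) (x : 'I_n) :
  path (fun u v => (u, v) \in nat_edges E) x p ->
  exists q : seq 'I_n, map val q = p /\ path (graph_rel E) x q.
Proof.
elim: p x => [|y p IH] x /=; first by exists [::].
case/andP => xy; have [_ yn] := nat_edges_lt xy => py.
have [q [qE qp]] := IH (Ordinal yn) py; exists (Ordinal yn :: q); split.
  by rewrite /= qE.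
by rewrite /= qp andbT /graph_rel /= -mem_nat_edges.
Qed.

(** Capping eps at 1 is used here: (1 - eps/2) X <= l turns into X <= (1 + eps) l because num <=
    den. *)
Lemma estimate_bound A E (v : 'I_n) d : inv A (nat_edges E) -> astk A = [::] ->
  walk (graph_rel E) s v d -> 0 < ab A v /\ ((ab A v).-1%:R <= (1 + eps) * d%:R :> rat)%R.
Proof.
move=> I s0 /walkP[p [pp lp <-]]; have [np nl] := graph_path pp.
have [v0 le] := inv_approx num_gt0 (ltn_ord s) I s0 np.
move: v0 le; rewrite nl lp size_map => v0 le; split => //.
set X := (ab A v).-1 in le *; set l := size p.
have num_le : num <= den by lia.
have nat_le : den * X <= (den + num) * l.
  (* Multiply (2 den - num) X <= 2 den l by den + num; the left factor becomes at least 2 den^2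
     because num^2 <= den num. *)
  have h : 2 * den * (den * X) <= 2 * den * ((den + num) * l).
    have h1 := leq_mul (leqnn (den + num)) le; rewrite -/l in h1.
    have h2 : num * num * X <= den * num * X by rewrite !leq_mul.
    by move: h1 h2; clear; move: X l num den => *; lia.
  by move: h; rewrite leq_pmul2l // muln_gt0 den_gt0.
have nat_le' : den * X <= (den + num0) * l.
  by apply: leq_trans nat_le _; rewrite leq_mul2r; apply/orP; right; lia.
have dq : (0 < (denq eps)%:~R :> rat)%R by rewrite ltr0z denq_gt0.
have dE : ((den)%:R = (denq eps)%:~R :> rat)%R by rewrite -[in RHS](gtz0_abs (denq_gt0 eps)).
have nE : ((num0)%:R = (numq eps)%:~R :> rat)%R.
  by rewrite -[in RHS](@gtz0_abs (numq eps)) // numq_gt0.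
rewrite -(ler_pM2l dq) mulrA mulrDr mulr1.
have -> : ((denq eps)%:~R * eps = (numq eps)%:~R :> rat)%R.
  by rewrite -{2}(divq_num_den eps) mulrCA divff ?mulr1 // gt_eqF.
by rewrite -dE -nE -natrD -!natrM ler_nat.
Qed.

Lemma time_bound C T : num * T <= C * (n ^ 2 * up_log 2 n ^ 5 * den) ->
  (T%:R <= C%:R * (n%:R ^+ 2 * (up_log 2 n)%:R ^+ 5 / Num.min eps 1) :> rat)%R.
Proof.
move=> le.
have dq : (0 < den%:R :> rat)%R by rewrite ltr0n den_gt0.
have nq : (0 < num%:R :> rat)%R by rewrite ltr0n num_gt0.
have dE : ((den)%:R = (denq eps)%:~R :> rat)%R by rewrite -[in RHS](gtz0_abs (denq_gt0 eps)).
have nE : ((num0)%:R = (numq eps)%:~R :> rat)%R.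
  by rewrite -[in RHS](@gtz0_abs (numq eps)) // numq_gt0.
have mE : (Num.min eps 1 = num%:R / den%:R :> rat)%R.
  have eE : (eps = num0%:R / den%:R)%R by rewrite dE nE divq_num_den.
  have [h|h] := leqP num0 den.
    rewrite [in LHS]eE; apply/min_idPl.
    by rewrite ler_pdivrMr // mul1r ler_nat.
  rewrite [in LHS]eE divff ?gt_eqF //; apply/min_idPr.
  by rewrite ler_pdivlMr // mul1r ler_nat ltnW.
rewrite mE invf_div [leRHS](_ : _ = (C * (n ^ 2 * up_log 2 n ^ 5 * den))%:R / num%:R)%R.
  by rewrite ler_pdivlMr // mulrC -natrM ler_nat.
by rewrite natrM natrM natrM natrX natrX !mulrA.
Qed.

Variable w : nat.
Hypothesis HW : (n + num0 + den) ^ 5 <= 2 ^ w.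

Let n0 : 0 < n.
Proof. exact: leq_trans (ltn_ord s). Qed.

Let bounds := word_bounds n0 num0_gt0 den_gt0 erefl HW.

Lemma exec_init E0 : uniq E0 -> exists st t A,
  [/\ exec w init_all (input s eps E0) st t, rep st A, inv A (nat_edges E0),
      astk A = [::] & t + phi A <= phi (A0 n s) + 200 * (n + L.+3)
         + size E0 * (L.+1 * (alpha + 1000) + 50)].
Proof.
move=> uE; have [W1 W2 b1 b2 [b3 b4 b5]] := bounds.
have szE : size (nat_edges E0) = size E0 by rewrite size_map.
have uE' : uniq (nat_edges E0) by rewrite map_inj_uniq //; exact: val2_inj.
have cells i : i < size (nat_edges E0) ->
    banks (input s eps E0) 0 (2 * i) = (nth (0, 0) (nat_edges E0) i).1 /\
    banks (input s eps E0) 0 (2 * i).+1 = (nth (0, 0) (nat_edges E0) i).2.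
  move/nth_flatten_pairs; rewrite /nat_edges -map_comp //.
have b6 : 2 * size (nat_edges E0) < 2 ^ w.
  by apply: leq_ltn_trans b5; rewrite leq_mul2l szE size_uniq_edges.
have z b a : b != 0 -> banks (input s eps E0) b a = 0 by move=> /negbTE /= ->.
have [st [t [ex [A [R I s0 ph]]]]] := wp_init_all (ltn_ord s) W1 W2 (leqnn alpha)
  (st := input s eps E0) erefl num_gt0 den_gt0 erefl erefl erefl erefl
  (esym szE) z uE' (@nat_edges_lt E0) cells b1 b2 b3 b4 b6.
by exists st, t, A; split => //; rewrite -szE.
Qed.

Definition run_budget (E0 : seq ('I_n * 'I_n)) k :=
  phi (A0 n s) + 200 * (n + L.+3) + size E0 * (L.+1 * (alpha + 1000) + 50)
  + k * (L.+1 * (alpha + 1000)).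

(** The answer is the parent path. Its length is at most the estimate, so the error bound carries
    over, and the time is linear in its own number of edges. *)
Lemma query_correct st A E (v : 'I_n) : rep st A -> inv A (nat_edges E) ->
  astk A = [::] ->
  exists st' t k, [/\ exec w query_path (set_reg st 0 v) st' t,
    answers E eps s v st' k, t <= 100 * k.+1 & rep st' A].
Proof.
move=> R I s0; have [W1 W2 _ _ _] := bounds.
have R0 : rep (set_reg st 0 v) A by exact: rep_set_reg.
have [v0|v0] := posnP (ab A v).
  have [st' [t [ex [un r0 tb]]]] :=
    wp_query_none (ltn_ord s) W1 W2 R0 (ltn_ord v) erefl v0.
  exists st', t, 0; split => //; [|lia|exact: unchanged_rep un R0].
  rewrite /answers; have := dist_spec (graph_rel E) s v.
  case: (dist _ _ _) => [d [wd _]|//].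
  by have [] := estimate_bound I s0 wd; rewrite v0.
have [p [h1 h2 [h3 h4] h5 h6]] := parent_chain I (ltn_ord v) v0.
have pn y : y \in val s :: p -> y < n by case/h4.
have [st' [t [ex [un r0 cells tb]]]] :=
  wp_query_path (ltn_ord s) W1 W2 R0 (ltn_ord v) v0 erefl h3 pn h6.
exists st', t, (size p); split => //; last exact: unchanged_rep un R0.
have [q [qE qp]] := nat_path h1.
have lq : last s q = v.
  by have [_] := graph_path qp; rewrite qE h2 => /val_inj.
rewrite /answers; have := dist_spec (graph_rel E) s v.
case: (dist _ _ _) => [d [wd _]|]; last first.
  by case/negP; apply/connectP; exists q.
have [_ le] := estimate_bound I s0 wd.
exists q; split; last by rewrite r0 cells /= qE.
split => //; last 1 first.
- by apply: le_trans le; rewrite ler_nat.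
- by rewrite -(map_inj_uniq val_inj) /= qE.
- by rewrite -qE size_map.
Qed.

Lemma run_exists E0 ops : uniq (E0 ++ inserted ops) -> exists st T A,
  [/\ run w dynamic_sssp s eps E0 ops st T, rep st A,
      inv A (nat_edges (E0 ++ inserted ops)), astk A = [::]
    & T + phi A <= run_budget E0 (size (inserted ops))].
Proof.
have [W1 W2 _ _ _] := bounds.
elim/last_ind: ops => [|ops o IH].
  rewrite /inserted /= cats0 => /exec_init[st [t [A [ex R I s0 ph]]]].
  exists st, t, A; split => //; first exact: RunInit.
  by rewrite /run_budget addn0.
have insE : inserted (rcons ops o) =
    inserted ops ++ (if o is Insert u v then [:: (u, v)] else [::]).
  by rewrite /inserted -cats1 pmap_cat; case: o.
case: o insE => [u v|v] insE; rewrite insE ?cats0; last first.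
  move=> /IH[st [T [A [rn R I s0 ph]]]].
  have [st' [t [k [ex _ _ R']]]] := query_correct v R I s0.
  by exists st', T, A; split => //; apply: RunQuery rn ex.
rewrite catA cats1 rcons_uniq => /andP[uv /IH[st [T [A [rn R I s0 ph]]]]].
have R' : rep (set_reg (set_reg st 0 u) 1 v) A by do 2![apply: rep_set_reg => //].
have uv' : (val u, val v) \notin nat_edges (E0 ++ inserted ops) by rewrite mem_nat_edges.
have [st' [t [ex [A' [R1 I1 s1 _ ph1]]]]] :=
  wp_insert_edge (ltn_ord s) W1 W2 (leqnn alpha) R' I s0 (ltn_ord u) (ltn_ord v)
    uv' erefl erefl.
exists st', (T + t), A'; split => //; first exact: RunInsert rn ex.
  apply: inv_ext I1 _ _ => // e.
  by rewrite /nat_edges map_rcons mem_rcons.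
move: ph ph1; rewrite /run_budget size_cat /= addn1 [(size _).+1 * _]mulSn.
move: (_ * (alpha + 1000)) => c.
by move: (phi A) (phi A') => a1 a2; lia.
Qed.

End Final.

Theorem theorem6 :
  exists (A : algorithm) (c Ctime Cquery : nat),
  forall (n : nat) (s : 'I_n) (eps : rat) (E0 : seq ('I_n * 'I_n))
         (ops : seq (op n)) (w : nat),
    (0 < eps)%R ->
    uniq (E0 ++ inserted ops) ->
    (n + `|numq eps| + `|denq eps|) ^ c <= 2 ^ w ->
    exists (st : state) (T : nat),
      [/\ run w A s eps E0 ops st T,
          forall v : 'I_n,
            approximates eps (dist (graph_rel (E0 ++ inserted ops)) s v)
              (estimate st v),
          1 < n ->
            (T%:R <= Ctime%:R * (n%:R ^+ 2 * (up_log 2 n)%:R ^+ 5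
                                 / Num.min eps 1))%R
        & forall v : 'I_n,
            exists (st' : state) (t k : nat),
              [/\ exec w (query A) (set_reg st 0 v) st' t,
                  answers (E0 ++ inserted ops) eps s v st' k
                & t <= Cquery * k.+1]].
Proof.
(* The exponent is that of [word_bounds], the time constant that of [total_le], and 100 is the cost
   per edge in [wp_query_path]. *)
exists dynamic_sssp, 5, (100 * 100 * 7 * 27), 100.
move=> n s eps E0 ops w eps_gt0 uE HW.
have [st [T [A [rn R I s0 ph]]]] := run_exists s eps_gt0 HW uE.
exists st, T; split.
- exact: rn.
- move=> v; rewrite /estimate (p_b R) //.
  have := dist_spec (graph_rel (E0 ++ inserted ops)) s v.
  case: (dist _ _ _) => [d [wd dm]|nc].
    have [v0 le] := estimate_bound eps_gt0 I s0 wd.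
    case vE: (ab A v) v0 le => [|k] // _ le; split => //.
    have v0 : 0 < ab A v by rewrite vE.
    (* The parent path is a walk from s to v no longer than the estimate: this is the bound d(s,v)
       <= estimate. *)
    have [p [h1 h2 _ h5 _]] := parent_chain I (ltn_ord v) v0.
    have [q [qE qp]] := nat_path h1.
    have lq : last s q = v by have [_] := graph_path qp; rewrite qE h2 => /val_inj.
    rewrite vE /= in h5; apply: leq_trans h5; apply: dm; apply/walkP.
    by exists q; rewrite -qE size_map.
  case vE: (ab A v) => [|k] //.
  have v0 : 0 < ab A v by rewrite vE.
  have [p [h1 h2 _ _ _]] := parent_chain I (ltn_ord v) v0.
  have [q [qE qp]] := nat_path h1.
  have lq : last s q = v by have [_] := graph_path qp; rewrite qE h2 => /val_inj.
  by case/negP: nc; apply/connectP; exists q.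
- move=> n1; apply: (time_bound eps_gt0).
  apply: (total_le (ltn_ord s) (num_gt0 eps_gt0) (geq_minr _ _) n1
            (m := size E0) (k := size (inserted ops))).
    by rewrite -size_cat; apply: size_uniq_edges.
  exact: leq_trans (leq_addr _ _) ph.
- move=> v; have [st' [t [k [ex an tb _]]]] := query_correct eps_gt0 HW v R I s0.
  by exists st', t, k.
Qed.
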